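(* For every $\hbar\in N(12A_2)$ with $\hbar^2=12$ and every geometric set $\mathfrak L\subset\mathfrak F(\hbar)$ one has $|\mathfrak L|\le350$.
   Context: $N(12A_2)$ is the Niemeier lattice (positive definite even unimodular of rank $24$) whose root system is $12A_2$. For $\hbar\in N$, $\hbar^2=12$, let $\mathfrak F(\hbar)=\{l\in N: l^2=4,\ l\cdot\hbar=4\}$. For $\mathfrak L\subset\mathfrak F(\hbar)$ let $\operatorname{span}_2\mathfrak L$ be the set of $v\in N$ some odd multiple of which lies in $\mathbb Z\mathfrak L+\mathbb Z\hbar$. $\mathfrak L$ is complete if $\mathfrak L=\mathfrak F(\hbar)\cap\operatorname{span}_2\mathfrak L$, admissible if $\operatorname{span}_2\mathfrak L$ has no vector of square $2$. A finite index extension $S\supset\operatorname{span}_2\mathfrak L$ in $N$ is mild if $\hbar\in4S^\vee$ and $S$ has no vector of square $2$. A complete admissible $\mathfrak L$ is geometric if some mild extension $S$ satisfies $\mathfrak L=\mathfrak F(\hbar)\cap S$ and, with $\delta=23-\operatorname{rank}S$ and $\mathcal S=S^\vee/S$ (with its discriminant quadratic form): (1) $\operatorname{rank}S\le21$; (2) for each prime $p>2$, $\ell(\mathcal S_p)<\delta$, or $\ell(\mathcal S_p)=\delta$ and $\det\mathcal S_p=|\mathcal S|\bmod(\mathbb Q_p^\times)^2$; (3) $\ell(\mathcal S_2)\le\delta+1$, and if equality holds then $\mathcal S_2$ is odd or $\det\mathcal S_2=\pm3|\mathcal S|\bmod(\mathbb Q_2^\times)^2$. ($\mathcal S_p$: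 $p$-primary part; $\ell$: minimal number of generators; $\det$: determinant of the Gram matrix on a minimal generating set; $\mathcal S_2$ odd if some order-2 element has non-integral square.) *)

(* Defs.v *)
(* Lattice vectors are rational row vectors of length 36
   (12 blocks of 3 coordinates), with the standard dot product. *)
From mathcomp Require Import all_boot all_order all_algebra zify.
From Stdlib Require Import Lia.
Set Implicit Arguments. Unset Strict Implicit. Unset Printing Implicit Defensive.
Import Order.TTheory GRing.Theory Num.Theory.
Local Open Scope ring_scope.

Notation vec := 'rV[rat]_36.

Definition dot (u v : vec) : rat := \sum_(i < 36) u 0 i * v 0 i.

Definition isZ (x : rat) : Prop := x \is a Num.int.

Lemma blk_lt (b : 'I_12) (k : 'I_3) : (3 * b + k < 36)%N.
Proof. case: b k => [b Hb] [k Hk] /=; lia. Qed.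
Definition blk (v : vec) (b : 'I_12) (k : 'I_3) : rat :=
  v 0 (Ordinal (blk_lt b k)).

(* Generator matrix [I_6 | A] of the extended ternary Golay code
   (a self-dual [12,6,6] code over F_3). *)
Definition golayA : seq (seq nat) :=
  [:: [:: 0; 1; 1; 1; 1; 1]%N; [:: 1; 0; 1; 2; 2; 1]%N; [:: 1; 1; 0; 1; 2; 2]%N;
      [:: 1; 2; 1; 0; 1; 2]%N; [:: 1; 2; 2; 1; 0; 1]%N; [:: 1; 1; 2; 2; 1; 0]%N].
Definition golayG (i : 'I_6) (j : 'I_12) : int :=
  if (j < 6)%N then (if (j == i :> nat) then 1 else 0)
  else (nth 0%N (nth [::] golayA i) (j - 6))%:Z.

Definition in_golay (w : 'I_12 -> int) : Prop :=
  exists a : 'I_6 -> int, forall j : 'I_12,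
    (w j = \sum_(i < 6) a i * golayG i j %[mod 3])%Z.

(* The Niemeier lattice N(12A_2): vectors of (A_2^* )^12, where
   A_2 = {x in Z^3 : sum x = 0} and A_2^* = {(a,b,c)/3 : a+b+c=0, a=b=c mod 3},
   whose glue word (classes in A_2^*/A_2 = Z/3) lies in the Golay code. *)

Definition inN (v : vec) : Prop :=
  (forall i, isZ (3 * v 0 i)) /\
  (forall b : 'I_12,
     blk v b 0 + blk v b 1 + blk v b 2 = 0 /\
     isZ (blk v b 0 - blk v b 1) /\ isZ (blk v b 0 - blk v b 2)) /\
  exists w : 'I_12 -> int,
    (forall b, 3 * blk v b 0 = (w b)%:~R) /\ in_golay w.

Definition inF (h l : vec) : Prop := inN l /\ dot l l = 4 /\ dot l h = 4.

Definition in_ZLh (h : vec) (L : seq vec) (v : vec) : Prop :=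
  exists (c : nat -> int) (d : int),
    v = \sum_(i < size L) (nth 0 L i *~ c i) + h *~ d.

Definition in_span2 (h : vec) (L : seq vec) (v : vec) : Prop :=
  inN v /\ exists k : nat, odd k /\ in_ZLh h L (k%:R *: v).

Definition complete (h : vec) (L : seq vec) : Prop :=
  forall v, v \in L <-> (inF h v /\ in_span2 h L v).

Definition admissible (h : vec) (L : seq vec) : Prop :=
  forall v, in_span2 h L v -> dot v v <> 2.

Definition sublattice_of_N (S : vec -> Prop) : Prop :=
  S 0 /\ (forall u v, S u -> S v -> S (u - v)) /\ (forall v, S v -> inN v).

Definition inQS (S : vec -> Prop) (x : vec) : Prop :=
  exists m : nat, (0 < m)%N /\ S (m%:R *: x).
Definition inDual (S : vec -> Prop) (x : vec) : Prop :=
  inQS S x /\ forall s, S s -> isZ (dot x s).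

Definition finite_index (T S : vec -> Prop) : Prop :=
  exists reps : seq vec, forall s, S s -> exists2 r, r \in reps & T (s - r).

Definition mild (h : vec) (L : seq vec) (S : vec -> Prop) : Prop :=
  sublattice_of_N S /\ (forall v, in_span2 h L v -> S v) /\
  finite_index (in_span2 h L) S /\
  inDual S ((1/4 : rat) *: h) /\
  (forall v, S v -> dot v v <> 2).

Definition rankS (S : vec -> Prop) (r : nat) : Prop :=
  exists B : 'M[rat]_(r, 36),
    (forall i, S (row i B)) /\ row_free B /\ (forall s, S s -> (s <= B)%MS).

Definition discr_order (S : vec -> Prop) (n : nat) : Prop :=
  exists reps : seq vec, size reps = n /\ (forall r, r \in reps -> inDual S r) /\
    (forall i j, (i < n)%N -> (j < n)%N -> S (nth 0 reps i - nth 0 reps j) -> i = j) /\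
    (forall x, inDual S x -> exists2 r, r \in reps & S (x - r)).

(* p-primary part of the discriminant group (as representatives in S^v) *)
Definition inPrim (S : vec -> Prop) (p : nat) (x : vec) : Prop :=
  inDual S x /\ exists k : nat, S ((p ^ k)%:R *: x).

Definition generates (S : vec -> Prop) (p : nat) (e : seq vec) : Prop :=
  (forall x, x \in e -> inPrim S p x) /\
  (forall x, inPrim S p x -> exists c : nat -> int,
      S (x - \sum_(i < size e) (nth 0 e i *~ c i))).

Definition ell (S : vec -> Prop) (p m : nat) : Prop :=
  (exists e, size e = m /\ generates S p e) /\
  (forall e, generates S p e -> (m <= size e)%N).

Definition gram (e : seq vec) : 'M[rat]_(size e) :=
  \matrix_(i, j) dot (nth 0 e i) (nth 0 e j).

(* a and b are nonzero and equal modulo (Q_p^x)^2, i.e. a/b lies in the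
   p-adic closure of the rational squares *)
Definition sq_class_eq (p : nat) (a b : rat) : Prop :=
  a != 0 /\ b != 0 /\
  forall n : nat, exists x : rat, coprime p `|denq ((x ^+ 2 - a / b) / (p%:R ^+ n))|%N.

Definition det_eq (S : vec -> Prop) (p : nat) (c : rat) : Prop :=
  exists e, generates S p e /\ ell S p (size e) /\ sq_class_eq p (\det (gram e)) c.

Definition odd2 (S : vec -> Prop) : Prop :=
  exists x, inDual S x /\ ~ S x /\ S (2%:R *: x) /\ ~ isZ (dot x x).

Definition geometric (h : vec) (L : seq vec) : Prop :=
  complete h L /\ admissible h L /\
  exists S : vec -> Prop, mild h L S /\
    (forall v, v \in L <-> (inF h v /\ S v)) /\
    exists (r n : nat), rankS S r /\ discr_order S n /\
      let delta := (23 - r)%N in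
      (r <= 21)%N /\
      (forall p : nat, prime p -> (2 < p)%N ->
         exists m, ell S p m /\
           ((m < delta)%N \/ (m = delta /\ det_eq S p n%:R))) /\
      (exists m, ell S 2 m /\ (m <= delta.+1)%N /\
         (m = delta.+1 -> odd2 S \/ det_eq S 2 (3 * n%:R) \/ det_eq S 2 (- 3 * n%:R))).

(* Main.v *)
(* Only three features of a geometric set L matter: differences of its elements are not
   roots, no root r has 3 r in Z L + Z h, and L and h lie in a space of dimension 21.

   The group W(A_2)^12 : 2.M_12 has at most 29 orbits on the vectors h of norm 12.  For fixed h,
   the stabiliser of h in W(A_2)^12 splits F(h) into orbits, products of block orbits
   of size 1, 2 or 3; two elements of L in one orbit differ in at least two blocks, for
   otherwise they differ by a root.  So an orbit contributes at most the product of
   its block sizes without the largest one, and for 24 of the 29 vectors h these bounds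
   add up to at most 350.

   For the orbit of h with bounds 15 * 27, three times a root bounds each contribution
   by 21.  The remaining four sums are 351, 379, 393 and 407.  Take w orthogonal to h and
   L.  If some wall (the root of a block orthogonal to h) is not orthogonal to w, the
   orbits through both kinds of walls contribute less.  If all walls are orthogonal
   to w, each orbit lies in the hyperplane of w or misses L; a dual frame shows
   that many orbits miss L unless w = 0.  When the sum is 351, equality everywhere
   forces w = 0 directly. *)

(* In a zero block of h the six roots are split into three pairs instead of being kept as one orbit:
   the counting needs any two members of a block class to differ by a root. The span of L and h has
   rank at most 21 in dimension 24, so w can be asked to satisfy two further linear conditions, and
   the exceptional cases spend them. Reflecting one block of x in a wall root changes the product of
   x with w by a multiple of the product of w with that root, so a wall seen by w ties the choices
   in different blocks together. The resulting sums are verified when w sees at least two of the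
   available walls but not all of them. One condition therefore makes w miss a chosen wall; if w
   then sees a single wall, a second such vector is made to miss that wall, and the sum of the two
   sees exactly two walls. The other condition removes a direction that the estimates do not
   control. When w sees no wall, the assumption that L has more than 350 elements limits the total
   cap of the orbits that miss L, and the frame inequality turns this limit into w = 0. *)
Require Import Defs.
From Stdlib Require Import ZArith Lia MSetPositive.
From mathcomp Require Import all_boot all_order all_algebra.
From mathcomp Require Import ssrZ zify lra.
Set Implicit Arguments. Unset Strict Implicit. Unset Printing Implicit Defensive.
Import GRing.Theory Num.Theory.
Delimit Scope Z_scope with BZ.

(* A vector v is represented by the 12 triples of integers 3 v, so [vdot] is 9 times
   the scalar product: norms 2, 4, 12 become 18, 36, 108. *)
Definition block : Type := (Z * Z * Z)%type.
Definition b0 : block := (0, 0, 0)%BZ.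
Definition bfst (u : block) : Z := u.1.1.
Definition bdot (u v : block) : Z :=
  (u.1.1 * v.1.1 + u.1.2 * v.1.2 + u.2 * v.2)%BZ.
Definition bsum (u : block) : Z := (u.1.1 + u.1.2 + u.2)%BZ.

Fixpoint vdot (x y : seq block) : Z :=
  match x, y with
  | u :: x', v :: y' => (bdot u v + vdot x' y')%BZ
  | _, _ => 0%BZ
  end.

Definition rows : seq (seq Z) := Eval vm_compute in
  mkseq (fun i => mkseq (fun j =>
    if (j < 6)%N then (if j == i then 1%BZ else 0%BZ)
    else Z.of_nat (nth 0%N (nth [::] golayA i) (j - 6))) 12) 6.
Definition gij (i j : nat) : Z := nth 0%BZ (nth [::] rows i) j.
Definition lin (a : nat -> Z) (j : nat) : Z :=
  (a 0%N * gij 0 j + a 1%N * gij 1 j + a 2%N * gij 2 j +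
   a 3%N * gij 3 j + a 4%N * gij 4 j + a 5%N * gij 5 j)%BZ.

Definition bok (u : block) : Prop :=
  (bsum u = 0 /\ (u.1.1 - u.1.2) mod 3 = 0 /\ (u.1.1 - u.2) mod 3 = 0)%BZ.

Definition inNz (x : seq block) : Prop :=
  size x = 12 /\ (forall j, (j < 12)%N -> bok (nth b0 x j)) /\
  exists a : nat -> Z, forall j, (j < 12)%N ->
    ((bfst (nth b0 x j) - lin a j) mod 3 = 0)%BZ.

Definition inFz (h x : seq block) : Prop :=
  inNz x /\ vdot x x = 36%BZ /\ vdot x h = 36%BZ.

(* What the argument uses of a geometric set: there are no roots x - y, nor roots r
   with 3 r in the span, and the orthogonal complement has dimension at least 3
   (so it meets any two hyperplanes). *)
Record config (h : seq block) (L : seq (seq block)) : Prop := Config {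
  config_uniq : uniq L;
  config_F : forall x, x \in L -> inFz h x;
  config_root : forall x y, x \in L -> y \in L -> vdot x y <> 27%BZ;
  config_triple : forall a1 a2 a3 b1 b2 b3 r,
    a1 \in L -> a2 \in L -> a3 \in L -> b1 \in L -> b2 \in L -> b3 \in L ->
    inNz r ->
    (forall z, size z = 12 ->
      (vdot z a1 - 2 * vdot z a2 + vdot z a3
       - (vdot z b1 - 2 * vdot z b2 + vdot z b3) = 3 * vdot z r)%BZ) ->
    vdot r r <> 18%BZ;
  config_perp : forall f1 f2 : seq block, size f1 = 12 -> size f2 = 12 ->
    exists w, [/\ size w = 12, forall j, bsum (nth b0 w j) = 0%BZ, w <> nseq 12 b0,
      vdot h w = 0%BZ & (forall x, x \in L -> vdot x w = 0%BZ) /\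
      vdot f1 w = 0%BZ /\ vdot f2 w = 0%BZ] }.

Definition bounded (h : seq block) : Prop :=
  forall L, config h L -> (size L <= 350)%N.

(** * Transport along isometries that preserve the lattice *)

Record isom (A A' : seq block -> seq block) : Prop := Isom {
  isom_size : forall x, size x = 12 -> size (A x) = 12;
  isom_dot : forall x y, size x = 12 -> size y = 12 -> vdot (A x) (A y) = vdot x y;
  isom_N : forall x, inNz x -> inNz (A x);
  isom_sum : forall x, size x = 12 -> (forall j, bsum (nth b0 x j) = 0%BZ) ->
    forall j, bsum (nth b0 (A x) j) = 0%BZ;
  isom_K : forall x, size x = 12 -> A' (A x) = x }.

Lemma inNz_size x : inNz x -> size x = 12. Proof. by case. Qed.

Lemma bdotC u v : bdot u v = bdot v u. Proof. rewrite /bdot; lia. Qed.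

Lemma vdotC x y : vdot x y = vdot y x.
Proof. by elim: x y => [|u x IH] [|v y] //=; rewrite bdotC IH. Qed.

Lemma vdot_nseq0 n x : vdot (nseq n b0) x = 0%BZ.
Proof. by elim: n x => [|n IH] [|v x] //=; rewrite IH. Qed.

Lemma bsqr_eq0 u : bdot u u = 0%BZ -> u = b0.
Proof.
case: u => [[a b] c]; rewrite /bdot /b0 /= => H.
have -> : a = 0%BZ by nia.
have -> : b = 0%BZ by nia.
by have -> : c = 0%BZ by nia.
Qed.

Lemma vsqr_ge0 x : (0 <= vdot x x)%BZ.
Proof. elim: x => //= u x IH; rewrite /bdot; nia. Qed.
Arguments vsqr_ge0 : clear implicits.

Lemma vsqr_eq0 x : vdot x x = 0%BZ -> x = nseq (size x) b0.
Proof.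
elim: x => //= u x IH H; have H1 := vsqr_ge0 x.
have H2 : (0 <= bdot u u)%BZ by rewrite /bdot; nia.
have [Eu Ex] : bdot u u = 0%BZ /\ vdot x x = 0%BZ by clear -H H1 H2; lia.
by rewrite (bsqr_eq0 Eu) [in LHS]IH.
Qed.

Lemma vdotE n x y : size x = n -> size y = n ->
  vdot x y = (\sum_(0 <= j < n) bdot (nth b0 x j) (nth b0 y j))%R.
Proof.
elim: n x y => [|n IH] [|u x] [|v y] //=; first by rewrite big_geq.
by move=> [xs] [ys]; rewrite big_nat_recl // (IH x y xs ys).
Qed.

(** Each clause of [config] is expressed by scalar products and membership in N, so the image of L
    is a configuration for [A h]. Test vectors are pulled back by [A'], and the vectors found are
    pushed forward by [A]. *)
Lemma bounded_isom A A' h : isom A A' -> isom A' A -> inNz h ->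
  bounded (A h) -> bounded h.
Proof.
move=> i1 i2 Nh B L gL.
have hs := inNz_size Nh.
have sL x : x \in L -> size x = 12 by move=> /(config_F gL) [/inNz_size].
have tr z x : size z = 12 -> x \in L -> vdot z (A x) = vdot (A' z) x.
  by move=> zs xL; rewrite -{1}(isom_K i2 zs) (isom_dot i1) ?(isom_size i2) ?(sL x xL).
rewrite -(size_map A L); apply: B; split.
- rewrite map_inj_in_uniq ?(config_uniq gL) // => x y xL yL E.
  by rewrite -(isom_K i1 (sL x xL)) E (isom_K i1 (sL y yL)).
- move=> _ /mapP [x xL ->]; have [Nx [n1 n2]] := config_F gL xL.
  by split; [apply: (isom_N i1) | rewrite !(isom_dot i1) ?(sL x xL)].
- move=> _ _ /mapP [x xL ->] /mapP [y yL ->].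
  by rewrite (isom_dot i1) ?(sL x xL) ?(sL y yL) //; apply: (config_root gL).
- move=> _ _ _ _ _ _ r /mapP [a1 A1 ->] /mapP [a2 A2 ->] /mapP [a3 A3 ->]
    /mapP [b1 B1 ->] /mapP [b2 B2 ->] /mapP [b3 B3 ->] Nr R.
  have rs := inNz_size Nr.
  rewrite -(isom_K i2 rs) (isom_dot i1) ?(isom_size i2) //.
  apply: (config_triple gL A1 A2 A3 B1 B2 B3 (isom_N i2 Nr)) => z zs.
  have := R (A z) (isom_size i1 zs); rewrite ?(isom_dot i1, sL _ A1, sL _ A2, sL _ A3, sL _ B1, sL _ B2, sL _ B3) // => ->.
  by rewrite -(isom_dot i2) ?(isom_size i1) // (isom_K i1).
- move=> f1 f2 s1 s2.
  have [w [ws w0 wn wh [wL [wf1 wf2]]]] :=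
    config_perp gL (isom_size i2 s1) (isom_size i2 s2).
  exists (A w); split.
  + exact: (isom_size i1).
  + exact: (isom_sum i1).
  + move=> E; apply: wn.
    have : vdot w w = 0%BZ by rewrite -(isom_dot i1) // E vdot_nseq0.
    by move/vsqr_eq0; rewrite ws.
  + by rewrite (isom_dot i1).
  + split; first by move=> _ /mapP [x xL ->]; rewrite (isom_dot i1) ?(sL x xL) // wL.
    by rewrite -(isom_K i2 s1) -(isom_K i2 s2) !(isom_dot i1) ?(isom_size i2).
Qed.

(** * Integer coordinates *)

Section RationalCoordinates.
Local Open Scope ring_scope.

Definition qz (z : Z) : rat := (int_of_Z z)%:~R.
Definition zq (x : rat) : Z := Z_of_int (numq x).

Lemma qzK z : zq (qz z) = z. Proof. by rewrite /zq /qz numq_int int_of_ZK. Qed.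
Lemma zqK x : isZ x -> qz (zq x) = x.
Proof. by move=> /intrP [m ->]; rewrite /qz /zq numq_int Z_of_intK. Qed.
Lemma qzZ z : isZ (qz z). Proof. exact: intr_int. Qed.
Lemma qzD a b : qz (a + b)%BZ = qz a + qz b. Proof. by rewrite /qz (rmorphD int_of_Z) intrD. Qed.
Lemma qzN a : qz (- a)%BZ = - qz a. Proof. by rewrite /qz (rmorphN int_of_Z) rmorphN. Qed.
Lemma qzB a b : qz (a - b)%BZ = qz a - qz b. Proof. by rewrite -qzN -qzD. Qed.
Lemma qzM a b : qz (a * b)%BZ = qz a * qz b. Proof. by rewrite /qz (rmorphM int_of_Z) intrM. Qed.
Lemma qz_inj : injective qz. Proof. exact: can_inj qzK. Qed.
Lemma qz0 : qz 0 = 0. Proof. by []. Qed.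

Definition comp (u : block) (k : nat) : Z :=
  match k with 0%N => u.1.1 | 1%N => u.1.2 | _ => u.2 end.
Definition ofZ (x : seq block) : vec :=
  \row_(i < 36) (qz (comp (nth b0 x (i %/ 3)) (i %% 3)) / 3%:R).
Definition coord (v : vec) (c : nat) : rat := v 0 (inord c).
Definition toZ (v : vec) : seq block :=
  mkseq (fun b => (zq (3%:R * coord v (3 * b)), zq (3%:R * coord v (3 * b).+1),
                   zq (3%:R * coord v (3 * b).+2))) 12.
Definition integral (v : vec) : Prop := forall i, isZ (3%:R * v 0 i).

Lemma size_toZ v : size (toZ v) = 12. Proof. by rewrite size_mkseq. Qed.

Lemma coord_ofZ x c : (c < 36)%N -> coord (ofZ x) c = qz (comp (nth b0 x (c %/ 3)) (c %% 3)) / 3%:R.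
Proof. by move=> lc; rewrite /coord mxE inordK. Qed.

Lemma coord_ofZ3 x b : (b < 12)%N ->
  [/\ coord (ofZ x) (3 * b) = qz (nth b0 x b).1.1 / 3%:R,
      coord (ofZ x) (3 * b).+1 = qz (nth b0 x b).1.2 / 3%:R
    & coord (ofZ x) (3 * b).+2 = qz (nth b0 x b).2 / 3%:R].
Proof.
move=> lb; split; rewrite coord_ofZ; try lia.
- have -> : (3 * b %/ 3 = b)%N by lia. by have -> : (3 * b %% 3 = 0)%N by lia.
- have -> : ((3 * b).+1 %/ 3 = b)%N by lia. by have -> : ((3 * b).+1 %% 3 = 1)%N by lia.
- have -> : ((3 * b).+2 %/ 3 = b)%N by lia. by have -> : ((3 * b).+2 %% 3 = 2)%N by lia.
Qed.

Lemma ofZK x : size x = 12 -> toZ (ofZ x) = x.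
Proof.
move=> xs; apply: (@eq_from_nth _ b0); rewrite size_toZ // => j lj.
rewrite nth_mkseq //; have [-> -> ->] := coord_ofZ3 x lj.
by rewrite ![3%:R * _]mulrC !divfK // !qzK; case: (nth _ _ _) => [[]].
Qed.

Lemma toZK v : integral v -> ofZ (toZ v) = v.
Proof.
move=> iv; apply/rowP => i; rewrite mxE.
have li : (i %/ 3 < 12)%N by have := ltn_ord i; lia.
rewrite nth_mkseq //.
have E c : isZ (3%:R * coord v c) by apply: iv.
have -> : v 0 i = coord v i by rewrite /coord inord_val.
have Q c : qz (zq (3%:R * coord v c)) / 3%:R = coord v c by rewrite zqK // mulrC mulKf.
have : (i %% 3 < 3)%N by rewrite ltn_mod.
have := divn_eq i 3; case: (i %% 3)%N => [|[|[|]]] // Ei _ /=; rewrite Q; congr (coord v _); lia.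
Qed.

Lemma sum_blocks (F : nat -> rat) n :
  \sum_(0 <= i < 3 * n) F i = \sum_(0 <= j < n) (F (3 * j)%N + F (3 * j).+1 + F (3 * j).+2).
Proof.
elim: n => [|n IH]; first by rewrite muln0 !big_geq.
have -> : (3 * n.+1 = (3 * n).+3)%N by lia.
by rewrite [RHS]big_nat_recr //= -IH !big_nat_recr //= -!addrA.
Qed.

Lemma dot_coord u v : dot u v = \sum_(0 <= j < 12)
  (coord u (3 * j) * coord v (3 * j) + coord u (3 * j).+1 * coord v (3 * j).+1 +
   coord u (3 * j).+2 * coord v (3 * j).+2).
Proof.
rewrite -(sum_blocks (fun i => coord u i * coord v i)) big_mkord.
by apply: eq_bigr => i _; rewrite /coord inord_val.
Qed.

Lemma dot_ofZ x y : size x = 12 -> size y = 12 -> dot (ofZ x) (ofZ y) = qz (vdot x y) / 9%:R.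
Proof.
move=> xs ys; rewrite dot_coord (vdotE xs ys).
have -> : qz (\sum_(0 <= j < 12) bdot (nth b0 x j) (nth b0 y j)) =
    \sum_(0 <= j < 12) qz (bdot (nth b0 x j) (nth b0 y j)).
  by apply: (big_morph qz qzD).
rewrite mulr_suml; apply: eq_big_nat => j /andP [_ lj].
have [-> -> ->] := coord_ofZ3 x lj; have [-> -> ->] := coord_ofZ3 y lj.
have E (a b : rat) : a / 3%:R * (b / 3%:R) = a * b / 9%:R.
  by rewrite mulrACA -invfM -natrM.
by rewrite /bdot !qzD !qzM !E -!mulrDl.
Qed.

Lemma dotE u v : dot u v = (u *m v^T) 0 0.
Proof. by rewrite mxE; apply: eq_bigr => i _; rewrite mxE. Qed.
Lemma dotC u v : dot u v = dot v u.
Proof. by apply: eq_bigr => i _; rewrite mulrC. Qed.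
Lemma dotDl u v w : dot (u + v) w = dot u w + dot v w.
Proof. by rewrite !dotE mulmxDl mxE. Qed.
Lemma dotZl a u w : dot (a *: u) w = a * dot u w.
Proof. by rewrite !dotE -scalemxAl mxE. Qed.
Lemma dotNl u w : dot (- u) w = - dot u w.
Proof. by rewrite !dotE mulNmx mxE. Qed.
Lemma dotDr u v w : dot w (u + v) = dot w u + dot w v.
Proof. by rewrite dotC dotDl !(dotC w). Qed.
Lemma dotNr u w : dot w (- u) = - dot w u. Proof. by rewrite dotC dotNl dotC. Qed.
Lemma dotZr a u w : dot w (a *: u) = a * dot w u. Proof. by rewrite dotC dotZl dotC. Qed.
Lemma dot_eq0 u : dot u u = 0 -> u = 0.
Proof.
move=> E; apply/rowP => i; rewrite [RHS]mxE; apply/eqP.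
have P : true -> forall j : 'I_36, true -> 0 <= u 0 j * u 0 j by move=> _ j _; rewrite -expr2 sqr_ge0.
have /eqP := E; rewrite /dot psumr_eq0 => [/allP /(_ i)|j _]; last exact: P.
by rewrite mem_index_enum => /(_ isT) /=; rewrite mulf_eq0 orbb.
Qed.

Lemma blkE v (b : 'I_12) :
  [/\ blk v b 0 = coord v (3 * b), blk v b 1 = coord v (3 * b).+1 & blk v b 2 = coord v (3 * b).+2].
Proof.
have E (k : 'I_3) : blk v b k = coord v (3 * b + k).
  by rewrite /blk /coord; congr (v 0 _); apply: val_inj; rewrite /= inordK ?blk_lt.
by split; rewrite E; congr (coord v _); rewrite /= ?addn0 ?addn1 ?addn2.
Qed.

Lemma isZ_div3 z : isZ (qz z / 3%:R) <-> (z mod 3 = 0)%BZ.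
Proof.
have n3 : (3%:R : rat) = qz 3%BZ by [].
split=> [/zqK E | E].
  have : z = (zq (qz z / 3%:R) * 3)%BZ.
    by apply: qz_inj; rewrite qzM E -n3 divfK.
  by move=> ->; rewrite Z.mod_mul.
have -> : z = (z / 3 * 3)%BZ by rewrite Z.mul_comm; apply/Z.div_exact.
by rewrite qzM -n3 mulfK //; apply: qzZ.
Qed.

Lemma golayG_gij (i : 'I_6) (j : 'I_12) : Z_of_int (golayG i j) = gij i j.
Proof.
have : all (fun i => all (fun j => Z_of_int (if (j < 6)%N then (if j == i then 1 else 0)
  else (nth 0%N (nth [::] golayA i) (j - 6))%:Z) == gij i j) (iota 0 12)) (iota 0 6) by vm_compute.
move=> /allP /(_ i); rewrite mem_iota ltn_ord => /(_ isT) /allP /(_ j).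
by rewrite mem_iota ltn_ord => /(_ isT) /eqP.
Qed.

Lemma golay_lin (a : 'I_6 -> int) (j : 'I_12) :
  Z_of_int (\sum_(i < 6) a i * golayG i j) = lin (fun i => Z_of_int (a (inord i))) j.
Proof.
rewrite (big_morph Z_of_int (id1 := 0) (op1 := +%R) (rmorphD Z_of_int) (rmorph0 Z_of_int)).
have M i : Z_of_int (a i * golayG i j) = (Z_of_int (a i) * gij i j)%BZ.
  by rewrite -golayG_gij; apply: (rmorphM Z_of_int).
under eq_bigr => i _ do rewrite M -{1}(inord_val i).
rewrite -(big_mkord xpredT (fun i => Z_of_int (a (inord i)) * gij i j)%BZ).
by rewrite !big_nat_recr //= big_geq // /lin; lia.
Qed.

Lemma eqz_mod3 (m n : int) : (m = n %[mod 3])%Z <-> ((Z_of_int m - Z_of_int n) mod 3 = 0)%BZ.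
Proof.
have S : Z_of_int (m - n) = (Z_of_int m - Z_of_int n)%BZ by apply: (rmorphB Z_of_int).
have M q : Z_of_int (q * 3) = (Z_of_int q * 3)%BZ by apply: (rmorphM Z_of_int).
rewrite -S; split=> [/eqP | /Z.mod_divide E].
  by rewrite eqz_mod_dvd => /dvdzP [q ->]; rewrite M Z.mod_mul.
have [//|k Ek] := E; apply/eqP; rewrite eqz_mod_dvd; apply/dvdzP; exists (int_of_Z k).
by apply: (can_inj Z_of_intK); rewrite M int_of_ZK.
Qed.

Lemma inN_inNz x : size x = 12 -> inN (ofZ x) <-> inNz x.
Proof.
move=> xs; split.
  move=> [_ [B [w [W [a G]]]]]; split=> //; split.
    move=> j lj; have [] := B (Ordinal lj); have [-> -> ->] := blkE (ofZ x) (Ordinal lj).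
    have [-> -> ->] := coord_ofZ3 x lj; rewrite -!mulrDl -!mulrBl -!qzD -!qzB !isZ_div3 => S [D1 D2].
    split; last by split.
    apply: qz_inj; rewrite /bsum qz0; move/eqP: S; rewrite mulf_eq0 => /orP [/eqP //|].
    by rewrite invr_eq0.
  exists (fun i => Z_of_int (a (inord i))) => j lj.
  rewrite -[j]/(val (Ordinal lj)) -golay_lin -/(lin _ _).
  have E : bfst (nth b0 x j) = Z_of_int (w (Ordinal lj)).
    have := W (Ordinal lj); have [-> _ _] := blkE (ofZ x) (Ordinal lj).
    have [-> _ _] := coord_ofZ3 x lj; rewrite mulrC divfK // => Ew.
    by rewrite /bfst -[LHS]qzK Ew /zq numq_int.
  by rewrite E; apply/eqz_mod3/G.
move=> [_ [ok [a G]]]; split.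
  by move=> i; rewrite mxE mulrC divfK //; apply: qzZ.
split.
  move=> b; have [S [D1 D2]] := ok b (ltn_ord b); have [-> -> ->] := blkE (ofZ x) b.
  have [-> -> ->] := coord_ofZ3 x (ltn_ord b); rewrite -!mulrDl -!mulrBl -!qzD -!qzB !isZ_div3.
  by split; [rewrite -/(bsum _) S qz0 mul0r | split].
exists (fun b => int_of_Z (bfst (nth b0 x b))); split.
  move=> b; have [-> _ _] := blkE (ofZ x) b; have [-> _ _] := coord_ofZ3 x (ltn_ord b).
  by rewrite mulrC divfK.
exists (fun i => int_of_Z (a i)) => j; apply/eqz_mod3; rewrite int_of_ZK golay_lin.
have := G j (ltn_ord j).
suff -> : lin (fun i => Z_of_int (int_of_Z (a (inord i : 'I_6)))) j = lin a j by [].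
by rewrite /lin !int_of_ZK !inordK.
Qed.

Lemma inN_integral v : inN v -> integral v. Proof. by case. Qed.

Lemma inNz_toZ v : inN v -> inNz (toZ v).
Proof. by move=> Nv; apply/inN_inNz; rewrite ?size_toZ // toZK //; apply: inN_integral. Qed.

Lemma vdot_toZ u v : integral u -> integral v -> qz (vdot (toZ u) (toZ v)) = 9%:R * dot u v.
Proof. by move=> iu iv; rewrite -{2}(toZK iu) -{2}(toZK iv) dot_ofZ ?size_toZ // mulrC divfK. Qed.

Lemma ZLh_mem h L l : l \in L -> in_ZLh h L l.
Proof.
move=> lL; have li : (index l L < size L)%N by rewrite index_mem.
exists (fun i => if i == index l L then 1 else 0), 0.
rewrite mulr0z addr0 (bigD1 (Ordinal li)) //= eqxx mulr1z nth_index // big1 ?addr0 // => i ne.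
by case: eqP => // E; case/eqP: ne; apply: val_inj.
Qed.

Lemma ZLh_h h L : in_ZLh h L h.
Proof. by exists (fun _ => 0), 1; rewrite big1 ?add0r // => i _; rewrite mulr0z. Qed.

Lemma ZLh_sub h L u v : in_ZLh h L u -> in_ZLh h L v -> in_ZLh h L (u - v).
Proof.
move=> [c [d ->]] [c' [d' ->]]; exists (fun i => c i - c' i), (d - d').
rewrite mulrzBr opprD addrACA; congr (_ + _).
by rewrite -sumrB; apply: eq_bigr => i _; rewrite mulrzBr.
Qed.

Lemma span2_of_ZLh h L v : inN v -> in_ZLh h L v -> in_span2 h L v.
Proof. by move=> Nv Zv; split=> //; exists 1%N; rewrite scale1r. Qed.

Lemma integral_comb u v : integral u -> integral v -> integral (u - v).
Proof. by move=> iu iv i; rewrite !mxE mulrBr; apply: rpredB; [apply: iu | apply: iv]. Qed.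
Lemma integral_scale n u : integral u -> integral (n%:R *: u).
Proof. by move=> iu i; rewrite !mxE mulrCA; apply: rpredM; [apply: rpred_nat | apply: iu]. Qed.

Lemma toZ0 : toZ 0 = nseq 12 b0.
Proof.
rewrite -(ofZK (size_nseq 12 b0)); congr toZ; apply/rowP => i.
by rewrite !mxE nth_nseq; case: ifP => _; case: (_ %% 3)%N => [|[|]] /=; rewrite qz0 mul0r.
Qed.

Lemma clear_denominators (w : vec) : exists2 n : nat, (n != 0)%N & integral (n%:R *: w).
Proof.
exists (\prod_(i < 36) `|denq (w 0%R i)|)%N.
  by rewrite -lt0n; apply: prodn_gt0 => i; rewrite absz_gt0 denq_eq0.
move=> i; rewrite mxE; apply: rpredM; first exact: rpred_nat.
rewrite (bigD1 i) //= natrM mulrAC; apply: rpredM; last exact: rpred_nat.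
by rewrite natr_absz gtr0_norm ?denq_gt0 // mulrC -numqE; apply: intr_int.
Qed.

(** Orthogonality to these twelve rows makes every block sum vanish, which confines a vector of the
    36-dimensional ambient space to the 24-dimensional span of N. *)
Definition blkrow (b : 'I_12) : vec := ofZ (mkseq (fun j => if j == b then (1, 1, 1)%BZ else b0) 12).

Lemma dot_blkrow b x : size x = 12 -> dot (blkrow b) (ofZ x) = qz (bsum (nth b0 x b)) / 9%:R.
Proof.
move=> xs; rewrite dot_ofZ ?size_mkseq //; congr (qz _ / _).
rewrite (vdotE (size_mkseq _ _) xs) (bigD1_seq (nat_of_ord b)) ?mem_index_iota ?iota_uniq //= ?ltn_ord //.
rewrite big1_seq ?addr0 => [|j /andP [/negbTE jb]].
  by rewrite nth_mkseq // eqxx /bdot /bsum; cbn [fst snd]; rewrite !Z.mul_1_l.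
by rewrite mem_index_iota => lj; rewrite nth_mkseq // jb.
Qed.

Lemma perp_vector (r : nat) (B : 'M[rat]_(r, 36)) (f1 f2 : vec) : (r <= 21)%N ->
  exists w : vec, [/\ w != 0, forall v, (v <= B)%MS -> dot v w = 0,
    forall b, dot (blkrow b) w = 0, dot f1 w = 0 & dot f2 w = 0].
Proof.
move=> r21; pose Bl : 'M[rat]_(12, 36) := \matrix_(b < 12) blkrow b.
pose M := col_mx (col_mx B Bl) (col_mx f1 f2).
(* [M] has [r + 12 + 2] rows, at most 35, in dimension 36. *)
have K0 : kermx M^T != 0.
  rewrite -mxrank_eq0 mxrank_ker subn_eq0 -ltnNge mxrank_tr.
  by apply: (leq_ltn_trans (rank_leq_row M)); lia.
pose w := nz_row (kermx M^T).
have wM : w *m M^T = 0 by apply/sub_kermxP/nz_row_sub.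
have P v : (v <= M)%MS -> dot v w = 0.
  by case/submxP => D ->; rewrite dotC dotE trmx_mul mulmxA wM mul0mx mxE.
have MB (m1 m2 : nat) (A : 'M[rat]_(m1, 36)) (A' : 'M[rat]_(m2, 36)) : (A <= col_mx A A')%MS && (A' <= col_mx A A')%MS.
  by rewrite -col_mx_sub.
have /andP [M1 M2] := MB _ _ (col_mx B Bl) (col_mx f1 f2).
have /andP [M3 M4] := MB _ _ B Bl; have /andP [M5 M6] := MB _ _ f1 f2.
exists w; split; first by rewrite nz_row_eq0.
- by move=> v vB; apply: P; apply: submx_trans vB (submx_trans M3 M1).
- move=> b; apply: P; apply: submx_trans (submx_trans M4 M1).
  by have := row_sub b Bl; rewrite rowK.
- by apply: P; apply: submx_trans M5 M2.
- by apply: P; apply: submx_trans M6 M2.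
Qed.

Section Config.
Variables (h : vec) (L : seq vec) (S : vec -> Prop) (r : nat) (B : 'M[rat]_(r, 36)).
Hypotheses (Nh : inN h) (uL : uniq L) (FL : forall l, l \in L -> inF h l).
Hypothesis adm : admissible h L.
Hypotheses (subS : sublattice_of_N S) (spanS : forall v, in_span2 h L v -> S v).
Hypotheses (SB : forall v, S v -> (v <= B)%MS) (r21 : (r <= 21)%N).

Let NL l : l \in L -> inN l. Proof. by case/FL. Qed.
Let SL l : l \in L -> S l.
Proof. by move=> lL; apply/spanS/span2_of_ZLh; [apply: NL | apply: ZLh_mem]. Qed.
Let Sh : S h. Proof. by apply/spanS/span2_of_ZLh => //; apply: ZLh_h. Qed.
Let iL l : l \in L -> integral l. Proof. by move/NL/inN_integral. Qed.
Let ih : integral h. Proof. exact: inN_integral. Qed.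

Lemma config_toZ : config (toZ h) (map toZ L).
Proof.
have n9 : (9%:R : rat) != 0 by [].
have vd u v n : integral u -> integral v -> dot u v = n -> vdot (toZ u) (toZ v) = zq (9%:R * n).
  by move=> iu iv <-; rewrite -vdot_toZ // qzK.
split.
- rewrite map_inj_in_uniq // => u v uL' vL' E.
  by rewrite -(toZK (iL uL')) E toZK //; apply: iL.
- move=> _ /mapP [l lL ->]; have [Nl [ll lh]] := FL lL; split; first exact: inNz_toZ.
  by rewrite (vd _ _ _ (iL lL) (iL lL) ll) (vd _ _ _ (iL lL) ih lh).
- move=> _ _ /mapP [x xL ->] /mapP [y yL ->] E.
  have Sxy : S (x - y) by apply: (proj1 (proj2 subS)); apply: SL.
  have Nxy : inN (x - y) by apply: (proj2 (proj2 subS)).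
  apply: (adm (v := x - y)).
    by apply: span2_of_ZLh => //; apply: ZLh_sub; apply: ZLh_mem.
  have Dxy : dot x y = 3%:R.
    by apply: (mulfI n9); rewrite -vdot_toZ ?E //; apply: iL.
  have [_ [xx _]] := FL xL; have [_ [yy _]] := FL yL.
  by rewrite !dotDl !dotDr !dotNl !dotNr (dotC y) Dxy xx yy.
- move=> _ _ _ _ _ _ r0 /mapP [a1 A1 ->] /mapP [a2 A2 ->] /mapP [a3 A3 ->]
    /mapP [b1 B1 ->] /mapP [b2 B2 ->] /mapP [b3 B3 ->] Nr R E.
  have rs := inNz_size Nr; have Nr' : inN (ofZ r0) by apply/inN_inNz.
  (* The second differences are written with subtractions only, so that [ZLh_sub] suffices for
     membership in the span. *)
  pose d := (a1 - a2) - (a2 - a3) - ((b1 - b2) - (b2 - b3)).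
  have id : integral (d - 3%:R *: ofZ r0).
    have ic := integral_comb.
    exact: (ic _ _ (ic _ _ (ic _ _ (ic _ _ (iL A1) (iL A2)) (ic _ _ (iL A2) (iL A3)))
      (ic _ _ (ic _ _ (iL B1) (iL B2)) (ic _ _ (iL B2) (iL B3)))) (integral_scale 3 (inN_integral Nr'))).
  have d0 : d = 3%:R *: ofZ r0.
    (* The relation [R] is known only through products; testing it on the vector [d - 3 r] itself
       shows that this vector has norm 0. *)
    apply/eqP; rewrite -subr_eq0; apply/eqP; apply: dot_eq0.
    set e := d - _ in id *; rewrite -{1}(toZK id); set z := toZ e.
    have zs : size z = 12 by rewrite size_toZ.
    clearbody z.
    have Ez l : l \in L -> dot (ofZ z) l = qz (vdot z (toZ l)) / 9%:R.
      by move=> lL; rewrite -{1}(toZK (iL lL)) dot_ofZ ?size_toZ.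
    rewrite /e /d !(dotDr, dotNr, dotZr) (Ez _ A1) (Ez _ A2) (Ez _ A3) (Ez _ B1) (Ez _ B2) (Ez _ B3) (dot_ofZ zs rs).
    move: (R z zs); move: (vdot z _) (vdot z _) (vdot z _) (vdot z _) (vdot z _) (vdot z _) (vdot z _).
    move=> v1 v2 v3 v4 v5 v6 v7 /(congr1 qz); rewrite !(qzB, qzD, qzM).
    have -> : qz 2%BZ = 2%:R by []. have -> : qz 3%BZ = 3%:R by [].
    move: (qz _) (qz _) (qz _) (qz _) (qz _) (qz _) (qz _) => q1 q2 q3 q4 q5 q6 q7 Eq.
    by move: Eq; lra.

  apply: (adm (v := ofZ r0)); last by rewrite dot_ofZ // E.
  (* The multiplier 3 is odd, so the root lies in [in_span2], against admissibility. *)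
  split=> //; exists 3%N; split=> //; rewrite -d0.
  by do ?[apply: ZLh_sub]; apply: ZLh_mem.
- move=> f1 f2 s1 s2.
  have [w [w0 wB wb wf1 wf2]] := perp_vector B (ofZ f1) (ofZ f2) r21.
  have [n n0 iw] := clear_denominators w.
  set x := toZ (n%:R *: w).
  have xs : size x = 12 by rewrite size_toZ.
  have dx u : integral u -> dot u w = 0 -> vdot (toZ u) x = 0%BZ.
    by move=> iu uw; apply: qz_inj; rewrite vdot_toZ // dotZr uw !mulr0.
  exists x; split=> //.
  + move=> j; case: (ltnP j 12) => lj; last by rewrite nth_default ?xs.
    have := dot_blkrow (Ordinal lj) xs; rewrite toZK // dotZr wb mulr0 => /esym /eqP.
    by rewrite mulf_eq0 invr_eq0 (negbTE n9) orbF => /eqP H; apply: qz_inj.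
  + move=> x0; case/negP: w0; have : n%:R *: w = 0 by rewrite -(toZK iw) -/x x0 -toZ0 toZK // => i; rewrite mxE mulr0.
    by move/eqP; rewrite scaler_eq0 pnatr_eq0 (negbTE n0).
  + by apply: dx => //; apply: wB; apply: SB.
  + split; first by move=> _ /mapP [l lL ->]; apply: dx; [apply: iL | apply/wB/SB/SL].
    have fx f : size f = 12 -> dot (ofZ f) w = 0 -> vdot f x = 0%BZ.
      move=> fs fw; rewrite -{1}(ofZK fs); apply: dx => //.
      by move=> i; rewrite mxE mulrC divfK //; apply: qzZ.
    by split; apply: fx.
Qed.
End Config.
End RationalCoordinates.

(** * Symmetries *)

(** Lets [lia] decide congruences modulo 3. *)
Ltac Zify.zify_post_hook ::= Z.to_euclidean_division_equations.

Definition bperm (k : nat) (u : block) : block :=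
  let: (a, b, c) := u in
  match k with
  | 0 => (a, b, c) | 1 => (b, a, c) | 2 => (a, c, b)
  | 3 => (c, b, a) | 4 => (b, c, a) | _ => (c, a, b)
  end.
Definition binv (k : nat) : nat := match k with 4 => 5 | 0 | 1 | 2 | 3 => k | _ => 4 end.

Lemma bpermK k u : bperm (binv k) (bperm k u) = u.
Proof. by case: u => [[a b] c]; case: k => [|[|[|[|[|k]]]]]. Qed.
Lemma bperm_dot k u v : bdot (bperm k u) (bperm k v) = bdot u v.
Proof.
by case: u v => [[a b] c] [[d e] f]; case: k => [|[|[|[|[|k]]]]]; rewrite /bdot /=; lia.
Qed.
Lemma bperm_sum k u : bsum (bperm k u) = bsum u.
Proof.
by case: u => [[a b] c]; case: k => [|[|[|[|[|k]]]]]; rewrite /bsum /=; lia.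
Qed.
Lemma bperm_ok k u : bok u -> bok (bperm k u).
Proof.
case: u => [[a b] c]; rewrite /bok bperm_sum /= => -[? [? ?]].
by case: k => [|[|[|[|[|k]]]]]; rewrite /=; lia.
Qed.
(** The three coordinates are congruent modulo 3, so the glue class can be read off any of them. *)
Lemma bperm_fst k u : bok u -> ((bfst (bperm k u) - bfst u) mod 3 = 0)%BZ.
Proof.
case: u => [[a b] c]; rewrite /bok /bfst /bsum /= => -[? [? ?]].
by case: k => [|[|[|[|[|k]]]]]; rewrite /=; lia.
Qed.

Definition pact (s : nat -> nat) (x : seq block) : seq block :=
  mkseq (fun j => bperm (s j) (nth b0 x j)) 12.

Lemma bperm_binv k u : bperm k (bperm (binv k) u) = u.
Proof. by case: u => [[a b] c]; case: k => [|[|[|[|[|k]]]]]. Qed.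

Lemma pact_isom s s' :
  (forall j u, bperm (s' j) (bperm (s j) u) = u) -> isom (pact s) (pact s').
Proof.
move=> K; split.
- by move=> x _; rewrite size_mkseq.
- move=> x y xs ys; rewrite !(vdotE (n := 12)) ?size_mkseq //.
  by apply: eq_big_nat => j /andP [_ lt]; rewrite !nth_mkseq // bperm_dot.
- move=> x [xs [xb [a xa]]]; split; first by rewrite size_mkseq.
  split=> [j lt|]; first by rewrite nth_mkseq //; apply/bperm_ok/xb.
  exists a => j lt; have := xa j lt; have := bperm_fst (s j) (xb j lt).
  rewrite nth_mkseq //; move: (lin a j) (bfst _) (bfst _) => ? ? ?; lia.
- move=> x _ x0 j; case: (ltnP j 12) => lt; first by rewrite nth_mkseq // bperm_sum.
  by rewrite nth_default ?size_mkseq.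
- move=> x xs; apply: (@eq_from_nth _ b0) => [|j]; rewrite size_mkseq // => lt.
  by rewrite !nth_mkseq // K.
Qed.

(** Minus the longest element of the Weyl group. Like -1 it negates the glue class, but it keeps
    dominant blocks dominant, so sign changes of the code act on dominant vectors. *)
Definition nrev (u : block) : block := (- u.2, - u.1.2, - u.1.1)%BZ.
Lemma nrevK u : nrev (nrev u) = u.
Proof. by case: u => [[a b] c]; rewrite /nrev /= !Z.opp_involutive. Qed.
Lemma nrev_dot u v : bdot (nrev u) (nrev v) = bdot u v.
Proof. by rewrite /bdot /=; lia. Qed.
Lemma nrev_ok u : bok u -> bok (nrev u).
Proof. rewrite /bok /bsum /= => -[? [? ?]]; lia. Qed.

Definition sgb (s : bool) (u : block) : block := if s then u else nrev u.
Definition gact (g : seq (nat * bool)) (x : seq block) : seq block :=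
  [seq sgb p.2 (nth b0 x p.1) | p <- g].
Definition gid : seq (nat * bool) := [seq (j, true) | j <- iota 0 12].
Definition gcomp (g' g : seq (nat * bool)) : seq (nat * bool) :=
  [seq (let q := nth (0%N, true) g p.1 in (q.1, p.2 == q.2)) | p <- g'].
Definition ginv (g : seq (nat * bool)) : seq (nat * bool) :=
  mkseq (fun j => let k := index j [seq p.1 | p <- g] in
                  (k, (nth (0%N, true) g k).2)) 12.
Definition grow (g : seq (nat * bool)) (i j : nat) : Z :=
  let p := nth (0%N, true) g j in
  if p.2 then gij i p.1 else (- gij i p.1)%BZ.
(** The generator matrix is systematic: a code word is the encoding of its first six letters. Hence
    the last clause, which encodes the first six letters of the image of each row and compares, says
    that [g] preserves the code. *)
Definition gok (g : seq (nat * bool)) : bool :=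
  [&& size g == 12, perm_eq [seq p.1 | p <- g] (iota 0 12), gcomp (ginv g) g == gid &
   all (fun i => all (fun j => Z.eqb
     ((grow g i j - lin (grow g i) j) mod 3)%BZ 0%BZ) (iota 0 12)) (iota 0 6)].

Lemma gact_comp g' g x : all (fun p : nat * bool => p.1 < size g)%N g' ->
  gact g' (gact g x) = gact (gcomp g' g) x.
Proof.
move=> /allP lt; rewrite /gact /gcomp -map_comp; apply/eq_in_map => p /lt pg /=.
rewrite (nth_map (0%N, true)) //; case: p (nth _ _ _) {pg} => [a s] [b t] /=.
by case: s t => [] [] //=; rewrite nrevK.
Qed.

Lemma gact_id x : size x = 12 -> gact gid x = x.
Proof.
move=> xs; rewrite /gact /gid -map_comp; apply: (@eq_from_nth _ b0).
  by rewrite size_map size_iota xs.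
by move=> j; rewrite size_map size_iota => lt; rewrite (nth_map 0%N) ?size_iota // nth_iota.
Qed.

Lemma lin_comb (a : nat -> Z) (c : nat -> nat -> Z) (f : nat -> Z) j :
  (forall i, (i < 6)%N -> ((f i - lin (c i) j) mod 3 = 0)%BZ) ->
  ((a 0%N * f 0%N + a 1%N * f 1%N + a 2%N * f 2%N + a 3%N * f 3%N + a 4%N * f 4%N
    + a 5%N * f 5%N
    - lin (fun k => a 0%N * c 0%N k + a 1%N * c 1%N k + a 2%N * c 2%N k
       + a 3%N * c 3%N k + a 4%N * c 4%N k + a 5%N * c 5%N k) j) mod 3 = 0)%BZ.
Proof.
move=> H.
have D i : (i < 6)%N -> exists q, (f i = lin (c i) j + 3 * q)%BZ.
  by move=> /H /Z.mod_divide [//|q E]; exists q; lia.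
have [q0 ->] := D 0%N isT; have [q1 ->] := D 1%N isT; have [q2 ->] := D 2%N isT.
have [q3 ->] := D 3%N isT; have [q4 ->] := D 4%N isT; have [q5 ->] := D 5%N isT.
apply/Z.mod_divide => //.
exists (a 0%N * q0 + a 1%N * q1 + a 2%N * q2 + a 3%N * q3 + a 4%N * q4 + a 5%N * q5)%BZ.
rewrite /lin; ring.
Qed.

Lemma gact_inNz g x : gok g -> inNz x -> inNz (gact g x).
Proof.
case/and4P => /eqP gs pg _ /allP lg [xs [xb [a xa]]].
have lt j : (j < 12)%N -> ((nth (0%N, true) g j).1 < 12)%N.
  move=> lj; have : (nth (0%N, true) g j).1 \in [seq p.1 | p <- g].
    by apply/map_f/mem_nth; rewrite gs.
  by rewrite (perm_mem pg) mem_iota.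
split; first by rewrite size_map.
split=> [j lj|].
  rewrite (nth_map (0%N, true)) ?gs //; have := xb _ (lt j lj).
  by case: (nth _ g j) => p [] //= /nrev_ok.
exists (fun k => a 0%N * grow g 0 k + a 1%N * grow g 1 k + a 2%N * grow g 2 k
       + a 3%N * grow g 3 k + a 4%N * grow g 4 k + a 5%N * grow g 5 k)%BZ => j lj.
rewrite (nth_map (0%N, true)) ?gs //.
have LC : forall i, (i < 6)%N -> ((grow g i j - lin (grow g i) j) mod 3 = 0)%BZ.
  move=> i li; have li' : i \in iota 0 6 by rewrite mem_iota.
  have lj' : j \in iota 0 12 by rewrite mem_iota.
  by have /allP /(_ j lj') /Z.eqb_eq := lg i li'.
have := lin_comb a LC.
have := xa _ (lt j lj); have := xb _ (lt j lj); rewrite /grow.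
move: (lin (fun k => _) j) => r.
case: (nth _ g j) => p s /=; rewrite /lin.
case: (nth b0 x p) => [[u v] t]; case: s; rewrite /bfst /bok /bsum /= => -[? [? ?]] ? ?; lia.
Qed.

Lemma gact_isom g : gok g -> gok (ginv g) -> isom (gact g) (gact (ginv g)).
Proof.
move=> ok ok'; have /and4P [/eqP gs pg /eqP gK _] := ok.
have /and4P [/eqP gs' pg' _ _] := ok'.
split.
- by move=> x _; rewrite size_map.
- move=> x y xs ys; rewrite !(vdotE (n := 12)) ?size_map //.
  transitivity (\sum_(j <- [seq p.1 | p <- g]) bdot (nth b0 x j) (nth b0 y j))%R.
    rewrite big_map (big_nth (0%N, true)) gs.
    apply: eq_big_nat => j /andP [_ lt]; rewrite /gact !(nth_map (0%N, true)) ?gs //.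
    by case: (nth (0%N, true) g j) => p []; [by [] | exact: nrev_dot].
  by rewrite (perm_big _ pg).
- by move=> x; apply: gact_inNz.
- move=> x xs x0 j; case: (ltnP j 12) => lt.
    rewrite (nth_map (0%N, true)) ?gs //; case: (nth _ g j) => p s /=.
    by have := x0 p; case: s => //=; rewrite /bsum /=; lia.
  by rewrite nth_default ?size_map ?gs.
- move=> x xs; rewrite gact_comp ?gK ?gact_id //.
  apply/allP => p pi; have : p.1 \in [seq p.1 | p <- ginv g] by apply: map_f.
  by rewrite (perm_mem pg') mem_iota gs.
Qed.

Definition gok2 g := [&& gok g, gok (ginv g) & ginv (ginv g) == g].

Lemma bounded_gact g h : gok2 g -> inNz h -> bounded (gact g h) -> bounded h.
Proof.
case/and3P => ok ok' /eqP gg Nh; apply: bounded_isom Nh; first exact: gact_isom.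
by rewrite -{2}gg; apply: gact_isom; rewrite ?gg.
Qed.

Definition sortc (u : block) : nat :=
  let: (a, b, c) := u in
  if Z.leb b a then
    if Z.leb c b then 0 else if Z.leb c a then 2 else 5
  else if Z.leb c a then 1 else if Z.leb c b then 4 else 3.

Definition dominant (u : block) : Prop := (u.1.1 >= u.1.2 /\ u.1.2 >= u.2)%BZ.

Lemma sortcP u : dominant (bperm (sortc u) u).
Proof.
case: u => [[a b] c]; rewrite /dominant /sortc.
case: (Z.leb_spec b a) => ?; case: (Z.leb_spec c b) => ?; case: (Z.leb_spec c a) => ? /=;
 lia.
Qed.

Lemma bounded_sort h : inNz h ->
  bounded (pact (fun j => sortc (nth b0 h j)) h) -> bounded h.
Proof.
move=> Nh; set s := fun j => _.
apply: (@bounded_isom _ (pact (fun j => binv (s j)))) Nh.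
  by apply: pact_isom => j u; rewrite bpermK.
by apply: pact_isom => j u; rewrite bperm_binv.
Qed.

(** * Weyl orbits and their leaders *)

Fixpoint allseq (n : nat) : seq (seq Z) :=
  if n is n'.+1 then [seq c :: s | c <- [:: 0; 1; 2]%BZ, s <- allseq n'] else [:: [::]].

Definition words : seq (seq nat) := Eval vm_compute in
  [seq mkseq (fun j => Z.to_nat (lin (fun i => nth 0%BZ a i) j mod 3)) 12 | a <- allseq 6].

Definition bclass (u : block) : nat := Z.to_nat (bfst u mod 3).
Definition vclass (x : seq block) : seq nat := [seq bclass u | u <- x].

Lemma allseqP (s : seq Z) : all (fun c => (0 <=? c) && (c <? 3))%BZ s -> s \in allseq (size s).
Proof.
elim: s => [|c s IH] //; rewrite [all _ _]/= => /andP [/andP [c0 c3] /IH si].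
apply: (@allpairs_f _ _ _ cons [:: 0; 1; 2]%BZ (allseq (size s))) => //.
rewrite !inE.
move/Z.leb_le: c0; move/Z.ltb_lt: c3 => c3 c0.
have [->|[->|->]] : (c = 0 \/ c = 1 \/ c = 2)%BZ by lia.
all: by [].
Qed.

Lemma lin_mod a c j : (forall i, (i < 6)%N -> (c i = a i mod 3)%BZ) ->
  ((lin a j) mod 3 = (lin c j) mod 3)%BZ.
Proof.
move=> H.
have D i : (i < 6)%N -> exists q, (a i = c i + 3 * q)%BZ.
  by move=> /H ->; exists (a i / 3)%BZ; lia.
have [q0 E0] := D 0%N isT; have [q1 E1] := D 1%N isT; have [q2 E2] := D 2%N isT.
have [q3 E3] := D 3%N isT; have [q4 E4] := D 4%N isT; have [q5 E5] := D 5%N isT.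
have -> : lin a j = (lin c j + lin (fun i => nth 0 [:: q0; q1; q2; q3; q4; q5] i) j * 3)%BZ.
  by rewrite /lin /= E0 E1 E2 E3 E4 E5; ring.
by rewrite Z.mod_add.
Qed.

Lemma wordsP x : inNz x -> vclass x \in words.
Proof.
case=> xs [xb [a xa]].
pose c := mkseq (fun i => (a i mod 3)%BZ) 6.
have ci : c \in allseq 6.
  apply: (allseqP (s := c)); apply/allP => _ /mapP [i _ ->].
  by have := Z.mod_pos_bound (a i) 3; lia.
have -> : words = [seq mkseq (fun j => Z.to_nat (lin (fun i => nth 0%BZ a i) j mod 3)) 12 | a <- allseq 6].
  by vm_compute.
apply/mapP; exists c => //; apply: (@eq_from_nth _ 0%N); first by rewrite size_map size_mkseq.
move=> j; rewrite size_map xs => lj; rewrite (nth_map b0) ?xs // nth_mkseq //.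
rewrite /bclass; congr Z.to_nat.
rewrite -(@lin_mod a) => [|i li]; last by rewrite nth_mkseq.
by have := xa j lj; lia.
Qed.

Definition zr : seq Z := [:: -6; -5; -4; -3; -2; -1; 0; 1; 2; 3; 4; 5; 6]%BZ.
Definition bokb (u : block) : bool :=
  [&& Z.eqb (bsum u) 0, Z.eqb ((u.1.1 - u.1.2) mod 3)%BZ 0
    & Z.eqb ((u.1.1 - u.2) mod 3)%BZ 0].
(** The blocks that can occur in a vector of norm 36. The range [zr] is wide enough because a block
    with first coordinate [a] and sum 0 has norm at least [3 a^2 / 2]. *)
Definition short_blocks : seq block := Eval vm_compute in
  [seq u <- [seq (a, b, - a - b)%BZ | a <- zr, b <- zr] | bokb u && Z.leb (bdot u u) 36].

Lemma bokP u : reflect (bok u) (bokb u).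
Proof.
apply: (iffP and3P) => [[/Z.eqb_eq ? /Z.eqb_eq ? /Z.eqb_eq ?] | [? [? ?]]] //.
by split; apply/Z.eqb_eq.
Qed.

Lemma zrP a : (-6 <= a <= 6)%BZ -> a \in zr.
Proof.
move=> H.
have : (a = -6 \/ a = -5 \/ a = -4 \/ a = -3 \/ a = -2 \/ a = -1 \/ a = 0 \/ a = 1
  \/ a = 2 \/ a = 3 \/ a = 4 \/ a = 5 \/ a = 6)%BZ by lia.
by do 12 (case=> [->|]) => //; move=> ->.
Qed.

Lemma short_blocksP u : bok u -> (bdot u u <= 36)%BZ -> u \in short_blocks.
Proof.
case: u => [[a b] c] ok n.
have -> : short_blocks = [seq u <- [seq (a, b, - a - b)%BZ | a <- zr, b <- zr] | bokb u && Z.leb (bdot u u) 36].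
  by vm_compute.
have E : c = (- a - b)%BZ by case: ok; rewrite /bsum /=; lia.
rewrite mem_filter; apply/andP; split; first by apply/andP; split; [apply/bokP | apply/Z.leb_le].
move: n; rewrite /bdot /= E => n; apply: (@allpairs_f _ _ _ (fun a b : Z => (a, b, - a - b)%BZ) zr zr); apply: zrP; nia.
Qed.

Definition bmax (u v : Z) := if Z.leb u v then v else u.
Definition bmin (u v : Z) := if Z.leb u v then u else v.
(* The leader of the orbit of [v] under the stabiliser of the dominant block [hb] in
   the Weyl group S_3 of the block. *)
Definition bleader (hb v : block) : block :=
  let: (p, q, r) := hb in
  let: (a, b, c) := v in
  if [&& Z.eqb p 0, Z.eqb q 0 & Z.eqb r 0] then
    let n := bdot v v in
    if Z.eqb n 6 then if Z.eqb (a mod 3)%BZ 1 then (1, 1, -2)%BZ else (2, -1, -1)%BZ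
    else if Z.eqb n 18 then
      if Z.eqb a 3 then (3, 0, -3)%BZ
      else if Z.eqb b 3 then (0, 3, -3)%BZ else (0, -3, 3)%BZ
    else v
  else if Z.eqb p q && Z.eqb (Z.abs (a - b)) 3 then (bmax a b, bmin a b, c)
  else if Z.eqb q r && Z.eqb (Z.abs (b - c)) 3 then (a, bmax b c, bmin b c)
  else v.

Definition opt : Type := (block * Z * Z)%type.
Definition bleaders (hb : block) : seq block := [seq v <- short_blocks | bleader hb v == v].
Definition opts (hb : block) (c : nat) : seq opt * Z * Z :=
  let s := [seq (v, bdot v v, bdot v hb) | v <- bleaders hb & bclass v == c] in
  (s, foldr Z.min 100%BZ [seq o.1.2 | o <- s], foldr Z.max (-100)%BZ [seq o.2 | o <- s]).
Definition table (h : seq block) : seq (seq (seq opt * Z * Z)) :=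
  [seq [:: opts hb 0; opts hb 1; opts hb 2] | hb <- h].
Definition node : Type := (seq opt * Z * Z)%type.
(* The minimal norm and the maximal product with h of the remaining blocks prune the
   enumeration. *)
Fixpoint nodes (t : seq (seq node)) (w : seq nat) : seq node * Z * Z :=
  match t, w with
  | o :: t', c :: w' =>
    let: (r, mn, mx) := nodes t' w' in
    let: (s, m, M) := nth ([::], 0, 0)%BZ o c in
    ((s, mn, mx) :: r, (m + mn)%BZ, (M + mx)%BZ)
  | _, _ => ([::], 0%BZ, 0%BZ)
  end.
Fixpoint enum_nodes (r : seq node) (n i : Z) : seq (seq block) :=
  match r with
  | [::] => if Z.eqb n 0 && Z.eqb i 0 then [:: [::]] else [::]
  | (s, mn, mx) :: r' =>
    foldr (fun (o : opt) acc =>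
      let: (v, nv, iv) := o in
      if Z.leb mn (n - nv) && Z.leb (i - iv) mx
      then [seq v :: x | x <- enum_nodes r' (n - nv) (i - iv)] ++ acc else acc) [::] s
  end.
Definition leaders (h : seq block) : seq (seq block) :=
  let t := table h in
  foldr (fun w acc => enum_nodes (nodes t w).1.1 36 36 ++ acc) [::] words.

Lemma foldr_min z0 s z : z \in s -> (foldr Z.min z0 s <= z)%BZ.
Proof. by elim: s => //= y s IH; rewrite inE => /orP [/eqP -> | /IH]; lia. Qed.
Lemma foldr_max z0 s z : z \in s -> (z <= foldr Z.max z0 s)%BZ.
Proof. by elim: s => //= y s IH; rewrite inE => /orP [/eqP -> | /IH]; lia. Qed.

Lemma nodes_bounds h x : all2 (fun hb u => u \in bleaders hb) h x ->
  let r := nodes (table h) (vclass x) in (r.1.2 <= vdot x x)%BZ /\ (vdot x h <= r.2)%BZ.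
Proof.
elim: h x => [|hb h IH] [|u x] //= /andP [ub /IH].
case: (nodes _ _) => [[r mn] mx] /= [H1 H2].
have lc : (bclass u < 3)%N.
  by rewrite /bclass; have := Z.mod_pos_bound (bfst u) 3; lia.
set s := [seq (v, bdot v v, bdot v hb) | v <- bleaders hb & bclass v == bclass u].
have us : (u, bdot u u, bdot u hb) \in s.
  by apply/mapP; exists u => //; rewrite mem_filter eqxx.
have -> : nth ([::], 0%BZ, 0%BZ) [:: opts hb 0; opts hb 1; opts hb 2] (bclass u) = opts hb (bclass u).
  by case: (bclass u) lc => [|[|[|]]].
rewrite /opts -/s /=.
have A1 : (foldr Z.min 100 [seq o.1.2 | o <- s] <= bdot u u)%BZ.
  by apply: foldr_min; apply/mapP; exists (u, bdot u u, bdot u hb).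
have A2 : (bdot u hb <= foldr Z.max (-100) [seq o.2 | o <- s])%BZ.
  by apply: foldr_max; apply/mapP; exists (u, bdot u u, bdot u hb).
by split; lia.
Qed.

Lemma enum_nodesP h x n i : all2 (fun hb u => u \in bleaders hb) h x ->
  vdot x x = n -> vdot x h = i ->
  x \in enum_nodes (nodes (table h) (vclass x)).1.1 n i.
Proof.
elim: h x n i => [|hb h IH] [|u x] //= n i; first by move=> _ <- <-.
move=> /andP [ub xb] En Ei.
have := nodes_bounds xb; have := IH x _ _ xb erefl erefl.
case: (nodes _ _) => [[r mn] mx] /= xr [H1 H2].
have lc : (bclass u < 3)%N.
  by rewrite /bclass; have := Z.mod_pos_bound (bfst u) 3; lia.
set s := [seq (v, bdot v v, bdot v hb) | v <- bleaders hb & bclass v == bclass u].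
have us : (u, bdot u u, bdot u hb) \in s.
  by apply/mapP; exists u => //; rewrite mem_filter eqxx.
have -> : nth ([::], 0%BZ, 0%BZ) [:: opts hb 0; opts hb 1; opts hb 2] (bclass u) = opts hb (bclass u).
  by case: (bclass u) lc => [|[|[|]]].
rewrite /opts -/s /=.
elim: s us => //= -[[v nv] iv] s IHs; rewrite inE => /orP [/eqP [<- <- <-] | /IHs us].
  have -> : (n - bdot u u)%BZ = vdot x x by lia.
  have -> : (i - bdot u hb)%BZ = vdot x h by lia.
  have -> : (mn <=? vdot x x)%BZ = true by apply/Z.leb_le.
  have -> : (vdot x h <=? mx)%BZ = true by apply/Z.leb_le.
  by rewrite mem_cat map_f.
by case: (_ && _) => //; rewrite mem_cat us orbT.
Qed.

Lemma vdot_nth_le x j : (bdot (nth b0 x j) (nth b0 x j) <= vdot x x)%BZ.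
Proof.
have sq u : (0 <= bdot u u)%BZ by rewrite /bdot; nia.
elim: x j => [|u x IH] [|j] //=; have := vsqr_ge0 x; have := sq u; first lia.
by have := IH j; lia.
Qed.

Arguments vdot_nth_le : clear implicits.

Lemma inFz_short h x : inFz h x -> all (mem short_blocks) x.
Proof.
case=> -[xs [xb _]] [n _]; apply/(all_nthP b0) => j lj.
apply: short_blocksP; first by apply: xb; rewrite -xs.
by have := vdot_nth_le x j; lia.
Qed.

Lemma leadersP h x : all2 (fun hb u => u \in bleaders hb) h x -> inFz h x -> x \in leaders h.
Proof.
move=> cx Fx; have [Nx [nx ix]] := Fx; have := wordsP Nx.
have xs := inNz_size Nx; rewrite /leaders; elim: words => //= w ws IH.
rewrite inE mem_cat => /orP [/eqP <- | /IH ->]; last by rewrite orbT.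
by rewrite enum_nodesP.
Qed.

(** Three times the weight of A_2 with Dynkin labels [a], [b]: consecutive coordinates drop by [3 a]
    and [3 b]. *)
Definition dyn (p : nat * nat) : block :=
  let a := Z.of_nat p.1 in let b := Z.of_nat p.2 in (2 * a + b, b - a, - a - 2 * b)%BZ.
(** Contains every block of the representatives used below, so that facts about a block of h and a
    short block become finite checks. *)
Definition htypes : seq block := Eval vm_compute in
  [seq dyn p | p <- [:: (0,0); (0,1); (1,0); (1,1); (2,0); (0,2); (1,2); (2,1); (3,1); (0,3); (2,2)]].

Definition mult (hb v : block) : nat :=
  let: (p, q, r) := hb in
  let: (a, b, c) := v in
  if [&& Z.eqb p 0, Z.eqb q 0 & Z.eqb r 0] then
    let n := bdot v v in if Z.eqb n 6 then 3 else if Z.eqb n 18 then 2 else 1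
  else if Z.eqb p q && Z.eqb (Z.abs (a - b)) 3 then 2
  else if Z.eqb q r && Z.eqb (Z.abs (b - c)) 3 then 2
  else 1.
Definition bfiber (hb v : block) : seq block := [seq u <- short_blocks | bleader hb u == v].

(** Blocks with one leader have equal norms, so a product smaller by 9 than the norm means that
    their difference has norm 18, a root. The clause on [mult] identifies it with the size of the
    class. *)
Definition bleader_check (hb v : block) : bool :=
  let v' := bleader hb v in
  [&& v' \in short_blocks, bleader hb v' == v', bclass v' == bclass v,
      Z.eqb (bdot v' v') (bdot v v) & Z.eqb (bdot v' hb) (bdot v hb)] &&
  all (fun u => (bleader hb u == v') ==> ((u == v) || Z.eqb (bdot u v) (bdot v v - 9)%BZ)) short_blocks &&
  (mult hb v == size (bfiber hb v')).

Lemma bleader_checkP hb v : hb \in htypes -> v \in short_blocks -> bleader_check hb v.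
Proof.
have : all (fun hb => all (bleader_check hb) short_blocks) htypes by vm_compute.
by move=> /allP H /H /allP; apply.
Qed.

Fixpoint leader (h x : seq block) : seq block :=
  match h, x with
  | hb :: h', u :: x' => bleader hb u :: leader h' x'
  | _, _ => [::]
  end.

Lemma leader_size h x : size x = size h -> size (leader h x) = size h.
Proof. by elim: h x => [|hb h IH] [|u x] //= [/IH ->]. Qed.

Lemma leader_nth h x j : size x = size h -> (j < size h)%N ->
  nth b0 (leader h x) j = bleader (nth b0 h j) (nth b0 x j).
Proof.
by elim: h x j => [|hb h IH] [|u x] [|j] //= [xs] lj; rewrite IH.
Qed.

Lemma leader_dot h x : size x = size h -> all (mem htypes) h -> all (mem short_blocks) x ->
  vdot (leader h x) (leader h x) = vdot x x /\ vdot (leader h x) h = vdot x h.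
Proof.
elim: h x => [|hb h IH] [|u x] //= [xs] /andP [ht hh] /andP [ub xb].
have [-> ->] := IH x xs hh xb.
by have /andP [/andP [/and5P [_ _ _ /Z.eqb_eq -> /Z.eqb_eq ->] _] _] := bleader_checkP ht ub.
Qed.

Lemma all_nth (T : eqType) (P : pred T) (x0 : T) s j : all P s -> (j < size s)%N -> P (nth x0 s j).
Proof. by move=> /all_nthP H /H; apply. Qed.

Lemma short_blocks_ok u : u \in short_blocks -> bok u.
Proof.
have : all bokb short_blocks by vm_compute.
by move=> /allP H /H /bokP.
Qed.

Lemma bclass_mod u v : bclass u = bclass v -> ((bfst u - bfst v) mod 3 = 0)%BZ.
Proof.
rewrite /bclass => E; have := Z.mod_pos_bound (bfst u) 3; have := Z.mod_pos_bound (bfst v) 3.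
move=> H1 H2; have : (bfst u mod 3 = bfst v mod 3)%BZ by lia.
lia.
Qed.

Lemma leader_inF h x : all (mem htypes) h -> size h = 12 -> inFz h x -> inFz h (leader h x).
Proof.
move=> hh hs Fx; have xb := inFz_short Fx; have [[xs [xo [a xa]]] [n i]] := Fx.
have sxh : size x = size h by rewrite xs hs.
have [d1 d2] := leader_dot sxh hh xb.
split; last by rewrite d1 d2.
have ok j : (j < 12)%N -> bleader_check (nth b0 h j) (nth b0 x j).
  by move=> lj; apply: bleader_checkP; apply: all_nth => //; rewrite ?hs ?xs.
split; first by rewrite leader_size.
split=> [j lj|]; last exists a => j lj.
  rewrite leader_nth ?hs //; apply: short_blocks_ok.
  by have /andP [/andP [/and5P []]] := ok j lj.
rewrite leader_nth ?hs //.
have /andP [/andP [/and5P [_ _ /eqP /bclass_mod C _ _] _] _] := ok j lj.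
have := xa j lj; move: (lin a j) C => r; lia.
Qed.

Lemma leader_in_leaders h x : all (mem htypes) h -> size h = 12 -> inFz h x ->
  leader h x \in leaders h.
Proof.
move=> hh hs Fx; apply: leadersP; last exact: leader_inF.
have xb := inFz_short Fx; have xs : size x = size h by rewrite hs; case: Fx => -[].
elim: h x hh xs xb {hs Fx} => [|hb h IH] [|u x] //= /andP [ht hh] [xs] /andP [ub xb].
rewrite IH // andbT mem_filter.
by have /andP [/andP [/and5P [-> -> _ _ _] _] _] := bleader_checkP ht ub.
Qed.

(** * Counting the members of one orbit *)

Fixpoint cart (ss : seq (seq block)) : seq (seq block) :=
  if ss is s :: ss' then [seq u :: x | u <- s, x <- cart ss'] else [:: [::]].
Lemma size_cart ss : size (cart ss) = foldr muln 1 [seq size s | s <- ss].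
Proof. by elim: ss => //= s ss IH; rewrite size_allpairs IH. Qed.
Lemma mem_cart (J : seq nat) (f : nat -> block) (S : nat -> seq block) :
  {in J, forall j, f j \in S j} -> [seq f j | j <- J] \in cart [seq S j | j <- J].
Proof.
elim: J => // j J IH H /=.
apply: (@allpairs_f _ _ _ cons (S j)); first by apply: H; rewrite mem_head.
by apply: IH => k kJ; apply: H; rewrite inE kJ orbT.
Qed.

Definition outside (D : pred nat) : seq nat := [seq j <- iota 0 12 | ~~ D j].

(** The blocks outside [D] tell the members of [X] apart, and each of them lies in a class of
    [bleader]; so [X] injects into the product of these classes. *)
Lemma fiber_bound h (o : seq block) (X : seq (seq block)) (D : pred nat) :
  size h = 12 -> all (mem htypes) h -> uniq X ->
  (forall x, x \in X -> inFz h x /\ leader h x = o) ->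
  {in X &, forall x y, (forall j, (j < 12)%N -> ~~ D j -> nth b0 x j = nth b0 y j) -> x = y} ->
  (size X <= foldr muln 1 [seq mult (nth b0 h j) (nth b0 o j) | j <- outside D])%N.
Proof.
move=> hs hh uX HX inj.
(* The equality of [mult] with a class size is available only at blocks that are leaders; a member
   [x0] shows that those of [o] are. *)
case: X uX HX inj => // x0 X0; set X := x0 :: X0 => uX HX inj.
pose f (x : seq block) := [seq nth b0 x j | j <- outside D].
have hx x : x \in X -> size x = 12 by move=> /HX [] [] [].
have -> : [seq mult (nth b0 h j) (nth b0 o j) | j <- outside D]
  = [seq size s | s <- [seq bfiber (nth b0 h j) (nth b0 o j) | j <- outside D]].
  have [Fx0 <-] := HX x0 (mem_head _ _); have xb := inFz_short Fx0.
  have x0s := hx x0 (mem_head _ _).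
  rewrite -map_comp; apply/eq_in_map => j; rewrite mem_filter mem_iota => /andP [_ lj] /=.
  have ht : nth b0 h j \in htypes by apply: all_nth => //; rewrite hs.
  have ub : nth b0 x0 j \in short_blocks by apply: all_nth => //; rewrite x0s.
  rewrite leader_nth ?x0s ?hs //.
  have /andP [/andP [/and5P [cb /eqP cc _ _ _] _] _] := bleader_checkP ht ub.
  by have /andP [_ /eqP ->] := bleader_checkP ht cb; rewrite cc.
rewrite -size_cart -(size_map f); apply: uniq_leq_size.
  rewrite map_inj_in_uniq // => x y xX yX E; apply: inj => // j lj Dj.
  have jO : j \in outside D by rewrite mem_filter Dj mem_iota.
  by move/eq_in_map: E => /(_ j jO).
move=> _ /mapP [x xX ->]; apply: mem_cart => j; rewrite mem_filter mem_iota => /andP [_ lj].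
have [Fx E] := HX x xX; rewrite mem_filter -E leader_nth ?hs ?hx // eqxx /=.
by apply: (all_nth _ (inFz_short Fx)); rewrite hx.
Qed.

Lemma vdot_diff x y b : size x = 12 -> size y = 12 -> (b < 12)%N ->
  (forall j, (j < 12)%N -> j != b -> nth b0 x j = nth b0 y j) ->
  vdot x y = (vdot y y - bdot (nth b0 y b) (nth b0 y b) + bdot (nth b0 x b) (nth b0 y b))%BZ.
Proof.
move=> xs ys lb H; rewrite (vdotE xs ys) (vdotE ys ys).
have S (F : nat -> Z) : (\sum_(0 <= j < 12) F j =
    \sum_(0 <= j < b) F j + (F b + \sum_(b.+1 <= j < 12) F j))%R.
  by rewrite (big_cat_nat (n := b)) ?(ltnW lb) //= (big_ltn lb).
rewrite !S.
have E1 : (\sum_(0 <= j < b) bdot (nth b0 x j) (nth b0 y j) =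
          \sum_(0 <= j < b) bdot (nth b0 y j) (nth b0 y j))%R.
  by apply: eq_big_nat => j /andP [_ lj]; rewrite H ?(ltn_trans lj) // neq_ltn lj.
have E2 : (\sum_(b.+1 <= j < 12) bdot (nth b0 x j) (nth b0 y j) =
          \sum_(b.+1 <= j < 12) bdot (nth b0 y j) (nth b0 y j))%R.
  by apply: eq_big_nat => j /andP [lj lj']; rewrite H // neq_ltn lj orbT.
rewrite E1 E2; lia.
Qed.

(* Orbit members differing in a single block would differ by a root. *)
Lemma fiber_two_blocks h L b : size h = 12 -> all (mem htypes) h -> config h L -> (b < 12)%N ->
  {in L &, forall x y, leader h x = leader h y ->
    (forall j, (j < 12)%N -> j != b -> nth b0 x j = nth b0 y j) -> x = y}.
Proof.
move=> hs hh gL lb x y xL yL E H.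
have Fx := config_F gL xL; have Fy := config_F gL yL.
have xs : size x = 12 by case: Fx => -[]. have ys : size y = 12 by case: Fy => -[].
have ub : nth b0 x b \in short_blocks by apply: (all_nth _ (inFz_short Fx)); rewrite xs.
have vb : nth b0 y b \in short_blocks by apply: (all_nth _ (inFz_short Fy)); rewrite ys.
have ht : nth b0 h b \in htypes by apply: all_nth => //; rewrite hs.
have Eb : bleader (nth b0 h b) (nth b0 x b) = bleader (nth b0 h b) (nth b0 y b).
  by rewrite -!leader_nth ?hs ?xs ?ys // E.
have /andP [/andP [_ /allP C] _] := bleader_checkP ht vb.
have := C _ ub; rewrite Eb eqxx /= => /orP [/eqP Exy | /Z.eqb_eq D].
  apply: (@eq_from_nth _ b0) => [|j]; rewrite xs ?ys // => lj.
  by case: (eqVneq j b) => [->|/H ->].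
case: (config_root gL xL yL); rewrite (vdot_diff xs ys lb H) D.
by case: Fy => _ [-> _]; lia.
Qed.

Lemma size_fibers (T U : eqType) (L : seq T) (O : seq U) (key : T -> U) :
  {in L, forall x, key x \in O} ->
  (size L <= sumn [seq size [seq x <- L | key x == o] | o <- O])%N.
Proof.
elim: L => [|x L IH] H //=.
have kx : key x \in O by apply: H; rewrite mem_head.
have -> : sumn [seq size (if key x == o then x :: [seq x <- L | key x == o]
                          else [seq x <- L | key x == o]) | o <- O]
  = (count (fun o => key x == o) O + sumn [seq size [seq x <- L | key x == o] | o <- O])%N.
  elim: O {H IH kx} => //= o O ->; case: (key x == o) => /=; lia.
have : (0 < count (fun o => key x == o) O)%N.
  by rewrite -has_count; apply/hasP; exists (key x).
have HL : {in L, forall x, key x \in O} by move=> y yL; apply: H; rewrite inE yL orbT.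
by have := IH HL; lia.
Qed.

Definition maxpos (s : seq nat) : nat := index (foldr maxn 0 s) s.
Definition mults (h o : seq block) : seq nat := [seq mult p.1 p.2 | p <- zip h o].
Definition dropmul (D : pred nat) (m : seq nat) : nat :=
  foldr muln 1 [seq nth 1 m j | j <- outside D].
(* One block, of the largest orbit, is determined by the others. *)
Definition cap (h o : seq block) : nat :=
  let m := mults h o in let b := maxpos m in dropmul (pred1 (if (b < 12)%N then b else 0)) m.

Lemma dropmulE D h o : size h = 12 -> size o = 12 ->
  foldr muln 1 [seq mult (nth b0 h j) (nth b0 o j) | j <- outside D] = dropmul D (mults h o).
Proof.
move=> hs os; rewrite /dropmul; congr foldr; apply/eq_in_map => j.
rewrite mem_filter mem_iota => /andP [_ lj].
by rewrite (nth_map (b0, b0)) ?size_zip ?hs ?os // nth_zip ?hs ?os.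
Qed.

Lemma leaders_size h o : size h = 12 -> o \in leaders h -> size o = 12.
Proof.
rewrite /leaders => hs; have : all (fun w => size w == 12) words by vm_compute.
elim: words => //= w ws IH /andP [/eqP sw sws]; rewrite mem_cat => /orP [|/(IH sws) //].
have : size (table h) = size w by rewrite size_map hs sw.
rewrite -sw; move: (table h) (36%BZ) {1}(36%BZ) => t.
elim: t w o {IH sws sw} => [|nd t IH] [|c w] //= o n i; first by case: ifP => // _ _; rewrite inE => /eqP ->.
case=> /IH {}IH; case E : (nodes t w) IH => [[r mn] mx] /= IH.
case: (nth _ nd c) => [[s m] M] /=; elim: s => //= -[[v nv] iv] s IHs.
case: ifP => _ //; rewrite mem_cat => /orP [/mapP [x /IH <- ->] // | /IHs //].
Qed.

Lemma fiber_cap h L o : size h = 12 -> all (mem htypes) h -> config h L -> o \in leaders h ->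
  (size [seq x <- L | leader h x == o] <= cap h o)%N.
Proof.
move=> hs hh gL oO; rewrite /cap.
set b := if _ then _ else _.
have lb : (b < 12)%N by rewrite /b; case: ifP.
rewrite -dropmulE ?(leaders_size hs oO) //; apply: fiber_bound => //.
- by apply/filter_uniq/(config_uniq gL).
- by move=> x; rewrite mem_filter => /andP [/eqP E xL]; split => //; apply: (config_F gL).
- move=> x y; rewrite !mem_filter => /andP [/eqP Ex xL] /andP [/eqP Ey yL] H.
  by apply: (fiber_two_blocks hs hh gL lb xL yL) => [|j lj jb]; rewrite ?Ex ?Ey // H.
Qed.

Definition cap_check (h : seq block) : bool :=
  [&& size h == 12, all (mem htypes) h & (sumn [seq cap h o | o <- leaders h] <= 350)%N].

Lemma cap_bounded h : cap_check h -> bounded h.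
Proof.
case/and3P => /eqP hs hh le L gL; apply: leq_trans le.
apply: (leq_trans (@size_fibers _ _ L (leaders h) (leader h) _)).
  by move=> x xL; apply: leader_in_leaders => //; apply: (config_F gL).
have : {subset leaders h <= leaders h} by [].
elim: {1 3 4}(leaders h) => //= o O IH sub.
by rewrite leq_add ?IH ?fiber_cap ?sub ?mem_head // => p pO; apply: sub; rewrite inE pO orbT.
Qed.

(** * Reduction to 29 vectors *)

Module PS := PositiveSet.

(** A prefix code, [c] ones and a zero for the letter [c], which makes sequences usable as keys of
    [PositiveSet] and membership fast to compute. *)
Fixpoint enc (s : seq nat) : positive :=
  if s is c :: s' then iter c xI (xO (enc s')) else xH.
Fixpoint dec (p : positive) (c : nat) : seq nat :=
  match p with
  | xH => [::]
  | xO q => c :: dec q 0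
  | xI q => dec q c.+1
  end.
Lemma decK s : dec (enc s) 0 = s.
Proof.
elim: s => //= c s IH.
have -> : forall k, dec (iter c xI (xO (enc s))) k = (c + k)%N :: s.
  by elim: c => [|c IHc] k /=; rewrite ?IH // IHc addnS.
by rewrite addn0.
Qed.

Section Bfs.
Variable succ : seq nat -> seq (seq nat).
Fixpoint bfs (fuel : nat) (todo : seq (seq nat)) (V : PS.t) : PS.t :=
  match fuel, todo with
  | f.+1, s :: todo' =>
    let: (t, W) := foldr (fun y (acc : seq (seq nat) * PS.t) =>
      let p := enc y in
      if PS.mem p acc.2 then acc else (y :: acc.1, PS.add p acc.2)) (todo', V) (succ s) in
    bfs f t W
  | _, _ => V
  end.
Definition reach (fuel : nat) (s : seq (seq nat)) : PS.t :=
  bfs fuel s (foldr (fun y V => PS.add (enc y) V) PS.empty s).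

Variable P : seq nat -> Prop.
Hypothesis P_succ : forall s t, P s -> t \in succ s -> P t.

Let sound_set (V : PS.t) := forall p, PS.mem p V -> P (dec p 0).

Lemma sound_add y V : P y -> sound_set V -> sound_set (PS.add (enc y) V).
Proof.
move=> Py gV p; move/PS.mem_spec/PS.add_spec => [->|/PS.mem_spec/gV //].
by rewrite decK.
Qed.

Lemma bfsP fuel todo V : {in todo, forall s, P s} -> sound_set V -> sound_set (bfs fuel todo V).
Proof.
elim: fuel todo V => // f IH [|s todo] V //= Pt gV.
have Ps : P s by apply: Pt; rewrite mem_head.
have Pt' : {in todo, forall s, P s} by move=> t tt; apply: Pt; rewrite inE tt orbT.
have : {subset succ s <= succ s} by [].
set fr := foldr _ _ _; rewrite /fr {fr}.
move: {1}(succ s) => S sub.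
suff : {in (foldr (fun y (acc : seq (seq nat) * PS.t) =>
      let p := enc y in
      if PS.mem p acc.2 then acc else (y :: acc.1, PS.add p acc.2)) (todo, V) (succ s)).1, forall s, P s}
   /\ sound_set (foldr (fun y (acc : seq (seq nat) * PS.t) =>
      let p := enc y in
      if PS.mem p acc.2 then acc else (y :: acc.1, PS.add p acc.2)) (todo, V) (succ s)).2.
  by case: (foldr _ _ _) => t W [H1 H2]; apply: IH.
have : {in succ s, forall t, P t} by move=> t; apply: P_succ.
elim: (succ s) => //= y ys IHy Py.
have [H1 H2] : _ /\ _ := IHy (fun t ty => Py t (mem_behead (s := y :: ys) ty)).
have Pyy : P y by apply: Py; rewrite mem_head.
case: ifP => _ //=; split; last exact: sound_add.
by move=> t; rewrite inE => /orP [/eqP -> // | /H1].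
Qed.

(** Only soundness of the search is proved. That it reaches far enough is tested by computation, so
    too little fuel would make a check fail but could not make it wrong. *)
Lemma reachP fuel s t : {in s, forall y, P y} -> PS.mem (enc t) (reach fuel s) -> P t.
Proof.
move=> Ps; rewrite -{2}(decK t); apply: (bfsP (V := _)) => //.
elim: s Ps => [|y s IH] Ps /=; first by move=> p; rewrite PS.mem_Leaf.
apply: sound_add; first by apply: Ps; rewrite mem_head.
by apply: IH => z zs; apply: Ps; rewrite inE zs orbT.
Qed.
End Bfs.

(* A dominant vector is coded by the positions of its blocks' Dynkin labels in
   [dpairs]; [ncode] is the effect of [nrev] on codes. *)
Definition dpairs : seq (nat * nat) :=
  [:: (0,0); (0,1); (1,0); (1,1); (0,2); (2,0); (1,2); (2,1); (0,3); (3,0);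
      (2,2); (1,3); (3,1); (0,4); (4,0)].
Definition bcode (c : nat) : block := dyn (nth (0, 0) dpairs c).
Definition ncode (c : nat) : nat := nth 0 [:: 0; 2; 1; 3; 5; 4; 7; 6; 9; 8; 10; 12; 11; 14; 13] c.
Definition decode (s : seq nat) : seq block := [seq bcode c | c <- s].
Definition cact (g : seq (nat * bool)) (s : seq nat) : seq nat :=
  [seq if p.2 then nth 0 s p.1 else ncode (nth 0 s p.1) | p <- g].

Lemma ncodeP c : (c < 15)%N -> (ncode c < 15)%N /\ bcode (ncode c) = nrev (bcode c).
Proof. by do 15 (case: c => [|c] //). Qed.

Definition valid (s : seq nat) : bool := (size s == 12) && all (fun c => c < 15)%N s.
Definition Pcode (s : seq nat) : Prop := valid s /\ (inNz (decode s) -> bounded (decode s)).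

Lemma decode_cact g s : gok g -> valid s -> valid (cact g s) /\ decode (cact g s) = gact g (decode s).
Proof.
move=> /and4P [/eqP gs pg _ _] /andP [/eqP ss /allP sv].
have lt p : p \in g -> (nth 0 s p.1 < 15)%N /\ (p.1 < 12)%N.
  move=> pi; have : p.1 \in [seq p.1 | p <- g] by apply: map_f.
  by rewrite (perm_mem pg) mem_iota => lp; split => //; apply/sv/mem_nth; rewrite ss.
split.
  rewrite /valid size_map gs eqxx; apply/allP => _ /mapP [p /lt [l15 _] ->].
  by case: p.2 => //; case: (ncodeP l15).
rewrite /decode /cact /gact -map_comp; apply/eq_in_map => p /lt [l15 l12] /=.
rewrite (nth_map 0) ?ss //; case: p.2 => //=.
by case: (ncodeP l15).
Qed.

Lemma Pcode_act g s : gok2 g -> gok2 (ginv g) -> Pcode s -> Pcode (cact g s).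
Proof.
move=> ok ok' [vs Ps]; have /and3P [ok1 ok2 _] := ok.
rewrite /Pcode; have [v ->] := decode_cact ok1 vs; split=> // Nh.
have E : gact (ginv g) (gact g (decode s)) = decode s.
  by apply: (isom_K (gact_isom ok1 ok2)); rewrite size_map; case/andP: vs => /eqP.
apply: (bounded_gact ok' Nh); rewrite E; apply: Ps.
by rewrite -E; apply: gact_inNz.
Qed.

(** For each glue class, the dominant blocks of norm at most 108, as pairs of a code and the norm
    divided by 6. *)
Definition dopt (c : nat) : seq (nat * nat) :=
  nth [::] [:: [:: (0, 0); (3, 3); (8, 9); (9, 9); (10, 12)];
               [:: (1, 1); (5, 4); (6, 7); (12, 13); (13, 16)];
               [:: (2, 1); (4, 4); (7, 7); (11, 13); (14, 16)]] c.
(** A block of nonzero class has norm at least 6, so this bounds from below what the remaining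
    blocks must still spend; [dEnum] prunes with it. *)
Definition wt (w : seq nat) : nat := count (fun c => c != 0) w.
Fixpoint dEnum (w : seq nat) (rem : nat) : seq (seq nat) :=
  if w is c :: w' then
    let m := wt w' in
    foldr (fun (o : nat * nat) acc =>
      if (o.2 + m <= rem)%N then [seq o.1 :: s | s <- dEnum w' (rem - o.2)] ++ acc else acc)
      [::] (dopt c)
  else if rem == 0 then [:: [::]] else [::].

Definition domv (h : seq block) : Prop := forall j, dominant (nth b0 h j).

Lemma dominant_code u : bok u -> dominant u -> (bdot u u <= 108)%BZ ->
  exists k n, [/\ (k, n) \in dopt (bclass u), bcode k = u & bdot u u = Z.of_nat (6 * n)].
Proof.
move=> ok du cap.
pose grid := [seq (a, b, - a - b)%BZ |
  a <- [:: 0; 1; 2; 3; 4; 5; 6; 7; 8]%BZ,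
  b <- [:: -8; -7; -6; -5; -4; -3; -2; -1; 0; 1; 2; 3; 4; 5; 6; 7; 8]%BZ].
have : all (fun u : block => bokb u && (Z.leb u.1.2 u.1.1 && Z.leb u.2 u.1.2)
   && Z.leb (bdot u u) 108 ==>
   has (fun o : nat * nat => (bcode o.1 == u) && Z.eqb (bdot u u) (Z.of_nat (6 * o.2)))
     (dopt (bclass u))) grid by vm_compute.
have ug : u \in grid.
  move: ok du cap; case: u => [[a b] c]; rewrite /bok /dominant /bdot /bsum /=.
  move=> [E0 _] [d1 d2] n.
  have E : c = (- a - b)%BZ by lia.
  rewrite E in d2 n *.
  have Ha : (0 <= a <= 8)%BZ by nia.
  have Hb : (-8 <= b <= 8)%BZ by nia.
  apply: (@allpairs_f _ _ _ (fun a b : Z => (a, b, - a - b)%BZ)).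
    have : (a = 0 \/ a = 1 \/ a = 2 \/ a = 3 \/ a = 4 \/ a = 5 \/ a = 6 \/ a = 7 \/ a = 8)%BZ by lia.
    by do 8 (case=> [->|]) => //; move=> ->.
  have : (b = -8 \/ b = -7 \/ b = -6 \/ b = -5 \/ b = -4 \/ b = -3 \/ b = -2 \/ b = -1 \/
    b = 0 \/ b = 1 \/ b = 2 \/ b = 3 \/ b = 4 \/ b = 5 \/ b = 6 \/ b = 7 \/ b = 8)%BZ by lia.
  by do 16 (case=> [->|]) => //; move=> ->.
move=> /allP H; have /implyP H2 := H u ug.
have : has (fun o : nat * nat => (bcode o.1 == u) && Z.eqb (bdot u u) (Z.of_nat (6 * o.2)))
     (dopt (bclass u)).
  apply: H2; apply/andP; split; last by apply/Z.leb_le.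
  apply/andP; split; first exact/bokP.
  by case: du => d1 d2; apply/andP; split; apply/Z.leb_le; lia.
move=> /hasP [[k n] o /andP [/eqP E /Z.eqb_eq E2]].
by exists k, n.
Qed.

Lemma dEnumP x r : (forall j, (j < size x)%N -> bok (nth b0 x j)) -> domv x ->
  (vdot x x <= 108)%BZ -> vdot x x = Z.of_nat (6 * r) ->
  exists2 s, s \in dEnum (vclass x) r & decode s = x.
Proof.
(* The bound by [wt] joins the induction because the pruning test at the head needs it for the
   tail. *)
suff H : (forall j, (j < size x)%N -> bok (nth b0 x j)) -> domv x ->
  (vdot x x <= 108)%BZ -> vdot x x = Z.of_nat (6 * r) ->
  (wt (vclass x) <= r)%N /\ exists2 s, s \in dEnum (vclass x) r & decode s = x.
  by move=> h1 h2 h3 h4; case: (H h1 h2 h3 h4).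
elim: x r => [|u x IH] r /= xb dx n En.
  have -> : r = 0 by lia.
  by split => //; exists [::].
have [k [m [o Ek Em]]] := dominant_code (xb 0%N isT) (dx 0%N)
  (Z.le_trans _ _ _ (vdot_nth_le (u :: x) 0) n).
have := vsqr_ge0 x => x0; rewrite /= in Em Ek o.
have [||||w [s sE sx]] := IH (r - m)%N.
- by move=> j lj; apply: (xb j.+1).
- by move=> j; apply: (dx j.+1).
- by rewrite /bdot in n; nia.
- by lia.
have lm : (m + wt (vclass x) <= r)%N by lia.
have om : ((bclass u != 0) <= m)%N.
  move: o; case: (bclass u) => [|[|[|c]]] // o; last by rewrite /dopt /= nth_nil in o.
    by have /allP /(_ _ o) : all (fun o => 0 < o.2) (dopt 1) by [].
  by have /allP /(_ _ o) : all (fun o => 0 < o.2) (dopt 2) by [].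
split; first by rewrite /wt /= -/(wt _); lia.
exists (k :: s); last by rewrite /= Ek sx.
elim: (dopt _) o => //= -[k' m'] os IHo; rewrite inE => /orP [/eqP [<- <-]|/IHo H].
  by rewrite /= lm mem_cat map_f.
by case: ifP => // _; rewrite mem_cat H orbT.
Qed.

Definition wact (g : seq (nat * bool)) (w : seq nat) : seq nat :=
  [seq let c := nth 0 w p.1 in if p.2 then c else (3 - c) %% 3 | p <- g].

Lemma bclass_nrev u : bok u -> bclass (nrev u) = (3 - bclass u) %% 3.
Proof.
case: u => [[a b] c] [s [m1 m2]]; rewrite /bclass /bfst /nrev /=.
rewrite /bsum /= in s m1 m2.
have := Z.mod_pos_bound a 3; have := Z.mod_pos_bound (- c) 3.
move=> H1 H2.
have [E|[E|E]] : (a mod 3 = 0 \/ a mod 3 = 1 \/ a mod 3 = 2)%BZ by lia.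
- by rewrite E (_ : (- c) mod 3 = 0)%BZ //; lia.
- by rewrite E (_ : (- c) mod 3 = 2)%BZ //; lia.
- by rewrite E (_ : (- c) mod 3 = 1)%BZ //; lia.
Qed.

Lemma vclass_gact g h : gok g -> inNz h -> vclass (gact g h) = wact g (vclass h).
Proof.
move=> /and4P [/eqP gs pg _ _] [hs [hb _]].
rewrite /vclass /gact /wact -map_comp; apply/eq_in_map => p pi /=.
have lp : (p.1 < 12)%N.
  have : p.1 \in [seq p.1 | p <- g] by apply: map_f.
  by rewrite (perm_mem pg) mem_iota.
rewrite (nth_map b0) ?hs //; case: p.2 => //=.
by rewrite bclass_nrev //; apply: hb.
Qed.

Definition Pword (w : seq nat) : Prop :=
  forall h, inNz h -> vdot h h = 108%BZ -> domv h -> vclass h = w -> bounded h.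

(** The search runs backwards: [bounded_gact] pulls boundedness back from [gact g h] to [h], so the
    successors of a word are preimages of it. The filter rechecks them, which avoids any reasoning
    about [ginv] on words. *)
Definition wsucc (gens : seq (seq (nat * bool))) (w' : seq nat) : seq (seq nat) :=
  [seq w <- [seq wact (ginv g) w' | g <- gens] | has (fun g => wact g w == w') gens].

Lemma domv_gact g h : domv h -> domv (gact g h).
Proof.
move=> dh j; case: (ltnP j (size g)) => lj; last first.
  by rewrite nth_default ?size_map // /dominant /=; lia.
rewrite (nth_map (0, true)) //; case: (nth _ g j) => p [] /=; first exact: dh.
by have := dh p; rewrite /dominant /=; lia.
Qed.

Lemma Pword_succ gens w w' : all gok2 gens -> Pword w' -> w \in wsucc gens w' -> Pword w.
Proof.
move=> /allP ok Pw'; rewrite mem_filter => /andP [/hasP [g gi /eqP E] _] h Nh nh dh wh.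
have ok2 := ok g gi; have /and3P [ok1 ok1' _] := ok2.
apply: (bounded_gact ok2 Nh); apply: Pw'.
- exact: gact_inNz.
- by rewrite (isom_dot (gact_isom ok1 ok1')) //; case: Nh.
- exact: domv_gact.
- by rewrite vclass_gact // wh.
Qed.

Definition csucc (gens : seq (seq (nat * bool))) (s : seq nat) : seq (seq nat) :=
  [seq cact g s | g <- gens].

(* Generators of subgroups of 2.M_12; [gensW] fixes [wordW] for W = 6, 9, 12. *)
Definition gens0 : seq (seq (nat * bool)) :=
  [:: [:: (10,true); (8,true); (9,false); (0,false); (7,true); (5,false); (1,false); (3,false); (2,true); (6,false); (4,false); (11,false)];
   [:: (6,true); (7,true); (4,true); (0,false); (5,false); (2,false); (3,false); (8,true); (1,true); (10,false); (11,true); (9,false)]].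
Definition gens6 : seq (seq (nat * bool)) :=
  [:: [:: (10,true); (4,false); (3,false); (5,false); (6,true); (1,false); (2,true); (7,true); (9,true); (8,true); (11,true); (0,true)];
   [:: (10,true); (1,false); (2,false); (5,false); (4,false); (3,false); (6,false); (9,true); (11,true); (7,true); (0,true); (8,true)]].
Definition gens9 : seq (seq (nat * bool)) :=
  [:: [:: (0,true); (2,false); (1,false); (6,true); (7,false); (10,false); (8,true); (9,true); (3,true); (11,true); (4,true); (5,true)];
   [:: (1,true); (2,true); (0,true); (4,false); (7,false); (5,true); (3,true); (10,false); (11,true); (6,true); (9,false); (8,true)]].
Definition gens12 : seq (seq (nat * bool)) :=
  [:: [:: (6,false); (11,true); (2,true); (3,true); (5,true); (7,true); (10,false); (9,true); (4,true); (8,true); (1,true); (0,true)];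
   [:: (2,true); (8,true); (11,true); (1,true); (4,true); (3,true); (7,false); (0,true); (9,true); (5,true); (10,true); (6,false)]].
Definition word0 : seq nat := [:: 0; 0; 0; 0; 0; 0; 0; 0; 0; 0; 0; 0].
Definition word6 : seq nat := [:: 1; 0; 0; 0; 0; 0; 0; 1; 1; 1; 1; 1].
Definition word9 : seq nat := [:: 0; 0; 0; 1; 2; 1; 1; 1; 1; 1; 2; 1].
Definition word12 : seq nat := [:: 1; 1; 1; 1; 1; 1; 2; 1; 1; 1; 1; 1].

Definition pcodes (h : seq (nat * nat)) : seq nat := [seq index p dpairs | p <- h].

(** The norm 108 is 6 times 18, so [dEnum w 18] contains the codes of all dominant vectors in
    question with glue word [w]. *)
Definition cover_check (gens : seq (seq (nat * bool))) (w : seq nat) (reps : seq (seq (nat * nat))) : bool :=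
  let V := reach (csucc gens) 6000 [seq pcodes h | h <- reps] in
  all (fun s => PS.mem (enc s) V) (dEnum w 18) &&
  all (fun h => valid (pcodes h) && all (mem dpairs) h) reps.

Lemma cover_checkP gens w reps : all (fun g => gok2 g && gok2 (ginv g)) gens ->
  cover_check gens w reps -> {in reps, forall h, bounded [seq dyn p | p <- h]} -> Pword w.
Proof.
move=> /allP ok /andP [/allP C /allP R] B h Nh nh dh wh.
have [s] := dEnumP (r := 18) (fun j lj => (proj1 (proj2 Nh)) j (leq_trans lj (eq_leq (inNz_size Nh))))
   dh (Z.eq_le_incl _ _ nh) nh.
rewrite wh => /C sV E.
suff [_ H] : Pcode s by rewrite -E; apply: H; rewrite E.
apply: (reachP (P := Pcode) _ _ sV).
  by move=> a _ Pa /mapP [g /ok /andP [o1 o2] ->]; apply: Pcode_act.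
move=> _ /mapP [p pr ->]; have /andP [v /allP pd] := R p pr; split => // _.
have -> : decode (pcodes p) = [seq dyn q | q <- p]; last exact: B.
rewrite /decode /pcodes -map_comp; apply/eq_in_map => q /pd qd /=.
by rewrite /bcode nth_index.
Qed.

(** There are 729 code words, so 800 steps exhaust them. *)
Definition word_check gens reps ws : bool :=
  let V := reach (wsucc gens) 800 reps in all (fun w => PS.mem (enc w) V) ws.
Lemma word_cover gens reps ws : all gok2 gens ->
  word_check gens reps ws -> {in reps, forall w, Pword w} -> {in ws, forall w, Pword w}.
Proof.
move=> ok /allP C HP w /C; apply: reachP => // w1 w2 P1; exact: (Pword_succ ok P1).
Qed.

Definition word_reps : seq (seq nat) := [:: word0; word6; word9; word12].
Lemma words_checkP : word_check gens0 word_reps words.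
Proof. vm_cast_no_check (erefl true). Qed.

Lemma gens0_ok : all gok2 gens0. Proof. by vm_compute. Qed.

Lemma bounded_all h : {in word_reps, forall w, Pword w} ->
  inNz h -> vdot h h = 108%BZ -> bounded h.
Proof.
move=> HP Nh nh; apply: (bounded_sort Nh).
set h' := pact _ h.
have i1 : isom (pact (fun j => sortc (nth b0 h j))) (pact (fun j => binv (sortc (nth b0 h j)))).
  by apply: pact_isom => j u; rewrite bpermK.
have Nh' : inNz h' by apply: (isom_N i1).
have hs := inNz_size Nh.
have : Pword (vclass h') by apply: (word_cover gens0_ok words_checkP HP); apply: wordsP.
apply=> //; first by rewrite (isom_dot i1).
move=> j; case: (ltnP j 12) => lj; first by rewrite nth_mkseq //; apply: sortcP.
by rewrite nth_default ?size_mkseq // /dominant /=; lia.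
Qed.

(** * The orbits of triples in four blocks *)

Lemma vdot_relation n z a1 a2 a3 c1 c2 c3 r :
  size z = n -> size a1 = n -> size a2 = n -> size a3 = n ->
  size c1 = n -> size c2 = n -> size c3 = n -> size r = n ->
  (forall j w, (j < n)%N ->
    bdot w (nth b0 a1 j) - 2 * bdot w (nth b0 a2 j) + bdot w (nth b0 a3 j)
    - (bdot w (nth b0 c1 j) - 2 * bdot w (nth b0 c2 j) + bdot w (nth b0 c3 j))
    = 3 * bdot w (nth b0 r j))%BZ ->
  (vdot z a1 - 2 * vdot z a2 + vdot z a3
   - (vdot z c1 - 2 * vdot z c2 + vdot z c3) = 3 * vdot z r)%BZ.
Proof.
have vc u x v y : vdot (u :: x) (v :: y) = (bdot u v + vdot x y)%BZ by [].
elim: n z a1 a2 a3 c1 c2 c3 r => [|n IH] [|z zs] [|a1 s1] [|a2 s2] [|a3 s3] [|c1 t1] [|c2 t2] [|c3 t3] [|r rs] //.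
move=> [S0] [S1] [S2] [S3] [S4] [S5] [S6] [S7] H.
have := H 0 z isT; rewrite ![nth _ (_ :: _) 0]/nth => H0.
have := IH _ _ _ _ _ _ _ _ S0 S1 S2 S3 S4 S5 S6 S7 (fun j w lj => H j.+1 w lj).
rewrite !vc; move: (bdot _ _) (bdot _ _) H0; lia.
Qed.

(** A class of three elements in a zero block consists of the minimal vectors of one nonzero glue
    class: they sum to zero and differ by roots. *)
Definition tri_check (v : block) : bool :=
  let s := bfiber b0 v in
  all (fun p => all (fun q => all (fun r => [&& p != q, p != r & q != r] ==>
    [&& Z.eqb (p.1.1 + q.1.1 + r.1.1) 0, Z.eqb (p.1.2 + q.1.2 + r.1.2) 0
      & Z.eqb (p.2 + q.2 + r.2) 0]%BZ) s) s) s &&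
  all (fun p => all (fun q => (p != q) ==>
    let d := (q.1.1 - p.1.1, q.1.2 - p.1.2, q.2 - p.2)%BZ in
    [&& bokb d, Z.eqb (bfst d mod 3)%BZ 0 & Z.eqb (bdot d d) 18]) s) s.

Lemma tri_checkP v : v \in short_blocks -> mult b0 v = 3 -> tri_check v.
Proof.
have : all (fun v => (mult b0 v == 3) ==> tri_check v) short_blocks by vm_compute.
by move=> /allP H /H /implyP I /eqP /I.
Qed.

Section Tetrad.
Variables (h o : seq block) (L : seq (seq block)).
Hypotheses (hs : size h = 12) (hh : all (mem htypes) h) (gL : config h L).
Variables (c1 c2 c3 c4 : nat).
Let bs := [:: c1; c2; c3; c4].
Hypothesis lbs : all (fun j => j < 12)%N bs.
Hypothesis zbs : all (fun j => (nth b0 h j == b0) && (mult b0 (nth b0 o j) == 3)) bs.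
Hypothesis obs : all (fun j => (j \in bs) || (mult (nth b0 h j) (nth b0 o j) == 1)) (iota 0 12).

Let X := [seq x <- L | leader h x == o].

Let XL x : x \in X -> x \in L. Proof. by rewrite mem_filter => /andP []. Qed.
Let Xs x : x \in X -> size x = 12. Proof. by move/XL => /(config_F gL) [] []. Qed.
Let Xo x : x \in X -> leader h x = o. Proof. by rewrite mem_filter => /andP [/eqP]. Qed.
Let Xshort x j : x \in X -> (j < 12)%N -> nth b0 x j \in short_blocks.
Proof. by move=> xX lj; apply: (all_nth _ (inFz_short (config_F gL (XL xX)))); rewrite (Xs xX). Qed.
Let Xpre x j : x \in X -> (j < 12)%N -> nth b0 x j \in bfiber (nth b0 h j) (nth b0 o j).
Proof.
by move=> xX lj; rewrite mem_filter Xshort // -(Xo xX) leader_nth ?hs ?(Xs xX) // eqxx.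
Qed.
Let ht j : (j < 12)%N -> nth b0 h j \in htypes.
Proof. by move=> lj; apply: (all_nth _ hh); rewrite hs. Qed.
Let bfiber_size x j : x \in X -> (j < 12)%N ->
  size (bfiber (nth b0 h j) (nth b0 o j)) = mult (nth b0 h j) (nth b0 o j).
Proof.
move=> xX lj; rewrite -(Xo xX) leader_nth ?hs ?(Xs xX) //.
have /andP [/andP [/and5P [cb /eqP cc _ _ _] _] _] := bleader_checkP (ht lj) (Xshort xX lj).
by have /andP [_ /eqP] := bleader_checkP (ht lj) cb; rewrite cc => <-.
Qed.

Let Xout x y j : x \in X -> y \in X -> (j < 12)%N -> j \notin bs -> nth b0 x j = nth b0 y j.
Proof.
move=> xX yX lj jb.
have /allP /(_ j) := obs; rewrite mem_iota lj (negPf jb) => /(_ isT) /eqP m1.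
have := bfiber_size xX lj; rewrite m1.
have := Xpre xX lj; have := Xpre yX lj.
by case: (bfiber _ _) => [|p [|]] //; rewrite !inE => /eqP -> /eqP ->.
Qed.

Let Xeq x y b : x \in X -> y \in X -> b \in bs ->
  (forall j, j \in bs -> j != b -> nth b0 x j = nth b0 y j) -> x = y.
Proof.
move=> xX yX bb H; have lb : (b < 12)%N by have /allP := lbs; apply.
apply: (fiber_two_blocks hs hh gL lb (XL xX) (XL yX)) => [|j lj jb]; first by rewrite !Xo.
by case: (boolP (j \in bs)) => jbs; [exact: H | exact: Xout].
Qed.

(** With the entries in [c1] and [c2] fixed, two distinct members differ in both [c3] and [c4]; a
    row is thus the graph of a partial injection between two sets of three elements. *)
Let row u v := [seq x <- X | (nth b0 x c1 == u) && (nth b0 x c2 == v)].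
Let rowX u v x : x \in row u v -> [/\ x \in X, nth b0 x c1 = u & nth b0 x c2 = v].
Proof. by rewrite mem_filter => /andP [/andP [/eqP ? /eqP ?] ?]. Qed.

Let bsE j : (j \in bs) = [|| j == c1, j == c2, j == c3 | j == c4].
Proof. by rewrite !inE. Qed.

Let row_inj u v : {in row u v &, injective (fun x => nth b0 x c3)}.
Proof.
move=> x y /rowX [xX x1 x2] /rowX [yX y1 y2] E.
apply: (Xeq xX yX (b := c4)) => [|j]; first by rewrite bsE eqxx !orbT.
rewrite bsE => /or4P [] /eqP ->; rewrite ?x1 ?x2 ?y1 ?y2 ?eqxx //.
Qed.

Let c3P : [/\ (c3 < 12)%N, nth b0 h c3 = b0 & mult b0 (nth b0 o c3) = 3].
Proof.
have c3b : c3 \in bs by rewrite bsE eqxx !orbT.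
have /allP /(_ _ c3b) /andP [/eqP ? /eqP ?] := zbs.
by split=> //; have /allP := lbs; apply.
Qed.
Let c4P : [/\ (c4 < 12)%N, nth b0 h c4 = b0 & mult b0 (nth b0 o c4) = 3].
Proof.
have c4b : c4 \in bs by rewrite bsE eqxx !orbT.
have /allP /(_ _ c4b) /andP [/eqP ? /eqP ?] := zbs.
by split=> //; have /allP := lbs; apply.
Qed.

Let row_map u v : {subset [seq nth b0 x c3 | x <- row u v] <= bfiber b0 (nth b0 o c3)}.
Proof.
have [l3 z3 _] := c3P.
by move=> _ /mapP [x /rowX [xX _ _] ->]; have := Xpre xX l3; rewrite z3.
Qed.
Let row_uniq u v : uniq [seq nth b0 x c3 | x <- row u v].
Proof.
rewrite map_inj_in_uniq; last exact: row_inj.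
by apply/filter_uniq/filter_uniq/(config_uniq gL).
Qed.

Let pre3 x : x \in X -> size (bfiber b0 (nth b0 o c3)) = 3.
Proof. by move=> xX; have [l3 z3 m3] := c3P; have := bfiber_size xX l3; rewrite z3 m3. Qed.

Let row_le u v : (size (row u v) <= 3)%N.
Proof.
case E : (row u v) => [|x s] //; have /rowX [xX _ _] : x \in row u v by rewrite E mem_head.
rewrite -E -(size_map (fun x => nth b0 x c3)) -(pre3 xX).
by apply: uniq_leq_size; [exact: row_uniq | exact: row_map].
Qed.

Let row_full u v : size (row u v) = 3 ->
  forall t, t \in bfiber b0 (nth b0 o c3) -> exists2 x, x \in row u v & nth b0 x c3 = t.
Proof.
move=> s3 t tp.
have [x0 x0r] : exists x, x \in row u v.
  by case: (row u v) s3 => // x s _; exists x; rewrite mem_head.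
have [x0X _ _] := rowX x0r.
have [_ E] := uniq_min_size (row_uniq u v) (@row_map u v)
  (eq_leq (etrans (pre3 x0X) (etrans (esym s3) (esym (size_map _ _))))).
by move: tp; rewrite -E => /mapP [x xr ->]; exists x.
Qed.

(* Two full rows are Latin rows without a common entry; their second
   differences differ by three times a root. *)
Let rows_excl u v v' : v != v' -> size (row u v) = 3 -> size (row u v') = 3 -> False.
Proof.
move=> vv' s s'.
have [x0 x0r] : exists x, x \in row u v.
  by case: (row u v) s => // x t _; exists x; rewrite mem_head.
have [x0X _ _] := rowX x0r.
have [l4 z4 m4] := c4P.
have [l3 z3 m3] := c3P.
have u3 : uniq (bfiber b0 (nth b0 o c3)) by apply: filter_uniq; vm_compute.
have s3 := pre3 x0X.
move: (row_full s) (row_full s') u3 s3.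
case: (bfiber b0 (nth b0 o c3)) => [|t0 [|t1 [|t2 [|]]]] // R R' u3 _.
have [a0 A0 e0] := R t0 (mem_head _ _).
have [a1 A1 e1] : exists2 x, x \in row u v & nth b0 x c3 = t1 by apply: R; rewrite !inE eqxx !orbT.
have [a2 A2 e2] : exists2 x, x \in row u v & nth b0 x c3 = t2 by apply: R; rewrite !inE eqxx !orbT.
have [d0 D0 f0] := R' t0 (mem_head _ _).
have [d1 D1 f1] : exists2 x, x \in row u v' & nth b0 x c3 = t1 by apply: R'; rewrite !inE eqxx !orbT.
have [d2 D2 f2] : exists2 x, x \in row u v' & nth b0 x c3 = t2 by apply: R'; rewrite !inE eqxx !orbT.
move: u3; rewrite /= !inE !negb_or => /and3P [/andP [n01 n02] n12 _].
have key w x y : x \in row u w -> y \in row u w -> nth b0 x c3 != nth b0 y c3 ->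
    nth b0 x c4 != nth b0 y c4.
  move=> /rowX [xX x1 x2] /rowX [yX y1 y2]; apply: contra => /eqP E; apply/eqP.
  congr (nth b0 _ c3); apply: (Xeq xX yX (b := c3)) => [|j]; first by rewrite bsE eqxx !orbT.
  by rewrite bsE => /or4P [] /eqP ->; rewrite ?x1 ?x2 ?y1 ?y2 ?eqxx.
have cross x y : x \in row u v -> y \in row u v' -> nth b0 x c3 = nth b0 y c3 ->
    nth b0 x c4 != nth b0 y c4.
  move=> /rowX [xX x1 x2] /rowX [yX y1 y2] E3; apply/eqP => E4.
  move: vv'; rewrite -x2 -y2; apply/negP; rewrite negbK; apply/eqP.
  congr (nth b0 _ c2); apply: (Xeq xX yX (b := c2)) => [|j]; first by rewrite bsE eqxx !orbT.
  by rewrite bsE => /or4P [] /eqP ->; rewrite ?x1 ?y1 ?eqxx.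
have ob4 : nth b0 o c4 \in short_blocks.
  rewrite -(Xo x0X) leader_nth ?hs ?(Xs x0X) //.
  by have /andP [/andP [/and5P [-> _ _ _ _] _] _] := bleader_checkP (ht l4) (Xshort x0X l4).
have := tri_checkP ob4 m4; rewrite /tri_check => /andP [T1 T2].
have p4 x w : x \in row u w -> nth b0 x c4 \in bfiber b0 (nth b0 o c4).
  by move=> /rowX [xX _ _]; have := Xpre xX l4; rewrite z4.
have sum0 w x y z : x \in row u w -> y \in row u w -> z \in row u w ->
    nth b0 x c3 != nth b0 y c3 -> nth b0 x c3 != nth b0 z c3 -> nth b0 y c3 != nth b0 z c3 ->
    forall w', (bdot w' (nth b0 x c4) + bdot w' (nth b0 y c4) + bdot w' (nth b0 z c4) = 0)%BZ.
  move=> xr yr zr n1 n2 n3 w'.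
  have /allP /(_ _ (p4 _ _ yr)) /allP /(_ _ (p4 _ _ zr)) := allP T1 _ (p4 _ _ xr).
  rewrite (key _ _ _ xr yr n1) (key _ _ _ xr zr n2) (key _ _ _ yr zr n3) /=.
  move=> /and3P [/Z.eqb_eq E1 /Z.eqb_eq E2 /Z.eqb_eq E3]; rewrite /bdot.
  nia.
set q := nth b0 d1 c4; set p := nth b0 a1 c4.
have npq : p != q by apply: cross; rewrite ?e1 ?f1.
have /allP /(_ _ (p4 _ _ D1)) := allP T2 _ (p4 _ _ A1).
rewrite -/p -/q npq /=; set d := (_, _, _) => /and3P [/bokP dok /Z.eqb_eq d3 /Z.eqb_eq d18].
pose r := mkseq (fun j => if j == c4 then d else b0) 12.
have rs : size r = 12 by rewrite size_mkseq.
have rn j : (j < 12)%N -> nth b0 r j = if j == c4 then d else b0.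
  by move=> lj; rewrite nth_mkseq.
have Nr : inNz r.
  split=> //; split=> [j lj|]; first by rewrite rn //; case: ifP.
  by exists (fun _ => 0%BZ) => j lj; rewrite rn //; case: ifP => _; rewrite ?Z.sub_0_r.
have [a0X a01 a02] := rowX A0. have [a1X a11 a12] := rowX A1. have [a2X a21 a22] := rowX A2.
have [d0X d01 d02] := rowX D0. have [d1X d11 d12] := rowX D1. have [d2X d21 d22] := rowX D2.
apply: (config_triple gL (XL a0X) (XL a1X) (XL a2X) (XL d0X) (XL d1X) (XL d2X) Nr).
  move=> z zs; apply: (vdot_relation zs (Xs a0X) (Xs a1X) (Xs a2X) (Xs d0X) (Xs d1X) (Xs d2X) rs) => j w lj.
  (* In block [c4] the three entries of a full row sum to zero, so its second difference is -3 times
     the middle entry. In block [c3] the two rows agree, and elsewhere each row is constant. *)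
  rewrite rn //; case: (eqVneq j c4) => [->|j4].
    have H1 := sum0 _ _ _ _ A0 A1 A2; rewrite e0 e1 e2 in H1.
    have H2 := sum0 _ _ _ _ D0 D1 D2; rewrite f0 f1 f2 in H2.
    have := H1 n01 n02 n12 w; have := H2 n01 n02 n12 w; rewrite -/p -/q.
    have -> : bdot w d = (bdot w q - bdot w p)%BZ by rewrite /bdot /d /=; lia.
    lia.
  have Z0 : bdot w b0 = 0%BZ by rewrite /bdot /=; lia.
  rewrite Z0; case: (boolP (j \in bs)) => [|jb].
    rewrite bsE (negPf j4) orbF => /or3P [] /eqP ->.
    - by rewrite a01 a11 a21 d01 d11 d21; lia.
    - by rewrite a02 a12 a22 d02 d12 d22; lia.
    - by rewrite e0 e1 e2 f0 f1 f2; lia.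
  rewrite (Xout a1X a0X lj jb) (Xout a2X a0X lj jb) (Xout d0X a0X lj jb).
  by rewrite (Xout d1X a0X lj jb) (Xout d2X a0X lj jb); lia.
rewrite (vdotE rs rs) (bigD1_seq c4) ?mem_index_iota ?iota_uniq // big1_seq.
  by rewrite rn // eqxx d18.
by move=> j /andP [jc]; rewrite mem_index_iota => /andP [_ lj]; rewrite rn // (negPf jc).
Qed.

(** For each of the three entries in [c1] at most one of the three rows is full, which gives
    [3 + 2 + 2 = 7] members, hence 21 in all. *)
Lemma tetrad_bound : (size X <= 21)%N.
Proof.
case E : X => [|x X'] //; rewrite -E.
have xX : x \in X by rewrite E mem_head.
have c1b : c1 \in bs by rewrite bsE eqxx.
have c2b : c2 \in bs by rewrite bsE eqxx orbT.
have l1 : (c1 < 12)%N by have /allP := lbs; apply.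
have l2 : (c2 < 12)%N by have /allP := lbs; apply.
have /allP /(_ _ c1b) /andP [/eqP z1 /eqP m1] := zbs.
have /allP /(_ _ c2b) /andP [/eqP z2 /eqP m2] := zbs.
have s1 : size (bfiber b0 (nth b0 o c1)) = 3 by have := bfiber_size xX l1; rewrite z1 m1.
have s2 : size (bfiber b0 (nth b0 o c2)) = 3 by have := bfiber_size xX l2; rewrite z2 m2.
have u2 : uniq (bfiber b0 (nth b0 o c2)) by apply: filter_uniq; vm_compute.
have P1 := @size_fibers _ _ X (bfiber b0 (nth b0 o c1)) (fun x => nth b0 x c1).
apply: (leq_trans (P1 _)) => [y yX|]; first by have := Xpre yX l1; rewrite z1.
have H u : (size [seq x <- X | nth b0 x c1 == u] <= 7)%N.
  have P2 := @size_fibers _ _ [seq x <- X | nth b0 x c1 == u] (bfiber b0 (nth b0 o c2)) (fun x => nth b0 x c2).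
  apply: (leq_trans (P2 _)) => [y|].
    by rewrite mem_filter => /andP [_ yX]; have := Xpre yX l2; rewrite z2.
  have R v : size [seq x <- [seq x <- X | nth b0 x c1 == u] | nth b0 x c2 == v] = size (row u v).
    by rewrite -filter_predI /row; congr size; apply: eq_filter => y /=; rewrite andbC.
  case: (bfiber b0 (nth b0 o c2)) s2 u2 => [|v0 [|v1 [|v2 [|]]]] //= _.
  rewrite !inE !negb_or !R => /and3P [/andP [n01 n02] n12 _].
  have := row_le u v0; have := row_le u v1; have := row_le u v2.
  have := @rows_excl u _ _ n01; have := @rows_excl u _ _ n02; have := @rows_excl u _ _ n12.
  move: (size (row u v0)) (size (row u v1)) (size (row u v2)) => k0 k1 k2 E1 E2 E3 L2 L1 L0.
  have [?|?] := eqVneq k0 3; have [?|?] := eqVneq k1 3; have [?|?] := eqVneq k2 3;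
    first [by case: E1 | by case: E2 | by case: E3 | lia].
case: (bfiber b0 (nth b0 o c1)) s1 => [|v0 [|v1 [|v2 [|]]]] //= _.
exact: (leq_add (H v0) (leq_add (H v1) (leq_add (H v2) (leqnn 0)))).
Qed.
End Tetrad.

(** Sixteen orbits are admissible because [16 * 21 = 336]. *)
Definition tetrad_check (h : seq block) : bool :=
  [&& size h == 12, all (mem htypes) h, (size (leaders h) <= 16)%N &
   all (fun o =>
     let bs := [seq j <- iota 0 12 | mult (nth b0 h j) (nth b0 o j) == 3] in
     [&& size bs == 4, all (fun j => nth b0 h j == b0) bs &
       all (fun j => (j \in bs) || (mult (nth b0 h j) (nth b0 o j) == 1)) (iota 0 12)])
     (leaders h)].

Lemma tetrad_bounded h : tetrad_check h -> bounded h.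
Proof.
case/and4P => /eqP hs hh le /allP C L gL.
have le21 : (size (leaders h) * 21 <= 350)%N by lia.
apply: leq_trans le21.
apply: (leq_trans (@size_fibers _ _ L (leaders h) (leader h) _)).
  by move=> x xL; apply: leader_in_leaders => //; apply: (config_F gL).
have : {subset leaders h <= leaders h} by [].
elim: {1 3 4}(leaders h) => //= o O IH sub.
rewrite mulSn leq_add ?IH // => [|p pO]; last by apply: sub; rewrite inE pO orbT.
have := C o (sub _ (mem_head _ _)); set bs := [seq j <- _ | _]; case/and3P.
have lbs : all (fun j => j < 12)%N bs.
  by apply/allP => j; rewrite mem_filter mem_iota => /andP [].
have mbs : all (fun j => mult (nth b0 h j) (nth b0 o j) == 3) bs by apply: filter_all.
clearbody bs; move: lbs mbs.
case: bs => [|c1 [|c2 [|c3 [|c4 [|]]]]] // lbs mbs _ zbs obs.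
have zbs' : all (fun j => (nth b0 h j == b0) && (mult b0 (nth b0 o j) == 3)) [:: c1; c2; c3; c4].
  apply/allP => j jb; have /eqP z := allP zbs j jb.
  by rewrite z eqxx /=; have := allP mbs j jb; rewrite z.
exact: (tetrad_bound hs hh gL lbs zbs' obs).
Qed.

(** * Orbits cut by a hyperplane *)

Arguments Z.mul : simpl never.
Arguments Z.add : simpl never.
Arguments Z.sub : simpl never.
Arguments Z.opp : simpl never.

(* Up to the scale, the product with the root of the block orthogonal to [hb]. *)
Definition udiff (hb w : block) : Z :=
  let: (p, q, r) := hb in
  if Z.eqb p q then (w.1.1 - w.1.2)%BZ else if Z.eqb q r then (w.1.2 - w.2)%BZ else 0%BZ.
Definition bswap (hb o : block) : block :=
  let: (p, q, r) := hb in
  if Z.eqb p q then (o.1.2, o.1.1, o.2) else (o.1.1, o.2, o.1.2).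
Definition swap_check (hb v : block) : bool :=
  let: (p, q, r) := hb in
  let o := bleader hb v in
  (v == o) || (mult hb o == 2) &&
  ((Z.eqb p q && (v == (o.1.2, o.1.1, o.2)) && Z.eqb (o.1.1 - o.1.2) 3) ||
   (~~ Z.eqb p q && Z.eqb q r && (v == (o.1.1, o.2, o.1.2)) && Z.eqb (o.1.2 - o.2) 3)).

Lemma swap_checkP hb v : hb \in htypes -> v \in short_blocks ->
  (hb != b0) || (mult hb (bleader hb v) == 1) -> swap_check hb v.
Proof.
have : all (fun hb => all (fun v => (hb != b0) || (mult hb (bleader hb v) == 1) ==>
  swap_check hb v) short_blocks) htypes by vm_compute.
by move=> /allP H /H /allP I /I /implyP.
Qed.

(** Outside zero blocks a class is at most a leader and its mirror image in the wall. Their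
    difference is the wall root, whose product with [w] is [3 * udiff hb w] in this scale. *)
Lemma bleader_swap hb v w : hb \in htypes -> v \in short_blocks ->
  (hb != b0) || (mult hb (bleader hb v) == 1) ->
  v = bleader hb v \/
  [/\ mult hb (bleader hb v) = 2, v = bswap hb (bleader hb v) &
      bdot v w = (bdot (bleader hb v) w - 3 * udiff hb w)%BZ].
Proof.
move=> ht vb hz; have := swap_checkP ht vb hz; rewrite /swap_check /bswap /udiff.
case: hb {ht hz} => [[p q] r]; set o := bleader _ _.
clearbody o; case: o => [[o1 o2] o3].
case/orP => [/eqP ? | /andP [/eqP m]]; first by left.
move: (mult _ _) m => mm m.
case: (Z.eqb p q) => /=.
  rewrite orbF => /andP [/eqP E /Z.eqb_eq D]; right; split => //.
  rewrite E /bdot; cbn [fst snd] in D |- *; have -> : o1 = (o2 + 3)%BZ by lia.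
  by ring.
case: (Z.eqb q r) => //= /andP [/eqP E /Z.eqb_eq D]; right; split => //.
rewrite E /bdot; cbn [fst snd] in D |- *; have -> : o2 = (o3 + 3)%BZ by lia.
by ring.
Qed.

Lemma vdot_diff2 x y w a c : size x = 12 -> size y = 12 -> size w = 12 ->
  (a < 12)%N -> (c < 12)%N -> a != c ->
  (forall j, (j < 12)%N -> j != a -> j != c -> nth b0 x j = nth b0 y j) ->
  (vdot x w - vdot y w =
   (bdot (nth b0 x a) (nth b0 w a) - bdot (nth b0 y a) (nth b0 w a)) +
   (bdot (nth b0 x c) (nth b0 w c) - bdot (nth b0 y c) (nth b0 w c)))%BZ.
Proof.
move=> xs ys ws la lc ac H; rewrite (vdotE xs ws) (vdotE ys ws).
have S (F : nat -> Z) : (\sum_(0 <= j < 12) F j =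
    F a + (F c + \sum_(0 <= j < 12 | j != c) (if j != a then F j else 0)))%R.
  rewrite (bigD1_seq a) ?mem_index_iota ?iota_uniq //= big_mkcond /=.
  by rewrite (bigD1_seq c) ?mem_index_iota ?iota_uniq //= eq_sym ac.
rewrite !S.
have -> : (\sum_(0 <= j < 12 | j != c) (if j != a then bdot (nth b0 x j) (nth b0 w j) else 0) =
  \sum_(0 <= j < 12 | j != c) (if j != a then bdot (nth b0 y j) (nth b0 w j) else 0))%R.
  rewrite big_nat_cond [RHS]big_nat_cond; apply: eq_bigr => j /andP [/andP [_ lj] jc].
  by case: ifP => // ja; rewrite H.
move: (bigop.body _ _ _) => R.
rewrite /GRing.add /=; lia.
Qed.

Lemma prod_pow2 (m : nat -> nat) (J : seq nat) :
  {in J, forall j, (m j == 1) || (m j == 2)} ->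
  foldr muln 1 [seq m j | j <- J] = 2 ^ count (fun j => m j == 2) J.
Proof.
elim: J => //= j J IH H; rewrite IH => [|k kJ]; last by apply: H; rewrite inE kJ orbT.
by have := H j (mem_head _ _); case/orP => /eqP ->; rewrite ?mul1n //= expnS.
Qed.

Definition tset (h o : seq block) : seq nat :=
  [seq j <- iota 0 12 | mult (nth b0 h j) (nth b0 o j) == 2].
(* Fiber members equal outside two walls coincide if exactly one of the two has [udiff]
   zero; four members on three walls would force u_a = u_c and u_a = - u_c. *)
Definition gbound (S : seq bool) (T : seq nat) : nat :=
  let k := size T in let s := count (nth false S) T in
  if (0 < s)%N && (s < k)%N then 2 ^ (k - 2)
  else if (k == 3) && (s == 3) then 3 else 2 ^ k.-1.
Definition nonzero_set (h w : seq block) : seq bool :=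
  mkseq (fun j => ~~ Z.eqb (udiff (nth b0 h j) (nth b0 w j)) 0) 12.

Section Walls.
Variables (h : seq block) (L : seq (seq block)) (w : seq block).
Hypotheses (hs : size h = 12) (hh : all (mem htypes) h) (gL : config h L).
Hypotheses (ws : size w = 12) (wL : forall x, x \in L -> vdot x w = 0%BZ).
Variable o : seq block.
Hypothesis hz : forall j, (j < 12)%N ->
  (nth b0 h j != b0) || (mult (nth b0 h j) (nth b0 o j) == 1).
Let X := [seq x <- L | leader h x == o].
Let u j := udiff (nth b0 h j) (nth b0 w j).

Let XL x : x \in X -> x \in L. Proof. by rewrite mem_filter => /andP []. Qed.
Let Xs x : x \in X -> size x = 12. Proof. by move/XL => /(config_F gL) [] []. Qed.
Let Xo x : x \in X -> leader h x = o. Proof. by rewrite mem_filter => /andP [/eqP]. Qed.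
Let ht j : (j < 12)%N -> nth b0 h j \in htypes.
Proof. by move=> lj; apply: (all_nth _ hh); rewrite hs. Qed.
Let Xshort x j : x \in X -> (j < 12)%N -> nth b0 x j \in short_blocks.
Proof. by move=> xX lj; apply: (all_nth _ (inFz_short (config_F gL (XL xX)))); rewrite (Xs xX). Qed.
Let oj x j : x \in X -> (j < 12)%N -> nth b0 o j = bleader (nth b0 h j) (nth b0 x j).
Proof. by move=> xX lj; rewrite -(Xo xX) leader_nth ?hs ?(Xs xX). Qed.
(** Under [hz] a member of the orbit is coded by signs: for each wall, whether its block is the
    leader or the mirror image. *)
Let sg j (x : seq block) := nth b0 x j == nth b0 o j.

Let oswap x j v : x \in X -> (j < 12)%N ->
  let hb := nth b0 h j in let u := nth b0 x j in
  u = nth b0 o j \/ [/\ mult hb (nth b0 o j) = 2, u = bswap hb (nth b0 o j) &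
      bdot u v = (bdot (nth b0 o j) v - 3 * udiff hb v)%BZ].
Proof.
move=> xX lj /=; rewrite (oj xX lj); apply: bleader_swap (ht lj) (Xshort xX lj) _.
by rewrite -(oj xX lj); apply: hz.
Qed.

Let mult12 x j : x \in X -> (j < 12)%N ->
  (mult (nth b0 h j) (nth b0 o j) == 1) || (mult (nth b0 h j) (nth b0 o j) == 2).
Proof.
move=> xX lj; have := hz lj; case: eqP => [_ /= -> // | hn _]; move/eqP: hn.
rewrite (oj xX lj) /mult; case: (nth b0 h j) (bleader _ _) => [[p q] r] [[a b] c].
case: ifP => [/and3P [/Z.eqb_eq -> /Z.eqb_eq -> /Z.eqb_eq ->] //|_ _].
by case: ifP => // _; case: ifP.
Qed.

Let sg_eq x y j : x \in X -> y \in X -> (j < 12)%N -> sg j x = sg j y ->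
  nth b0 x j = nth b0 y j.
Proof.
move=> xX yX lj; rewrite /sg.
have := oswap b0 xX lj; have := oswap b0 yX lj => /= -[-> | [_ Ey _]] [-> | [_ Ex _]] //.
- by rewrite eqxx => /eqP.
- by rewrite eqxx => /esym /eqP.
- by rewrite Ex Ey.
Qed.

Let sg_val x j : x \in X -> (j < 12)%N ->
  bdot (nth b0 x j) (nth b0 w j) =
  (bdot (nth b0 o j) (nth b0 w j) - (if sg j x then 0 else 3 * u j))%BZ.
Proof.
move=> xX lj; rewrite /sg.
have := oswap (nth b0 w j) xX lj => /=.
case: eqP => [-> _|ne [//|[_ _ ->]] //]; lia.
Qed.

Let sg_T x j : x \in X -> (j < 12)%N -> j \notin tset h o -> sg j x.
Proof.
move=> xX lj; rewrite mem_filter mem_iota lj andbT /sg.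
have := oswap b0 xX lj => /=.
by case=> [-> _|[-> _ _]]; rewrite eqxx.
Qed.

Let eq1 x y a : x \in X -> y \in X -> (a < 12)%N ->
  (forall j, (j < 12)%N -> j != a -> sg j x = sg j y) -> x = y.
Proof.
move=> xX yX la H; apply: (fiber_two_blocks hs hh gL la (XL xX) (XL yX)); first by rewrite !Xo.
by move=> j lj ja; apply: sg_eq => //; apply: H.
Qed.

(** Leaving the leader at wall [j] changes the product with [w] by [-3 * u j]. Both members are
    orthogonal to [w], so the changes at the two walls cancel; their relative sign depends on
    whether both walls are left in the same direction. *)
Let pairrel x y a c : x \in X -> y \in X -> (a < 12)%N -> (c < 12)%N -> a != c ->
  (forall j, (j < 12)%N -> j != a -> j != c -> sg j x = sg j y) ->
  sg a x != sg a y -> sg c x != sg c y ->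
  (if sg a x == sg c x then u a + u c = 0 else u a - u c = 0)%BZ.
Proof.
move=> xX yX la lc ac H na nc.
have E := vdot_diff2 (Xs xX) (Xs yX) ws la lc ac
  (fun j lj ja jc => sg_eq xX yX lj (H j lj ja jc)).
rewrite (wL (XL xX)) (wL (XL yX)) (sg_val xX la) (sg_val yX la) (sg_val xX lc) (sg_val yX lc) in E.
move: na nc E; case: (sg a x); case: (sg a y) => // _; case: (sg c x); case: (sg c y) => // _ /=; lia.
Qed.

Let outT D : count (fun j => mult (nth b0 h j) (nth b0 o j) == 2) (outside D) =
  count (fun j => ~~ D j) (tset h o).
Proof.
rewrite /outside /tset -!size_filter -!filter_predI; congr size.
by apply: eq_filter => j /=; rewrite andbC.
Qed.

Let Xpow D : {in X &, forall x y, (forall j, (j < 12)%N -> ~~ D j -> nth b0 x j = nth b0 y j) -> x = y} ->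
  (size X <= 2 ^ count (fun j => ~~ D j) (tset h o))%N.
Proof.
case E : X => [|x0 X'] // H; rewrite -E in H *.
have x0X : x0 \in X by rewrite E mem_head.
have uX : uniq X by apply/filter_uniq/(config_uniq gL).
have := fiber_bound (o := o) hs hh uX _ H.
rewrite prod_pow2 ?outT; first by apply=> x xX; split; [apply: (config_F gL); apply: XL | exact: Xo].
by move=> j; rewrite mem_filter mem_iota => /andP [_ lj]; apply: (mult12 x0X).
Qed.

Let uT : uniq (tset h o). Proof. by apply/filter_uniq/iota_uniq. Qed.
Let ltT j : j \in tset h o -> (j < 12)%N. Proof. by rewrite mem_filter mem_iota => /andP []. Qed.

Let count1 a : a \in tset h o -> count (fun j => ~~ pred1 a j) (tset h o) = (size (tset h o)).-1.
Proof.
move=> aT; have := count_predC (pred1 a) (tset h o).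
by rewrite (count_uniq_mem _ uT) aT /= => <-.
Qed.

Let count2 a c : a \in tset h o -> c \in tset h o -> a != c ->
  count (fun j => ~~ pred2 a c j) (tset h o) = (size (tset h o) - 2)%N.
Proof.
move=> aT cT ac; have := count_predC (pred2 a c) (tset h o).
have -> : count (pred2 a c) (tset h o) = 2.
  have P0 : count (predI (pred1 a) (pred1 c)) (tset h o) = 0.
    apply/eqP; rewrite -leqn0 leqNgt -has_count; apply/hasPn => j _ /=.
    by case: eqP => //= ->.
  have := count_predUI (pred1 a) (pred1 c) (tset h o).
  by rewrite P0 addn0 !(count_uniq_mem _ uT) aT cT.
by move=> <-; rewrite addKn.
Qed.

Let T := tset h o.

Let mixed a c : a \in T -> c \in T -> u a <> 0%BZ -> u c = 0%BZ ->
  (size X <= 2 ^ (size T - 2))%N.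
Proof.
move=> aT cT ua uc; have ac : a != c by apply/eqP => E; apply: ua; rewrite E.
rewrite -(count2 aT cT ac); apply: Xpow => x y xX yX H.
have H' j : (j < 12)%N -> j != a -> j != c -> sg j x = sg j y.
  by move=> lj ja jc; rewrite /sg H //= negb_or ja jc.
have la := ltT aT; have lc := ltT cT.
case: (eqVneq (sg a x) (sg a y)) => [Ea|na].
  by apply: (eq1 xX yX lc) => j lj jc; case: (eqVneq j a) => [->|ja] //; apply: H'.
case: (eqVneq (sg c x) (sg c y)) => [Ec|nc].
  by apply: (eq1 xX yX la) => j lj ja; case: (eqVneq j c) => [->|jc] //; apply: H'.
have := pairrel xX yX la lc ac H' na nc; rewrite uc.
by case: ifP => _ ?; case: ua; lia.
Qed.

Let plain : (size X <= 2 ^ (size T).-1)%N.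
Proof.
case E : T => [|a T'].
  (* Without walls the orbit has at most one element; the exponent [0.-1] is 0, and block 0 is an
     arbitrary choice. *)
  have := @Xpow pred0; rewrite -/T E /=; apply => x y xX yX H.
  by apply: (eq1 (a := 0) xX yX) => // j lj _; rewrite /sg H.
have aT : a \in T by rewrite E mem_head.
rewrite -E -(count1 aT); apply: Xpow => x y xX yX H.
by apply: (eq1 xX yX (ltT aT)) => j lj ja; rewrite /sg H.
Qed.

Let three : size T = 3 -> (forall j, j \in T -> u j <> 0%BZ) -> (size X <= 3)%N.
Proof.
case E : T => [|a [|b [|c [|]]]] // _ H.
have := uT; rewrite -/T E /= !inE negb_or => /and3P [/andP [ab ac] bc _].
have aT : a \in T by rewrite E !inE eqxx.
have bT : b \in T by rewrite E !inE eqxx orbT.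
have cT : c \in T by rewrite E !inE eqxx !orbT.
have la := ltT aT; have lb := ltT bT; have lc := ltT cT.
rewrite leqNgt; apply/negP => s4.
pose f x := (sg b x, sg c x).
have out x y j : x \in X -> y \in X -> (j < 12)%N -> j != a -> j != b -> j != c -> sg j x = sg j y.
  move=> xX yX lj ja jb jc; have jT : j \notin T by rewrite E !inE !negb_or ja jb jc.
  by rewrite (sg_T xX lj jT) (sg_T yX lj jT).
have inj : {in X &, injective f}.
  move=> x y xX yX [Eb Ec]; apply: (eq1 xX yX la) => j lj ja.
  case: (eqVneq j b) => [-> //|jb]; case: (eqVneq j c) => [-> //|jc]; exact: out.
have uf : uniq [seq f x | x <- X] by rewrite map_inj_in_uniq //; apply/filter_uniq/(config_uniq gL).
pose BB := [:: (true, true); (true, false); (false, true); (false, false)].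
have sub : {subset [seq f x | x <- X] <= BB} by move=> [[] []] _.
have [_ EB] := uniq_min_size uf sub (leq_trans s4 (eq_leq (esym (size_map _ _)))).
have ex p : p \in BB -> exists2 x, x \in X & f x = p.
  by rewrite -EB => /mapP [x xX ->]; exists x.
have [x1 X1 [b1 c1]] := ex (true, true) isT.
have [x2 X2 [b2 c2]] := ex (true, false) isT.
have [x3 X3 [b3 c3]] := ex (false, true) isT.
have [x4 X4 [b4 c4]] := ex (false, false) isT.
have flip x y j k : x \in X -> y \in X -> (j < 12)%N -> sg j x != sg j y ->
    (forall i, (i < 12)%N -> i != a -> i != j -> sg i x = sg i y) -> k = sg j y -> sg a x != sg a y.
  move=> xX yX lj nj Hi _; apply: contra nj => /eqP Ea; apply/eqP; congr (sg j _).
  by apply: (eq1 xX yX lj) => i li ij; case: (eqVneq i a) => [-> //|ia]; apply: Hi.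
(* Four members realise all signs at [b] and [c]. Neighbours there must differ at [a], since members
   cannot differ in a single block; so [x1], [x2] and [x3], [x4] cross the walls [a], [c] in
   opposite relative directions. *)
have n12 : sg a x1 != sg a x2.
  apply: (flip _ _ c (sg c x2)); rewrite ?c1 ?c2 // => i li ia ic.
  by case: (eqVneq i b) => [->|ib]; [rewrite b1 b2 | exact: out].
have n34 : sg a x3 != sg a x4.
  apply: (flip _ _ c (sg c x4)); rewrite ?c3 ?c4 // => i li ia ic.
  by case: (eqVneq i b) => [->|ib]; [rewrite b3 b4 | exact: out].
have n13 : sg a x1 != sg a x3.
  apply: (flip _ _ b (sg b x3)); rewrite ?b1 ?b3 // => i li ia ib.
  by case: (eqVneq i c) => [->|ic]; [rewrite c1 c3 | exact: out].
have R12 : (if sg a x1 == sg c x1 then u a + u c = 0 else u a - u c = 0)%BZ.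
  apply: (pairrel X1 X2 la lc ac) => //; last by rewrite c1 c2.
  by move=> i li ia ic; case: (eqVneq i b) => [->|ib]; [rewrite b1 b2 | exact: out].
have R34 : (if sg a x3 == sg c x3 then u a + u c = 0 else u a - u c = 0)%BZ.
  apply: (pairrel X3 X4 la lc ac) => //; last by rewrite c3 c4.
  by move=> i li ia ic; case: (eqVneq i b) => [->|ib]; [rewrite b3 b4 | exact: out].
have ua := H a (mem_head _ _).
move: R12 R34 n13; rewrite c1 c3; case: (sg a x1); case: (sg a x3) => //= ? ? _; apply: ua; lia.
Qed.

Lemma gboundP : (size X <= gbound (nonzero_set h w) T)%N.
Proof.
have nS j : j \in T -> nth false (nonzero_set h w) j = ~~ Z.eqb (u j) 0.
  by move=> jT; rewrite nth_mkseq ?(ltT jT).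
rewrite /gbound; case: ifP => [/andP [s0 sk] | _].
  move: s0; rewrite -has_count => /hasP [a aT]; rewrite nS // => /negP ua.
  have : ~~ all (nth false (nonzero_set h w)) T by rewrite all_count neq_ltn sk.
  move=> /allPn [c cT]; rewrite nS // negbK => /Z.eqb_eq uc.
  by apply: (mixed aT cT) => // E; apply: ua; rewrite E.
case: ifP => [/andP [/eqP k3 /eqP s3] | _]; last exact: plain.
apply: (three k3) => j jT E.
have : all (nth false (nonzero_set h w)) T by rewrite all_count s3 k3.
by move=> /allP /(_ j jT); rewrite nS // E.
Qed.

(** Reflections in wall roots orthogonal to [w] do not change products with [w], so every member of
    the orbit has the product of its leader. *)
Lemma fiber_dead : (forall j, j \in T -> u j = 0%BZ) -> vdot o w <> 0%BZ -> X = [::].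
Proof.
move=> u0 ne; case E : X => [|x X'] //.
have xX : x \in X by rewrite E mem_head.
have os : size o = 12 by rewrite -(Xo xX) leader_size ?hs ?(Xs xX).
case: ne; rewrite -(wL (XL xX)) (vdotE os ws) (vdotE (Xs xX) ws).
apply: eq_big_nat => j /andP [_ lj]; rewrite (sg_val xX lj).
case: ifP => sx; first lia.
rewrite u0; first lia.
by apply/negPn/negP => jT; rewrite (sg_T xX lj jT) in sx.
Qed.
End Walls.

Arguments Z.eqb : simpl never.
Arguments Z.leb : simpl never.
Arguments Z.ltb : simpl never.
Arguments Z.max : simpl never.
Arguments Z.abs : simpl never.

(** * Frame expansions over the integers *)

Fixpoint dotz (u v : seq Z) : Z :=
  match u, v with x :: u', y :: v' => (x * y + dotz u' v')%BZ | _, _ => 0%BZ end.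
(** Lists stand for vectors padded with zeros, so that summands of different lengths, such as
    [funit i], can be combined. *)
Fixpoint axpy (a : Z) (u v : seq Z) : seq Z :=
  match u, v with
  | x :: u', y :: v' => (a * x + y)%BZ :: axpy a u' v'
  | [::], _ => v
  | _, [::] => [seq (a * x)%BZ | x <- u]
  end.
Definition lcomb (l : seq (Z * seq Z)) : seq Z := foldr (fun p acc => axpy p.1 p.2 acc) [::] l.
Definition wsum (T : Type) (F : T -> Z) (l : seq T) : Z := foldr (fun p acc => F p + acc)%BZ 0%BZ l.

Lemma dotz_axpy a u v y : dotz (axpy a u v) y = (a * dotz u y + dotz v y)%BZ.
Proof.
have E (u' y' : seq Z) : dotz [seq (a * x)%BZ | x <- u'] y' = (a * dotz u' y')%BZ.
  by elim: u' y' => [|x u' IH] [|z y'] /=; rewrite ?IH; lia.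
elim: u v y => [|x u IH] [|x' v] [|z y] //=; rewrite ?IH ?E; lia.
Qed.

Lemma dotz_lcomb l y : dotz (lcomb l) y = wsum (fun p => p.1 * dotz p.2 y)%BZ l.
Proof. by elim: l => //= p l <-; rewrite dotz_axpy. Qed.

Lemma wsum_map (T U : Type) (f : T -> U) F l : wsum F (map f l) = wsum (fun x => F (f x)) l.
Proof. by elim: l => //= x l ->. Qed.
Lemma wsum_cat (T : Type) (F : T -> Z) l1 l2 : wsum F (l1 ++ l2) = (wsum F l1 + wsum F l2)%BZ.
Proof. by elim: l1 => //= x l1 ->; lia. Qed.

Lemma dotz_zero u y : all (Z.eqb 0) u -> dotz u y = 0%BZ.
Proof. elim: u y => [|x u IH] [|z y] //= /andP [/Z.eqb_eq <- /IH ->]; lia. Qed.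

Definition funit (i : nat) : seq Z := rcons (nseq i 0%BZ) 1%BZ.
Lemma dotz_unit i y : dotz (funit i) y = nth 0%BZ y i.
Proof.
elim: i y => [|i IH] [|z y] //=; last by rewrite -/(funit i) IH.
by case: y => *; lia.
Qed.

Lemma argmax_seq (T : eqType) (F : T -> Z) (s : seq T) x : x \in s ->
  exists2 x0, x0 \in s & forall y, y \in s -> (F y <= F x0)%BZ.
Proof.
elim: s x => // x1 s IH x _; case: s IH => [_|x2 s IH].
  by exists x1; rewrite ?mem_head // => y; rewrite inE => /eqP ->; lia.
have [x3 x3s H] := IH x2 (mem_head _ _).
case: (Z_le_gt_dec (F x1) (F x3)) => C.
  by exists x3; [rewrite inE x3s orbT | move=> y; rewrite inE => /orP [/eqP -> // | /H]].
exists x1; first exact: mem_head.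
by move=> y; rewrite inE => /orP [/eqP -> | /H]; lia.
Qed.

Lemma dotz_nth u x y : (forall i, nth 0%BZ x i = nth 0%BZ y i) -> dotz u x = dotz u y.
Proof.
elim: u x y => [|a u IH] x y H; first by case: x {H} => [|? ?]; case: y.
have IH0 (z : seq Z) : (forall i, nth 0%BZ z i = 0%BZ) -> dotz u z = 0%BZ.
  by move=> Hz; rewrite (IH z [::]) => [|i]; [case: (u) | rewrite Hz ?nth_nil].
case: x y H => [|x0 x] [|y0 y] H //=.
- by have /= <- := H 0; rewrite IH0 => [|i]; [lia | exact/esym/(H i.+1)].
- by have /= -> := H 0; rewrite IH0 => [|i]; [lia | exact: (H i.+1)].
- by have /= -> := H 0; rewrite (IH x y) // => i; exact: (H i.+1).
Qed.

Lemma dotzC u v : dotz u v = dotz v u.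
Proof. by elim: u v => [|x u IH] [|y v] //=; rewrite IH Z.mul_comm. Qed.

Lemma nth_lcomb (l : seq (Z * seq Z)) i :
  nth 0%BZ (lcomb l) i = wsum (fun p => p.1 * nth 0 p.2 i)%BZ l.
Proof. by rewrite -dotz_unit dotzC dotz_lcomb; elim: l => //= p l ->; rewrite dotzC dotz_unit. Qed.

(* [Q / Den] inverts the frame operator of [D] and [E].  If [y] is orthogonal to
   [E] and to all of [D] outside weight [rho], expand the member of [D] with the
   largest product with [y]: the check makes that product smaller than itself. *)
Definition frame_check (D E : seq (Z * seq Z)) (Q : seq (seq Z)) (Den tau rho : Z) : bool :=
  let q u := [seq dotz r u | r <- Q] in
  let DQ := [seq (p, q p.2) | p <- D] in
  let EQ := [seq (p, q p.2) | p <- E] in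
  [&& all (fun i => all (Z.eqb 0) (axpy (- Den) (funit i)
        (lcomb [seq (t.1.1 * nth 0 t.2 i, t.1.2)%BZ | t <- DQ ++ EQ])))
        (iota 0 (size Q)),
      all (fun p => Z.ltb (rho * tau + wsum (fun t => t.1.1 * Z.max 0 (Z.abs (dotz p.2 t.2) - tau)) DQ) Den)%BZ D,
      all (fun p => Z.leb 0 p.1) D, Z.leb 0 tau & Z.ltb 0 Den].

(** Let [K] be the coefficient of [p] in the expansion of the extremal member. From
    [|K| <= tau + max(0, |K| - tau)], the weighted sum of [|K|] over any part of [D] of weight at
    most [rho] is at most [rho * tau] plus a sum that does not depend on the part. Thus [tau] is a
    Lagrange multiplier for the budget [rho], and no subsets have to be enumerated. *)
Lemma frameP D E Q Den tau rho y : frame_check D E Q Den tau rho -> size y = size Q ->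
  (forall p, p \in E -> dotz p.2 y = 0%BZ) ->
  (wsum (fun p => if Z.eqb (dotz p.2 y) 0 then 0 else p.1) D <= rho)%BZ ->
  forall i, nth 0%BZ y i = 0%BZ.
Proof.
rewrite /frame_check; set q := (fun u => [seq dotz r u | r <- Q]); set DQ := [seq (p, q p.2) | p <- D]; set EQ := [seq (p, q p.2) | p <- E].
move=> /and5P [/allP Rep /allP Bd /allP pos /Z.leb_le tau0 /Z.ltb_lt Den0] ys Ey dead.
have repi i : (Den * nth 0 y i = wsum (fun p => p.1 * nth 0 (q p.2) i * dotz p.2 y) D)%BZ.
  case: (ltnP i (size Q)) => li; last first.
    rewrite nth_default ?ys //; elim: (D) => [|p D' IH] /=; first lia.
    rewrite -IH nth_default ?size_map //; lia.
  have := Rep i; rewrite mem_iota => /(_ li) /dotz_zero - /(_ y).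
  rewrite dotz_axpy dotz_lcomb map_cat wsum_cat dotz_unit /DQ /EQ -!map_comp !wsum_map /=.
  have -> : wsum (fun p => (p.1 * nth 0 (q p.2) i * dotz p.2 y)%BZ) E = 0%BZ.
    elim: E Ey {Rep EQ} => //= p E' IH Ey; rewrite IH => [|p' pE]; last by apply: Ey; rewrite inE pE orbT.
    rewrite (Ey p (mem_head _ _)); lia.
  lia.
have rep u : (Den * dotz u y = wsum (fun p => p.1 * dotz u (q p.2) * dotz p.2 y) D)%BZ.
  pose l := [seq (p.1 * dotz p.2 y, q p.2)%BZ | p <- D].
  have -> : (Den * dotz u y)%BZ = dotz u (lcomb l).
    have -> : (Den * dotz u y)%BZ = dotz u (axpy Den y [::]) by rewrite [RHS]dotzC dotz_axpy /= dotzC; lia.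
    apply: dotz_nth => i; rewrite -dotz_unit dotzC dotz_axpy dotzC dotz_unit repi nth_lcomb /l wsum_map /=.
    by elim: (D) => //= p D' <-; lia.
  by rewrite dotzC dotz_lcomb /l wsum_map; elim: (D) => //= p D' ->; rewrite (dotzC u); lia.
have zero p : p \in D -> dotz p.2 y = 0%BZ.
  move=> pD.
  have [p0 p0D p0max] : exists2 p0, p0 \in D & forall p, p \in D -> (Z.abs (dotz p.2 y) <= Z.abs (dotz p0.2 y))%BZ.
    exact: (@argmax_seq _ (fun p => Z.abs (dotz p.2 y)) D p).
  suff : dotz p0.2 y = 0%BZ by have := p0max p pD; lia.
  have R := rep p0.2.
  have /Z.ltb_lt := Bd p0 p0D; rewrite /DQ wsum_map /= => B.
  set M := Z.abs (dotz p0.2 y) in p0max *.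
  have M0 : (0 <= M)%BZ by rewrite /M; lia.
  have key (D' : seq (Z * seq Z)) : {subset D' <= D} ->
    (Z.abs (wsum (fun p => p.1 * dotz p0.2 (q p.2) * dotz p.2 y) D') <=
     M * (tau * wsum (fun p => if Z.eqb (dotz p.2 y) 0 then 0 else p.1) D' +
          wsum (fun p => p.1 * Z.max 0 (Z.abs (dotz p0.2 (q p.2)) - tau)) D'))%BZ.
    elim: D' => [|p1 D' IH] sub; first by rewrite /=; nia.
    have p1D : p1 \in D by apply: sub; rewrite mem_head.
    have /Z.leb_le n0 := pos p1 p1D; have mx := p0max p1 p1D.
    have := IH (fun z zD => sub z (mem_behead (s := p1 :: D') zD)).
    rewrite /=; move: (wsum _ _) (wsum _ _) (wsum _ _) => s1 s2 s3 H.
    move: (dotz p0.2 (q p1.2)) => K.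
    suff : (Z.abs (p1.1 * K * dotz p1.2 y) <= M * (tau * (if Z.eqb (dotz p1.2 y) 0 then 0 else p1.1) +
       p1.1 * Z.max 0 (Z.abs K - tau)))%BZ by nia.
    case: Z.eqb_spec => [->|ne].
      have : (0 <= p1.1 * Z.max 0 (Z.abs K - tau))%BZ by apply: Z.mul_nonneg_nonneg; lia.
      by rewrite !Z.mul_0_r; nia.
    rewrite !Z.abs_mul (Z.abs_eq p1.1) //.
    have : (Z.abs K <= tau + Z.max 0 (Z.abs K - tau))%BZ by lia.
    move: (Z.max _ _) => m; move: (Z.abs K) (Z.abs_nonneg K) (Z.abs (dotz p1.2 y)) (Z.abs_nonneg (dotz p1.2 y)) mx => k k0 a a0 mx hk.
    have -> : (M * (tau * p1.1 + p1.1 * m) = p1.1 * ((tau + m) * M))%BZ by ring.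
    rewrite -Z.mul_assoc; apply: Z.mul_le_mono_nonneg_l => //; apply: Z.mul_le_mono_nonneg => //.
  have := key D (fun z zD => zD); rewrite -R Z.abs_mul -/M (Z.abs_eq Den); last lia.
  move: (wsum _ _) (wsum _ _) dead B => s2 s1 dead B H.
  have T : (tau * s1 <= tau * rho)%BZ by apply: Z.mul_le_mono_nonneg_l.
  (* The strict inequality of the check now reads [Den * M <= M * (Den - 1)], so the maximum [M] is
     0. *)
  have : (M * (tau * s1 + s2) <= M * (Den - 1))%BZ by apply: Z.mul_le_mono_nonneg_l; lia.
  move=> H'; have M00 : M = 0%BZ by nia.
  by apply/Z.abs_0_iff.
move=> i; have := repi i.
have -> : wsum (fun p => p.1 * nth 0 (q p.2) i * dotz p.2 y)%BZ D = 0%BZ; last by nia.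
elim: D zero {Rep Bd pos dead rep repi DQ} => //= p D' IH zero; rewrite IH => [|p' pD]; last by apply: zero; rewrite inE pD orbT.
rewrite (zero p (mem_head _ _)); lia.
Qed.

(* Coordinates for vectors orthogonal to all wall roots; [Yblk] is dual to [Vblk] up to
   a factor 2. *)
Definition Vblk (hb v : block) : seq Z :=
  let: (p, q, r) := hb in
  if Z.eqb p q then [:: v.2] else if Z.eqb q r then [:: v.1.1] else [:: v.1.1; v.1.2].
Definition Yblk (hb w : block) : seq Z :=
  let: (p, q, r) := hb in
  if Z.eqb p q then [:: 3 * w.2]%BZ else if Z.eqb q r then [:: 3 * w.1.1]%BZ
  else [:: 2 * (w.1.1 - w.2); 2 * (w.1.2 - w.2)]%BZ.
Fixpoint bmap (f : block -> block -> seq Z) (h x : seq block) : seq Z :=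
  match h, x with hb :: h', v :: x' => f hb v ++ bmap f h' x' | _, _ => [::] end.

Lemma size_bmap h x w : size x = size h -> size w = size h ->
  size (bmap Vblk h x) = size (bmap Yblk h w).
Proof.
elim: h x w => [|[[p q] r] h IH] [|v x] [|u w] //= [xs] [ws].
by rewrite !size_cat (IH _ w xs ws); case: Z.eqb; case: Z.eqb.
Qed.

Lemma bmap_dot h x w : size x = size h -> size w = size h ->
  (forall j, bsum (nth b0 x j) = 0%BZ) -> (forall j, bsum (nth b0 w j) = 0%BZ) ->
  (forall j, (j < size h)%N -> udiff (nth b0 h j) (nth b0 w j) = 0%BZ) ->
  dotz (bmap Vblk h x) (bmap Yblk h w) = (2 * vdot x w)%BZ.
Proof.
elim: h x w => [|hb h IH] [|v x] [|u w] //= [xs] [ws] x0 w0 u0.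
have {}IH := IH x w xs ws (fun j => x0 j.+1) (fun j => w0 j.+1) (fun j lj => u0 j.+1 lj).
have := u0 0 isT; have := x0 0; have := w0 0; rewrite /= => {u0 x0 w0}.
case: hb => [[p q] r]; rewrite /udiff /bsum /= => bw bv.
case: (Z.eqb p q) => [|]; last case: (Z.eqb q r); move=> E; rewrite /= IH /bdot; nia.
Qed.

Lemma bmap_eq0 h w : size w = size h -> (forall j, bsum (nth b0 w j) = 0%BZ) ->
  (forall j, (j < size h)%N -> udiff (nth b0 h j) (nth b0 w j) = 0%BZ) ->
  (forall i, (i < size (bmap Yblk h w))%N -> nth 0%BZ (bmap Yblk h w) i = 0%BZ) ->
  w = nseq (size h) b0.
Proof.
elim: h w => [|hb h IH] [|u w] //= [ws] w0 u0 y0.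
have E : u = b0 /\ forall i, (i < size (bmap Yblk h w))%N -> nth 0%BZ (bmap Yblk h w) i = 0%BZ.
  move: y0 (u0 0 isT) (w0 0); rewrite /= => {u0 w0}.
  case: hb => [[p q] r]; case: u => [[a b] c]; rewrite /udiff /bsum /=.
  case: (Z.eqb p q) => [|]; last case: (Z.eqb q r); rewrite /= => y0 H1 H2.
  - have /= H3 := y0 0 isT; split; last by move=> i /(y0 i.+1).
    by rewrite /b0; congr (_, _, _); lia.
  - have /= H3 := y0 0 isT; split; last by move=> i /(y0 i.+1).
    by rewrite /b0; congr (_, _, _); lia.
  - have /= H3 := y0 0 isT; have /= H4 := y0 1 isT; split; last by move=> i /(y0 i.+2).
    by rewrite /b0; congr (_, _, _); lia.
case: E => -> /(IH w ws (fun j => w0 j.+1) (fun j lj => u0 j.+1 lj)) -> //.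
Qed.

(** The coordinates of [3 x - h]. For x in F(h) this is orthogonal to h, because 3 times 36 is 108;
    so it is 3 times the projection of x along h. *)
Definition centered (h x : seq block) : seq Z :=
  axpy (-1) (bmap Vblk h h) [seq (3 * z)%BZ | z <- bmap Vblk h x].

(** If L has at least 351 elements, the orbits missing L have total cap at most [rho], the excess of
    the sum of all caps over 351. The vector h and the functional [Zv] supply the directions that
    are known to vanish on w; [sel] chooses the orbits that enter the frame. *)
Definition wallrank (h : seq block) (Q : seq (seq Z)) (sel : seq block -> bool)
    (t t2 : Z) (Zv : seq Z) (rho : nat) (Den tau : Z) : bool :=
  let O := [seq (cap h o, o) | o <- leaders h] in
  (sumn [seq p.1 | p <- O] <= rho + 351)%N &&
  frame_check [seq (Z.of_nat p.1, centered h p.2) | p <- O & sel p.2]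
    [:: (t, bmap Vblk h h); (t2, Zv)] Q Den tau (Z.of_nat rho) &&
  (size Q == size (bmap Vblk h h)).

Definition iswall (hb : block) : bool := let: (p, q, r) := hb in Z.eqb p q || Z.eqb q r.
Fixpoint supports (h : seq block) : seq (seq bool) :=
  if h is hb :: h' then
    [seq c :: s | c <- (if iswall hb then [:: true; false] else [:: false]), s <- supports h']
  else [:: [::]].
Lemma supportsP h w : size w = size h ->
  [seq ~~ Z.eqb (udiff p.1 p.2) 0 | p <- zip h w] \in supports h.
Proof.
elim: h w => [|hb h IH] [|u w] //= [ws].
apply: (@allpairs_f _ _ _ cons (if iswall hb then [:: true; false] else [:: false]));
  last exact: IH.
case: hb => [[p q] r]; rewrite /iswall /udiff.
by case: (Z.eqb p q) => [|]; last case: (Z.eqb q r); rewrite //= !inE; case: (~~ _).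
Qed.

Lemma nonzero_supports h w : size h = 12 -> size w = 12 -> nonzero_set h w \in supports h.
Proof.
move=> hs ws.
have <- : [seq ~~ Z.eqb (udiff p.1 p.2) 0 | p <- zip h w] = nonzero_set h w.
  apply: (@eq_from_nth _ false); rewrite size_map size_zip hs ws ?size_mkseq // => j lj.
  by rewrite (nth_map (b0, b0)) ?size_zip ?hs ?ws // nth_zip ?hs ?ws // nth_mkseq.
by apply: supportsP; rewrite hs.
Qed.

Definition wall_check (h : seq block) (lo hi : nat) : bool :=
  let Ts := [seq tset h o | o <- leaders h] in
  all (fun S => (lo <= count id S <= hi)%N ==> (sumn [seq gbound S T | T <- Ts] <= 350)%N)
      (supports h).

Lemma htypes_bsum b : b \in htypes -> bsum b = 0%BZ.
Proof.
have : all (fun b => Z.eqb (bsum b) 0) htypes by vm_compute.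
by move=> /allP H /H /Z.eqb_eq.
Qed.

Section Perp.
Variables (h : seq block) (L : seq (seq block)) (w : seq block).
Hypotheses (hs : size h = 12) (hh : all (mem htypes) h) (gL : config h L).
Hypothesis hz : all (fun b => b != b0) h.
Hypotheses (ws : size w = 12) (w0 : forall j, bsum (nth b0 w j) = 0%BZ).
Hypothesis (wL : forall x, x \in L -> vdot x w = 0%BZ).

Lemma size_by_fibers (F : seq block -> nat) :
  (forall o, o \in leaders h -> (size [seq x <- L | leader h x == o] <= F o)%N) ->
  (size L <= sumn [seq F o | o <- leaders h])%N.
Proof.
move=> H; apply: (leq_trans (@size_fibers _ _ L (leaders h) (leader h) _)).
  by move=> x xL; apply: leader_in_leaders => //; apply: (config_F gL).
elim: (leaders h) H => //= o O IH H.
rewrite leq_add ?H ?mem_head // IH // => p pO; apply: H; by rewrite inE pO orbT.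
Qed.

Lemma wall_bound lo hi : wall_check h lo hi ->
  (lo <= count id (nonzero_set h w) <= hi)%N -> (size L <= 350)%N.
Proof.
move=> /allP C c; apply: leq_trans (size_by_fibers (F := fun o => gbound (nonzero_set h w) (tset h o)) _) _.
  by move=> o _; apply: gboundP => // j lj; rewrite (all_nth b0 hz) ?hs.
have := nonzero_supports hs ws.
move/C; rewrite c /=.
by rewrite -map_comp.
Qed.

(** An orbit whose centered leader is not orthogonal to [w] misses L by [fiber_dead], as no wall
    sees [w]. If L were large, these orbits would fit into the budget [rho] and [frameP] would give
    [w = 0]. *)
Lemma frame_bound Q sel t t2 Zv rho Den tau : wallrank h Q sel t t2 Zv rho Den tau ->
  (forall j, (j < 12)%N -> udiff (nth b0 h j) (nth b0 w j) = 0%BZ) ->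
  vdot h w = 0%BZ -> dotz Zv (bmap Yblk h w) = 0%BZ -> w <> nseq 12 b0 -> (size L <= 350)%N.
Proof.
rewrite /wallrank => /andP [/andP [tot fr] /eqP sQ] u0 hw Zw wn; rewrite leqNgt; apply/negP => big.
have u0' j : (j < size h)%N -> udiff (nth b0 h j) (nth b0 w j) = 0%BZ by rewrite hs; apply: u0.
have bh j : bsum (nth b0 h j) = 0%BZ.
  case: (ltnP j 12) => lj; last by rewrite nth_default ?hs.
  by apply: htypes_bsum; apply: (all_nth _ hh); rewrite hs.
have wsh : size w = size h by rewrite ws.
have hdot := bmap_dot (x := h) erefl wsh bh w0 u0'.
have dead o : dotz (centered h o) (bmap Yblk h w) <> 0%BZ -> [seq x <- L | leader h x == o] = [::].
  move=> ne; case E : [seq x <- L | leader h x == o] => [|x X] //; case: ne.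
  have : x \in [seq x <- L | leader h x == o] by rewrite E mem_head.
  rewrite mem_filter => /andP [/eqP Eo xL].
  have [No _] := leader_inF hh hs (config_F gL xL); rewrite Eo in No.
  have os := inNz_size No; have osh : size o = size h by rewrite os.
  have bo j : bsum (nth b0 o j) = 0%BZ.
    case: (ltnP j 12) => lj; last by rewrite nth_default ?os.
    by have [_ [/(_ j lj) []]] := No.
  have od : vdot o w = 0%BZ.
    case: (Z.eq_dec (vdot o w) 0) => // ne.
    have hzo j : (j < 12)%N -> (nth b0 h j != b0) || (mult (nth b0 h j) (nth b0 o j) == 1).
      by move=> lj; rewrite (all_nth b0 hz) ?hs.
    have ut j : j \in tset h o -> udiff (nth b0 h j) (nth b0 w j) = 0%BZ.
      by rewrite mem_filter mem_iota => /andP [_ /andP [_ lj]]; apply: u0.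
    by have := fiber_dead hs hh gL ws wL hzo ut ne; rewrite E.
  have E3 u y : dotz [seq (3 * z)%BZ | z <- u] y = (3 * dotz u y)%BZ.
    by elim: u y => [|x1 u IH] [|z y] //=; rewrite IH; lia.
  rewrite /centered dotz_axpy E3 (bmap_dot osh wsh bo w0 u0') hdot od hw; lia.
apply: wn; rewrite -hs; apply: (bmap_eq0 wsh w0 u0').
move=> i _; apply: (frameP fr).
- by rewrite sQ -(size_bmap (x := h) erefl wsh).
- by move=> p; rewrite !inE => /orP [] /eqP -> /=; rewrite ?hdot ?hw.
have le := size_by_fibers (F := fun o => if Z.eqb (dotz (centered h o) (bmap Yblk h w)) 0 then cap h o else 0) _.
have {le big} : (350 < sumn [seq (if Z.eqb (dotz (centered h o) (bmap Yblk h w)) 0 then cap h o else 0) | o <- leaders h])%N.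
  apply: leq_trans big _; apply: le => o oO; case: Z.eqb_spec => [_|/dead -> //].
  exact: fiber_cap.
(* The frame counts only selected orbits, while the surviving caps are summed over all orbits; hence
   an inequality. *)
have wsum_dead (D : pred (seq block)) (s : seq (seq block)) :
  (wsum (fun o => if D o then 0 else Z.of_nat (cap h o)) [seq o <- s | sel o] +
   Z.of_nat (sumn [seq (if D o then cap h o else 0%N) | o <- s]) <= Z.of_nat (sumn [seq cap h o | o <- s]))%BZ.
  by elim: s => //= o s IH; case: (sel o); rewrite /=; case: (D o); lia.
move: tot; rewrite filter_map -!map_comp wsum_map.
move=> T1 T2; have := wsum_dead (fun o => Z.eqb (dotz (centered h o) (bmap Yblk h w)) 0) (leaders h).
have {}T1 : (sumn [seq cap h o | o <- leaders h] <= rho + 351)%N := T1.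
set W := wsum _ _ => T3; change (W <= Z.of_nat rho)%BZ.
by move: T1 T2 T3; lia.
Qed.
End Perp.

(** * Vectors that see exactly one or two walls *)

Definition rvec (h : seq block) (c : nat) : seq block :=
  mkseq (fun j => if j == c then
    let: (p, q, r) := nth b0 h c in
    if Z.eqb p q then (1, -1, 0)%BZ else if Z.eqb q r then (0, 1, -1)%BZ else b0
    else b0) 12.

Lemma vdot_rvec h c w : size w = 12 -> (c < 12)%N ->
  vdot (rvec h c) w = udiff (nth b0 h c) (nth b0 w c).
Proof.
move=> ws lc; rewrite (vdotE (size_mkseq _ _) ws).
rewrite (bigD1_seq c) ?mem_index_iota ?iota_uniq //= big1_seq ?addr0 => [|j].
  rewrite nth_mkseq // eqxx; case: (nth b0 h c) (nth b0 w c) => [[p q] r] [[a b] d].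
  rewrite /udiff /bdot; case: Z.eqb => /=; last case: Z.eqb => /=; lia.
rewrite mem_index_iota => /andP [/negbTE jc lj]; rewrite nth_mkseq // jc /bdot /=; lia.
Qed.

Definition vadd (x y : seq block) : seq block :=
  mkseq (fun j => let u := nth b0 x j in let v := nth b0 y j in
    (u.1.1 + v.1.1, u.1.2 + v.1.2, u.2 + v.2)%BZ) 12.

Lemma vdot_vadd x y z : size x = 12 -> size y = 12 -> size z = 12 ->
  vdot x (vadd y z) = (vdot x y + vdot x z)%BZ.
Proof.
move=> xs ys zs; rewrite (vdotE xs (size_mkseq _ _)) (vdotE xs ys) (vdotE xs zs).
have -> (a b : Z) : (a + b)%BZ = (a + b)%R by [].
rewrite -big_split /=; apply: eq_big_nat => j /andP [_ lj].
by rewrite nth_mkseq // /bdot /=; lia.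
Qed.

Section Special.
Variables (h : seq block) (D : seq nat) (a0 : nat) (f2 : seq block) (Zv : seq Z).
Variables (Q : seq (seq Z)) (sel : seq block -> bool) (t t2 Den tau : Z) (rho : nat).
Hypotheses (hs : size h = 12) (hh : all (mem htypes) h) (hz : all (fun b => b != b0) h).
Hypotheses (D12 : all (fun j => j < 12)%N D) (Da0 : a0 \in D).
Hypothesis (D3 : (2 < size D)%N).
Hypotheses (W : wall_check h 2 (size D).-1) (FR : wallrank h Q sel t t2 Zv rho Den tau).
Hypothesis fs : size f2 = 12.
Hypothesis f2D : forall w, size w = 12 -> vdot f2 w = 0%BZ ->
  forall j, (j < 12)%N -> udiff (nth b0 h j) (nth b0 w j) <> 0%BZ -> j \in D.
Hypothesis f2Z : forall w, size w = 12 -> (forall j, bsum (nth b0 w j) = 0%BZ) -> vdot f2 w = 0%BZ ->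
  dotz Zv (bmap Yblk h w) = 0%BZ.

Let supp w := [seq j <- iota 0 12 | ~~ Z.eqb (udiff (nth b0 h j) (nth b0 w j)) 0].
Let count_supp w : count id (nonzero_set h w) = size (supp w).
Proof. by rewrite count_map -size_filter. Qed.
Let suppP w j : (j < 12)%N -> udiff (nth b0 h j) (nth b0 w j) <> 0%BZ <-> j \in supp w.
Proof.
move=> lj; rewrite mem_filter mem_iota lj andbT.
by case: Z.eqb_spec => H; split.
Qed.

(** The condition [rvec h c] removes [c] from the support, so the support has fewer than [size D]
    walls. The empty support is excluded by the frame, and two or more walls by [wall_check]. *)
Lemma single_wall L c : config h L -> (350 < size L)%N -> c \in D ->
  exists2 w, [/\ size w = 12, forall j, bsum (nth b0 w j) = 0%BZ & forall x, x \in L -> vdot x w = 0%BZ]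
    & exists2 d, d \in D /\ d != c & supp w = [:: d].
Proof.
move=> gL big cD; have lc := allP D12 c cD.
have [w [ws w0 wn hw [wL [wc wf]]]] := config_perp gL (size_mkseq _ _ : size (rvec h c) = 12) fs.
rewrite vdot_rvec // in wc.
have sD d : d \in supp w -> d \in D /\ d != c.
  move=> dS; have := dS; rewrite mem_filter mem_iota => /andP [nz /andP [_ ld]].
  split; first by apply: (f2D ws wf ld); apply/suppP.
  by apply: contraNneq nz => ->; rewrite wc.
exists w => //; case E : (supp w) => [|d [|d' s]].
- have u0 j : (j < 12)%N -> udiff (nth b0 h j) (nth b0 w j) = 0%BZ.
    by move=> lj; case: (Z.eq_dec (udiff (nth b0 h j) (nth b0 w j)) 0) => // /(suppP w lj); rewrite E.
  have := frame_bound hs hh gL hz ws w0 wL FR u0 hw (f2Z ws w0 wf) wn.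
  by rewrite leqNgt big.
- by exists d => //; apply: sD; rewrite E mem_head.
- have : (size L <= 350)%N; last by rewrite leqNgt big.
  apply: (wall_bound hs hh gL hz ws wL W); rewrite count_supp {1}E /=.
  have sub : {subset supp w <= rem c D}.
    move=> j jS; have [jD jc] := sD j jS.
    by have := perm_mem (perm_to_rem cD) j; rewrite jD inE (negbTE jc) /= => <-.
  rewrite -(size_rem cD); apply: uniq_leq_size sub.
  by apply/filter_uniq/iota_uniq.
Qed.

(** The second vector is chosen to miss the one wall [d] of the first, so their single walls differ
    and the sum has support [{d, d'}], a size that [wall_check] covers. *)
Lemma special_bounded : bounded h.
Proof.
move=> L gL; rewrite leqNgt; apply/negP => big.
have [w [ws w0 wL] [d [dD _] Sd]] := single_wall gL big Da0.
have [w' [ws' w0' wL'] [d' [d'D dd] Sd']] := single_wall gL big dD.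
have [ld ld'] : (d < 12)%N /\ (d' < 12)%N by split; apply: (allP D12).
have add j : (j < 12)%N -> udiff (nth b0 h j) (nth b0 (vadd w w') j) =
    (udiff (nth b0 h j) (nth b0 w j) + udiff (nth b0 h j) (nth b0 w' j))%BZ.
  move=> lj; rewrite nth_mkseq // /udiff; case: (nth b0 h j) => [[p q] r].
  by case: Z.eqb; last case: Z.eqb; rewrite /=; lia.
have S2 : supp (vadd w w') =i [:: d; d'].
  move=> j; case: (ltnP j 12) => lj; last first.
    rewrite mem_filter mem_iota [(_ <= j < _)%N]andbC ltnNge lj andbF !inE.
    by apply/esym/negbTE; rewrite negb_or !neq_ltn !(leq_trans _ lj) ?orbT.
  have A1 := suppP w lj; have A2 := suppP w' lj; have A3 := suppP (vadd w w') lj.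
  rewrite Sd inE in A1; rewrite Sd' inE in A2; rewrite add // in A3.
  apply/idP/idP => [/A3 H | ]; rewrite !inE.
    apply/orP; case: (Z.eq_dec (udiff (nth b0 h j) (nth b0 w j)) 0) => E; last by left; apply/A1.
    by right; apply/A2; lia.
  move=> H; apply/A3; case/orP: H => /eqP E; rewrite E in A1 A2 |- *.
    have := A1.2 (eqxx _); suff : udiff (nth b0 h d) (nth b0 w' d) = 0%BZ by lia.
    by case: (Z.eq_dec (udiff (nth b0 h d) (nth b0 w' d)) 0) => // /A2; rewrite eq_sym (negbTE dd).
  have := A2.2 (eqxx _); suff : udiff (nth b0 h d') (nth b0 w d') = 0%BZ by lia.
  by case: (Z.eq_dec (udiff (nth b0 h d') (nth b0 w d')) 0) => // /A1; rewrite (negbTE dd).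
have : (size L <= 350)%N; last by rewrite leqNgt big.
have sz : size (vadd w w') = 12 by rewrite size_mkseq.
apply: (wall_bound hs hh gL hz sz _ W) => [x xL|].
  have xs : size x = 12 by case: (config_F gL xL) => -[].
  by rewrite vdot_vadd // wL // wL'.
have u1 : uniq (supp (vadd w w')) by apply/filter_uniq/iota_uniq.
have u2 : uniq [:: d; d'] by rewrite /= inE eq_sym dd.
rewrite count_supp (uniq_size_uniq u2 (fun j => esym (S2 j))) in u1 *.
by rewrite (eqP u1) /=; lia.
Qed.
End Special.

(** * The vector with total cap 351 *)

(** Used with orbit sizes below caps: if the caps have sum 351 and L has at least 351 elements,
    every orbit attains its cap. *)
Lemma sum_tight (T : eqType) (F G : T -> nat) (s : seq T) :
  {in s, forall x, F x <= G x}%N -> (sumn [seq G x | x <- s] <= sumn [seq F x | x <- s])%N ->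
  {in s, forall x, G x <= F x}%N.
Proof.
elim: s => //= y s IH le tot x; have ley := le y (mem_head _ _).
have les : {in s, forall x, F x <= G x}%N by move=> z zs; apply: le; rewrite inE zs orbT.
have tots : (sumn [seq F x | x <- s] <= sumn [seq G x | x <- s])%N.
  by elim: (s) les => //= z s' IH' les; rewrite leq_add ?les ?mem_head ?IH' // => z' zs; apply: les; rewrite inE zs orbT.
by rewrite inE => /orP [/eqP -> | /(IH les _) -> //]; lia.
Qed.

Definition plain_zero (h o : seq block) : bool :=
  all (fun j => (nth b0 h j != b0) || (mult (nth b0 h j) (nth b0 o j) == 1)) (iota 0 12).

Definition total_check (h : seq block) : bool :=
  (sumn [seq cap h o | o <- leaders h] <= 351)%N && all (fun o => 0 < cap h o)%N (leaders h).

(* Applied when every fiber reaches its bound: the graph of the two-wall orbits is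
   connected, so a single wall root orthogonal to w makes all of them so. *)
Definition connected_check (h : seq block) : bool :=
  let O := [seq (cap h o, tset h o) | o <- leaders h & plain_zero h o] in
  all (fun S => ~~ nth false S 11 ==> all (fun p => p.1 <= gbound S p.2)%N O ==>
    all (fun j => ~~ nth false S j) (iota 2 10)) (supports h).

(** With budget 0 the frame check merely certifies that these leaders determine the coordinates of
    the last ten blocks. The first two blocks are zero in all of them. *)
Definition span_check (h : seq block) (Q : seq (seq Z)) (Den tau : Z) : bool :=
  let O := [seq o <- leaders h | plain_zero h o] in
  all (fun o => (nth b0 o 0 == b0) && (nth b0 o 1 == b0)) O &&
  frame_check [seq (1%BZ, bmap Vblk (drop 2 h) (drop 2 o)) | o <- O] [::] Q Den tau 0.

Definition zorbit (h : seq block) (k : nat) (o : seq block) : bool :=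
  [&& mult (nth b0 h k) (nth b0 o k) == 3, nth b0 o (1 - k) == b0
    & (dropmul (pred2 k (head 0 (tset h o))) (mults h o) < cap h o)%N].
(** If all members had the same block [k], they would be determined outside [k] and the wall [a],
    since differing in [a] alone is impossible. That allows fewer members than the cap. *)
Lemma two_values h L k o : size h = 12 -> all (mem htypes) h -> config h L -> o \in leaders h ->
  (cap h o <= size [seq x <- L | leader h x == o])%N -> zorbit h k o ->
  exists x y, [/\ x \in L, y \in L, leader h x = o, leader h y = o & nth b0 x k != nth b0 y k].
Proof.
move=> hs hh gL oO full /and3P [_ _]; set a := head 0 _ => lt.
set X := [seq x <- L | leader h x == o] in full.
case: (boolP (all (fun x => all (fun y => nth b0 x k == nth b0 y k) X) X)) => [/allP same|].
  have : (size X <= dropmul (pred2 k a) (mults h o))%N; last by lia.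
  rewrite -dropmulE ?(leaders_size hs oO) //; apply: fiber_bound => //.
  - by apply/filter_uniq/(config_uniq gL).
  - by move=> x; rewrite mem_filter => /andP [/eqP E xL]; split => //; apply: (config_F gL).
  - move=> x y xX yX H; have := xX; have := yX; rewrite !mem_filter => /andP [/eqP Ey yL] /andP [/eqP Ex xL].
    have := allP (same x xX) y yX => /eqP Exy.
    case: (ltnP a 12) => la.
      apply: (fiber_two_blocks hs hh gL la xL yL) => [|j lj ja]; first by rewrite Ex Ey.
      by case: (eqVneq j k) => [-> //|jk]; apply: H; rewrite //= negb_or jk ja.
    (* When [a] is out of range, only block [k] was dropped and the members agree everywhere; any
       block serves here. *)
    apply: (fiber_two_blocks hs hh gL (b := 0) isT xL yL) => [|j lj _]; first by rewrite Ex Ey.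
    case: (eqVneq j k) => [-> //|jk]; apply: H; rewrite //= negb_or jk.
    by rewrite neq_ltn (leq_trans lj la).
case/allPn => x xX /allPn [y yX ne]; exists x, y.
by move: xX yX; rewrite !mem_filter => /andP [/eqP -> ->] /andP [/eqP -> ->].
Qed.

(** Two distinct members of a three-element class are linearly independent, so the plane of sum zero
    contains no nonzero vector orthogonal to both. The identities below are Cramer's rule. *)
Lemma zero_det u v z : u \in short_blocks -> v \in short_blocks -> mult b0 (bleader b0 u) = 3 ->
  bleader b0 u = bleader b0 v -> u != v -> bsum z = 0%BZ -> bdot u z = 0%BZ -> bdot v z = 0%BZ -> z = b0.
Proof.
pose det (u v : block) := ((u.1.1 - u.2) * (v.1.2 - v.2) - (u.1.2 - u.2) * (v.1.1 - v.2))%BZ.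
have : all (fun u => all (fun v => (mult b0 (bleader b0 u) == 3) && (bleader b0 u == bleader b0 v) && (u != v)
  ==> ~~ Z.eqb (det u v) 0) short_blocks) short_blocks by vm_compute.
move=> /allP H /H /allP H' /H' /implyP {H H'} H m3 E ne z0 uz vz.
have /negP {}H : ~~ Z.eqb (det u v) 0 by apply: H; rewrite m3 E ne !eqxx.
have dn : det u v <> 0%BZ by move=> D; apply: H; rewrite D.
move: z0 uz vz dn; rewrite /det /bsum /bdot; case: u v z {m3 E ne H} => [[u1 u2] u3] [[v1 v2] v3] [[z1 z2] z3] /= z0 uz vz dn.
have E3 : z3 = (- z1 - z2)%BZ by lia.
rewrite {}E3 {z0} in uz vz *; set d := (_ - _)%BZ in dn.
have E1 : (d * z1 = 0)%BZ.
  transitivity ((v2 - v3) * (u1 * z1 + u2 * z2 + u3 * (- z1 - z2)) -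
    (u2 - u3) * (v1 * z1 + v2 * z2 + v3 * (- z1 - z2)))%BZ; first by rewrite /d; ring.
  by rewrite uz vz; lia.
have E2 : (d * z2 = 0)%BZ.
  transitivity ((u1 - u3) * (v1 * z1 + v2 * z2 + v3 * (- z1 - z2)) -
    (v1 - v3) * (u1 * z1 + u2 * z2 + u3 * (- z1 - z2)))%BZ; first by rewrite /d; ring.
  by rewrite uz vz; lia.
by rewrite /b0; congr (_, _, _); nia.
Qed.

Lemma bleader_b0 v : v \in short_blocks -> bleader b0 v = b0 -> v = b0.
Proof.
have : all (fun v => (bleader b0 v == b0) ==> (v == b0)) short_blocks by vm_compute.
by move=> /allP H /H /implyP I E; apply/eqP/I/eqP.
Qed.

Section Rigid.
Variables (h : seq block) (Q : seq (seq Z)) (Den tau : Z).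
Hypotheses (hs : size h = 12) (hh : all (mem htypes) h).
Hypotheses (h0 : nth b0 h 0 = b0) (h1 : nth b0 h 1 = b0) (sQ : size Q = size (bmap Vblk (drop 2 h) (drop 2 h))).
Hypotheses (T : total_check h) (C : connected_check h) (S : span_check h Q Den tau).
Hypotheses (Z0 : has (zorbit h 0) (leaders h)) (Z1 : has (zorbit h 1) (leaders h)).

Lemma rigid_bounded : bounded h.
Proof.
move=> L gL; rewrite leqNgt; apply/negP => big.
have /andP [tot /allP cap0] := T.
have full : {in leaders h, forall o, cap h o <= size [seq x <- L | leader h x == o]}%N.
  apply: sum_tight; first by move=> o oO; apply: fiber_cap.
  apply: (leq_trans tot); apply: (leq_trans big).
  by apply: size_fibers => x xL; apply: leader_in_leaders => //; apply: (config_F gL).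
have [w [ws w0 wn _ [wL [w11 _]]]] :=
  config_perp gL (size_mkseq _ _ : size (rvec h 11) = 12) (size_mkseq _ _ : size (rvec h 11) = 12).
rewrite vdot_rvec // in w11.
have pz o j : plain_zero h o -> (j < 12)%N ->
    (nth b0 h j != b0) || (mult (nth b0 h j) (nth b0 o j) == 1).
  by move=> /allP H lj; apply: H; rewrite mem_iota.
(* All orbits being full, the wall bounds cannot be smaller than the caps; with wall 11 unseen this
   leaves no visible wall in the last ten blocks. *)
have u0 j : (1 < j)%N -> (j < 12)%N -> udiff (nth b0 h j) (nth b0 w j) = 0%BZ.
  move=> j1 lj; have := allP C (nonzero_set h w) (nonzero_supports hs ws).
  rewrite [nth false _ 11]nth_mkseq // w11 => /implyP /(_ isT) /implyP {}C'.
  have /allP : all (fun j => ~~ nth false (nonzero_set h w) j) (iota 2 10).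
    apply: C'; apply/allP => p /mapP [o]; rewrite mem_filter => /andP [po oO] -> /=.
    apply: (leq_trans (full o oO)); apply: gboundP => // k; exact: pz.
  move=> /(_ j); rewrite mem_iota j1 lj nth_mkseq // => /(_ isT); rewrite negbK.
  by move/Z.eqb_eq.
have bh j : bsum (nth b0 h j) = 0%BZ.
  case: (ltnP j 12) => lj; last by rewrite nth_default ?hs.
  by apply: htypes_bsum; apply: (all_nth _ hh); rewrite hs.
have /andP [/allP zO fr] := S.
have dsz (x : seq block) : size x = 12 -> size (drop 2 x) = size (drop 2 h) by rewrite !size_drop hs => ->.
have w0' j : bsum (nth b0 (drop 2 w) j) = 0%BZ by rewrite nth_drop.
have u0' j : (j < size (drop 2 h))%N -> udiff (nth b0 (drop 2 h) j) (nth b0 (drop 2 w) j) = 0%BZ.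
  by rewrite size_drop hs => lj; rewrite !nth_drop; apply: u0; rewrite ?ltnS //; lia.
(* Every orbit meets L and no wall of the last ten blocks sees [w], so the leaders with plain zero
   blocks are orthogonal to [w]. *)
have y0 i : nth 0%BZ (bmap Yblk (drop 2 h) (drop 2 w)) i = 0%BZ.
  apply: (frameP fr) => //; first by rewrite sQ; apply/esym/size_bmap; rewrite // dsz.
  rewrite wsum_map /=.
  suff H : {in [seq o <- leaders h | plain_zero h o], forall o, dotz (bmap Vblk (drop 2 h) (drop 2 o)) (bmap Yblk (drop 2 h) (drop 2 w)) = 0%BZ}.
    elim: [seq o <- _ | _] H => //= o O IH H; rewrite H ?mem_head //=.
    by rewrite Z.add_0_l; apply: IH => o' oO; apply: H; rewrite inE oO orbT.
  move=> o oO; have /andP [/eqP o0 /eqP o1] := zO o oO.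
  move: oO; rewrite mem_filter => /andP [po oO].
  have [x xX] : exists x, x \in [seq x <- L | leader h x == o].
    have := leq_trans (cap0 o oO) (full o oO).
    by case: [seq x <- L | _] => // x X _; exists x; rewrite mem_head.
  have := xX; rewrite mem_filter => /andP [/eqP Eo xL].
  have [No _] := leader_inF hh hs (config_F gL xL); rewrite Eo in No.
  have os := inNz_size No.
  have bo j : bsum (nth b0 (drop 2 o) j) = 0%BZ.
    rewrite nth_drop; case: (ltnP (2 + j) 12) => lj; last by rewrite nth_default ?os.
    by have [_ [/(_ _ lj) []]] := No.
  rewrite bmap_dot ?dsz //.
  have od : vdot o w = 0%BZ.
    case: (Z.eq_dec (vdot o w) 0) => // ne.
    have ut j : j \in tset h o -> udiff (nth b0 h j) (nth b0 w j) = 0%BZ.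
      rewrite mem_filter mem_iota => /andP [/eqP mj /andP [_ lj]].
      apply: u0 => //; case: j mj {lj} => [|[|j]] // mj.
      - by have := pz o 0 po isT; rewrite mj h0 eqxx.
      - by have := pz o 1 po isT; rewrite mj h1 eqxx.
    by have := fiber_dead hs hh gL ws wL (fun j => pz o j po) ut ne; move: xX => /[swap] ->.
  move: od; case: (o) os o0 o1 => [|o_0 [|o_1 o']] //= _ -> ->.
  by case: (w) ws => [|w_0 [|w_1 w']] //= _; rewrite !drop0 /bdot /=; lia.
have wE : drop 2 w = nseq 10 b0.
  by rewrite (bmap_eq0 (dsz w ws) w0' u0') // size_drop hs.
have dx x : x \in L -> (bdot (nth b0 x 0) (nth b0 w 0) + bdot (nth b0 x 1) (nth b0 w 1) = 0)%BZ.
  move=> xL; have := wL _ xL; have [[xs _] _] := config_F gL xL.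
  have N0 z : vdot z (nseq 10 b0) = 0%BZ by rewrite vdotC vdot_nseq0.
  move: (nseq 10 b0) N0 wE => N N0; case: (w) ws => [|w_0 [|w_1 w']] //= _; rewrite drop0 => ->.
  case: x xs {xL} => [|x_0 [|x_1 x']] //= _; rewrite N0; lia.
(* For each of the two zero blocks, an orbit that vanishes in the other one and takes two values in
   this one kills the remaining block of [w]. *)
have zk k : (k < 2)%N -> nth b0 h k = b0 -> nth b0 h (1 - k) = b0 -> has (zorbit h k) (leaders h) ->
    (forall x, x \in L -> nth b0 x (1 - k) = b0 -> bdot (nth b0 x k) (nth b0 w k) = 0%BZ) ->
    nth b0 w k = b0.
  move=> k2 hk hk' /hasP [o oO zo] H.
  have [x [y [xL yL Ex Ey ne]]] := two_values hs hh gL oO (full o oO) zo.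
  have k12 : (k < 12)%N by apply: leq_trans k2 _.
  have k12' : (1 - k < 12)%N by rewrite (leq_ltn_trans (leq_subr _ _)).
  have [/eqP m3 /eqP ok _] := and3P zo; rewrite hk in m3.
  have sx z : z \in L -> size z = 12 by move=> /(config_F gL) [] [].
  have B z j : z \in L -> (j < 12)%N -> nth b0 z j \in short_blocks.
    by move=> zL lj; apply: (all_nth _ (inFz_short (config_F gL zL))); rewrite sx.
  have oE z j : z \in L -> leader h z = o -> (j < 12)%N -> nth b0 o j = bleader (nth b0 h j) (nth b0 z j).
    by move=> zL <- lj; rewrite leader_nth ?hs ?sx.
  have z0 z : z \in L -> leader h z = o -> nth b0 z (1 - k) = b0.
    move=> zL Ez; apply: bleader_b0; first exact: B.
    by have := oE z _ zL Ez k12'; rewrite hk' ok.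
  have ox := oE x k xL Ex k12; have oy := oE y k yL Ey k12; rewrite hk in ox oy.
  apply: (zero_det (B x k xL k12) (B y k yL k12)) => //.
  - by rewrite -ox.
  - by rewrite -ox -oy.
  - exact: H (z0 x xL Ex).
  - exact: H (z0 y yL Ey).
apply: wn; rewrite -(cat_take_drop 2 w) wE.
have -> : take 2 w = [:: b0; b0]; last by [].
have b00 z : bdot b0 z = 0%BZ by [].
have z0 : nth b0 w 0 = b0.
  by apply: zk => // x xL /= x1; have := dx x xL; rewrite x1 b00 Z.add_0_r.
have z1 : nth b0 w 1 = b0.
  by apply: zk => // x xL /= x1; have := dx x xL; rewrite x1 b00.
by case: (w) ws z0 z1 => [|w_0 [|w_1 w']] //= _ -> ->; rewrite take0.
Qed.
End Rigid.

Definition h23 : seq block := [seq dyn p | p <- [:: (0,0); (0,0); (0,3); (0,1); (1,0); (0,1); (0,1); (0,1); (0,1); (0,1); (1,0); (0,1)]].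
(** The inverse of the frame operator of [span_check], times 114048. The value of [tau] chosen with
    it is unconstrained by the budget, which is 0. *)
Definition Q23 : seq (seq Z) :=
  [:: [:: 1683; -495; 495; -495; -495; -495; -495; -495; 495; -495];
   [:: -495; 1403; 37; 107; 107; -37; 107; -37; -107; -37];
   [:: 495; 37; 1403; -107; 37; -107; -107; -107; -37; 37];
   [:: -495; 107; -107; 1403; -37; -37; -37; 107; -107; -37];
   [:: -495; 107; 37; -37; 1403; -37; 107; 107; 37; 107];
   [:: -495; -37; -107; -37; -37; 1403; 107; -37; -107; 107];
   [:: -495; 107; -107; -37; 107; 107; 1403; -37; 37; -37];
   [:: -495; -37; -107; 107; 107; -37; -37; 1403; 37; 107];
   [:: 495; -107; -37; -107; 37; -107; 37; 37; 1403; -107];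
   [:: -495; -37; 37; -37; 107; 107; -37; 107; -107; 1403]]%BZ.

Lemma bounded23 : bounded h23.
Proof.
have T : total_check h23 by vm_cast_no_check (erefl true).
have C : connected_check h23 by vm_cast_no_check (erefl true).
have S : span_check h23 Q23 114048 20016 by vm_cast_no_check (erefl true).
have Z0 : has (zorbit h23 0) (leaders h23) by vm_cast_no_check (erefl true).
have Z1 : has (zorbit h23 1) (leaders h23) by vm_cast_no_check (erefl true).
apply: (rigid_bounded _ _ _ _ _ T C S Z0 Z1) => //; by vm_compute.
Qed.

(** * The bound for all vectors *)

Definition h28 : seq block := [seq dyn p | p <- [:: (1,1); (1,1); (1,1); (0,1); (1,0); (0,1); (0,1); (0,1); (0,1); (0,1); (1,0); (0,1)]].
Definition h26 : seq block := [seq dyn p | p <- [:: (0,1); (0,1); (0,1); (0,1); (0,1); (0,1); (1,0); (0,1); (0,1); (0,1); (0,1); (1,2)]].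
Definition h27 : seq block := [seq dyn p | p <- [:: (0,1); (0,1); (0,1); (0,1); (0,1); (0,1); (1,0); (0,1); (0,1); (0,1); (2,0); (2,0)]].
(** [Q26], [Q27] and [Q28] are multiples, by the constants [Den] of [frame26], [frame27] and
    [frame28], of the inverse frame operators for the cap weights and the extra functionals given
    there. *)
Definition Q26 : seq (seq Z) :=
  [:: [:: 9364; 8194; 8194; 8194; 8194; 8194; -8194; 8194; 8194; 8194; 8194; 24038; 7676];
   [:: 8194; 9364; 8194; 8194; 8194; 8194; -8194; 8194; 8194; 8194; 8194; 24038; 7676];
   [:: 8194; 8194; 9364; 8194; 8194; 8194; -8194; 8194; 8194; 8194; 8194; 24038; 7676];
   [:: 8194; 8194; 8194; 9364; 8194; 8194; -8194; 8194; 8194; 8194; 8194; 24038; 7676];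
   [:: 8194; 8194; 8194; 8194; 9364; 8194; -8194; 8194; 8194; 8194; 8194; 24038; 7676];
   [:: 8194; 8194; 8194; 8194; 8194; 9364; -8194; 8194; 8194; 8194; 8194; 24038; 7676];
   [:: -8194; -8194; -8194; -8194; -8194; -8194; 9364; -8194; -8194; -8194; -8194; -24038; -7676];
   [:: 8194; 8194; 8194; 8194; 8194; 8194; -8194; 9364; 8194; 8194; 8194; 24038; 7676];
   [:: 8194; 8194; 8194; 8194; 8194; 8194; -8194; 8194; 9364; 8194; 8194; 24038; 7676];
   [:: 8194; 8194; 8194; 8194; 8194; 8194; -8194; 8194; 8194; 9364; 8194; 24038; 7676];
   [:: 8194; 8194; 8194; 8194; 8194; 8194; -8194; 8194; 8194; 8194; 9364; 24038; 7676];
   [:: 24038; 24038; 24038; 24038; 24038; 24038; -24038; 24038; 24038; 24038; 24038; 111706; 42622];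
   [:: 7676; 7676; 7676; 7676; 7676; 7676; -7676; 7676; 7676; 7676; 7676; 42622; 18079]]%BZ.
Definition Q27 : seq (seq Z) :=
  [:: [:: 12725; 8150; 8150; 8150; 8150; 8150; -8150; 8150; 8150; 8150; -16225; -16225];
   [:: 8150; 12725; 8150; 8150; 8150; 8150; -8150; 8150; 8150; 8150; -16225; -16225];
   [:: 8150; 8150; 12725; 8150; 8150; 8150; -8150; 8150; 8150; 8150; -16225; -16225];
   [:: 8150; 8150; 8150; 12725; 8150; 8150; -8150; 8150; 8150; 8150; -16225; -16225];
   [:: 8150; 8150; 8150; 8150; 12725; 8150; -8150; 8150; 8150; 8150; -16225; -16225];
   [:: 8150; 8150; 8150; 8150; 8150; 12725; -8150; 8150; 8150; 8150; -16225; -16225];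
   [:: -8150; -8150; -8150; -8150; -8150; -8150; 12725; -8150; -8150; -8150; 16225; 16225];
   [:: 8150; 8150; 8150; 8150; 8150; 8150; -8150; 12725; 8150; 8150; -16225; -16225];
   [:: 8150; 8150; 8150; 8150; 8150; 8150; -8150; 8150; 12725; 8150; -16225; -16225];
   [:: 8150; 8150; 8150; 8150; 8150; 8150; -8150; 8150; 8150; 12725; -16225; -16225];
   [:: -16225; -16225; -16225; -16225; -16225; -16225; 16225; -16225; -16225; -16225; 36938; 32912];
   [:: -16225; -16225; -16225; -16225; -16225; -16225; 16225; -16225; -16225; -16225; 32912; 36938]]%BZ.
Definition Q28 : seq (seq Z) :=
  [:: [:: 17924; 8962; 15524; 7762; 15524; 7762; -7738; 7738; -7738; -7738; -7738; -7738; -7738; 7738; -7738];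
   [:: 8962; 6281; 7762; 3881; 7762; 3881; -3869; 3869; -3869; -3869; -3869; -3869; -3869; 3869; -3869];
   [:: 15524; 7762; 17924; 8962; 15524; 7762; -7738; 7738; -7738; -7738; -7738; -7738; -7738; 7738; -7738];
   [:: 7762; 3881; 8962; 6281; 7762; 3881; -3869; 3869; -3869; -3869; -3869; -3869; -3869; 3869; -3869];
   [:: 15524; 7762; 15524; 7762; 17924; 8962; -7738; 7738; -7738; -7738; -7738; -7738; -7738; 7738; -7738];
   [:: 7762; 3881; 7762; 3881; 8962; 6281; -3869; 3869; -3869; -3869; -3869; -3869; -3869; 3869; -3869];
   [:: -7738; -3869; -7738; -3869; -7738; -3869; 5777; -3869; 3869; 3869; 3869; 3869; 3869; -3869; 3869];
   [:: 7738; 3869; 7738; 3869; 7738; 3869; -3869; 5777; -3869; -3869; -3869; -3869; -3869; 3869; -3869];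
   [:: -7738; -3869; -7738; -3869; -7738; -3869; 3869; -3869; 5777; 3869; 3869; 3869; 3869; -3869; 3869];
   [:: -7738; -3869; -7738; -3869; -7738; -3869; 3869; -3869; 3869; 5777; 3869; 3869; 3869; -3869; 3869];
   [:: -7738; -3869; -7738; -3869; -7738; -3869; 3869; -3869; 3869; 3869; 5777; 3869; 3869; -3869; 3869];
   [:: -7738; -3869; -7738; -3869; -7738; -3869; 3869; -3869; 3869; 3869; 3869; 5777; 3869; -3869; 3869];
   [:: -7738; -3869; -7738; -3869; -7738; -3869; 3869; -3869; 3869; 3869; 3869; 3869; 5777; -3869; 3869];
   [:: 7738; 3869; 7738; 3869; 7738; 3869; -3869; 3869; -3869; -3869; -3869; -3869; -3869; 5777; -3869];
   [:: -7738; -3869; -7738; -3869; -7738; -3869; 3869; -3869; 3869; 3869; 3869; 3869; 3869; -3869; 5777]]%BZ.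
Lemma wall26 : wall_check h26 2 10. Proof. vm_cast_no_check (erefl true). Qed.
Lemma wall27 : wall_check h27 2 11. Proof. vm_cast_no_check (erefl true). Qed.
Lemma wall28 : wall_check h28 2 7. Proof. vm_cast_no_check (erefl true). Qed.
Lemma frame26 : wallrank h26 Q26 (fun o => bclass (nth b0 o 11) != 0) 2 9
  (rcons (funit 11) 2%BZ) 56 3190590 41796.
Proof. vm_cast_no_check (erefl true). Qed.
Lemma frame27 : wallrank h27 Q27 (fun o => 1 < cap h27 o)%N 1 0 [::] 28 10870200 175932.
Proof. vm_cast_no_check (erefl true). Qed.
Lemma frame28 : wallrank h28 Q28 xpredT 1 0 [::] 42 5151600 68688.
Proof. vm_cast_no_check (erefl true). Qed.

Lemma iswall_supp h w j : size h = 12 -> (j < 12)%N ->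
  udiff (nth b0 h j) (nth b0 w j) <> 0%BZ -> iswall (nth b0 h j).
Proof.
move=> hs lj; rewrite /udiff /iswall; case: (nth b0 h j) => [[p q] r].
by case: (Z.eqb p q) => //; case: (Z.eqb q r).
Qed.

Lemma bounded26 : bounded h26.
Proof.
(* The last block has no wall and keeps two coordinates. The functional [Zv] evaluates there to
   [2 (a - c) + 4 (b - c)], twice the product with [(1, 2, -3)]. *)
pose f2 := rcons (nseq 11 b0) (1, 2, -3)%BZ.
apply: (@special_bounded h26 (iota 0 11) 0 f2 _ _ _ _ _ _ _ _ _ _ _ _ _ _ wall26 frame26) => //.
- move=> w ws _ j lj nz; rewrite mem_iota; move: (iswall_supp (w := w) (erefl : size h26 = 12) lj nz).
  by case: j lj {nz} => [|[|[|[|[|[|[|[|[|[|[|[|]]]]]]]]]]]].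
- case=> [|w0 [|w1 [|w2 [|w3 [|w4 [|w5 [|w6 [|w7 [|w8 [|w9 [|w10 [|[[a b] c] [|? ?]]]]]]]]]]]]] // _ _.
  rewrite /f2 /= /bdot /b0 /=; lia.
Qed.

(** All twelve blocks carry a wall and one condition on w is enough, so the zero vector is passed as
    the second. *)
Lemma bounded27 : bounded h27.
Proof.
apply: (@special_bounded h27 (iota 0 12) 0 (nseq 12 b0) _ _ _ _ _ _ _ _ _ _ _ _ _ _ wall27 frame27) => //.
by move=> w _ _ j lj _; rewrite mem_iota.
Qed.

(** The walls are in blocks 3 to 11. The second condition hides the wall in block 4, which leaves
    eight walls and supports of size at most 7. *)
Lemma bounded28 : bounded h28.
Proof.
apply: (@special_bounded h28 [:: 3; 5; 6; 7; 8; 9; 10; 11] 3 (rvec h28 4) _ _ _ _ _ _ _ _ _ _ _ _ _ _ wall28 frame28) => //.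
move=> w ws; rewrite vdot_rvec // => u4 j lj nz.
move: (iswall_supp (w := w) (erefl : size h28 = 12) lj nz); move: nz.
by case: j lj => [|[|[|[|[|[|[|[|[|[|[|[|]]]]]]]]]]]] // _; rewrite ?u4.
Qed.

Definition h0 : seq block := [seq dyn p | p <- [:: (0,0); (0,0); (0,0); (0,0); (0,0); (0,0); (0,0); (0,0); (0,0); (0,0); (0,3); (0,3)]].
Definition reps0 : seq (seq (nat * nat)) :=
  [:: [:: (0,0); (0,0); (0,0); (0,0); (0,0); (0,0); (0,0); (0,0); (0,0); (0,0); (0,3); (0,3)];
   [:: (0,0); (0,0); (0,0); (0,0); (0,0); (0,0); (0,0); (0,0); (0,0); (1,1); (1,1); (2,2)];
   [:: (0,0); (0,0); (0,0); (0,0); (0,0); (0,0); (0,0); (0,0); (1,1); (1,1); (1,1); (0,3)];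
   [:: (0,0); (0,0); (0,0); (0,0); (0,0); (0,0); (1,1); (1,1); (1,1); (1,1); (1,1); (1,1)];
   [:: (0,0); (0,0); (0,0); (0,0); (0,0); (1,1); (1,1); (1,1); (1,1); (1,1); (1,1); (0,0)]].
Definition reps6 : seq (seq (nat * nat)) :=
  [:: [:: (0,1); (0,0); (0,0); (0,0); (0,0); (0,0); (0,0); (0,1); (0,1); (0,1); (0,1); (3,1)];
   [:: (0,1); (0,0); (0,0); (0,0); (0,0); (0,0); (0,0); (0,1); (0,1); (0,1); (1,2); (1,2)];
   [:: (0,1); (0,0); (0,0); (0,0); (0,0); (0,0); (0,0); (0,1); (0,1); (2,0); (2,0); (1,2)];
   [:: (0,1); (0,0); (0,0); (0,0); (0,0); (0,0); (0,0); (0,1); (2,0); (2,0); (2,0); (2,0)];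
   [:: (0,1); (0,0); (0,0); (0,0); (0,0); (0,0); (1,1); (0,1); (0,1); (0,1); (2,0); (1,2)];
   [:: (0,1); (0,0); (0,0); (0,0); (0,0); (0,0); (1,1); (0,1); (0,1); (2,0); (2,0); (2,0)];
   [:: (0,1); (0,0); (0,0); (0,0); (0,0); (0,0); (0,3); (0,1); (0,1); (0,1); (0,1); (2,0)];
   [:: (0,1); (0,0); (0,0); (0,0); (0,0); (0,0); (2,2); (0,1); (0,1); (0,1); (0,1); (0,1)];
   [:: (0,1); (0,0); (0,0); (0,0); (0,0); (1,1); (1,1); (0,1); (0,1); (0,1); (0,1); (1,2)];
   [:: (0,1); (0,0); (0,0); (0,0); (0,0); (1,1); (1,1); (0,1); (0,1); (0,1); (2,0); (2,0)];
   [:: (0,1); (0,0); (0,0); (0,0); (0,0); (1,1); (1,1); (0,1); (2,0); (2,0); (0,1); (0,1)];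
   [:: (0,1); (0,0); (0,0); (0,0); (0,0); (1,1); (0,3); (0,1); (0,1); (0,1); (0,1); (0,1)];
   [:: (0,1); (0,0); (0,0); (0,0); (1,1); (1,1); (1,1); (0,1); (0,1); (0,1); (0,1); (2,0)];
   [:: (0,1); (0,0); (0,0); (1,1); (1,1); (1,1); (1,1); (0,1); (0,1); (0,1); (0,1); (0,1)]].
Definition reps9 : seq (seq (nat * nat)) :=
  [:: [:: (0,0); (0,0); (0,0); (0,1); (1,0); (0,1); (0,1); (0,1); (0,1); (0,1); (0,2); (1,2)];
   [:: (0,0); (0,0); (0,0); (0,1); (1,0); (0,1); (0,1); (0,1); (0,1); (2,0); (0,2); (2,0)];
   [:: (0,0); (0,0); (0,0); (0,1); (1,0); (0,1); (0,1); (0,1); (2,0); (2,0); (0,2); (0,1)];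
   [:: (0,0); (0,0); (1,1); (0,1); (1,0); (0,1); (0,1); (0,1); (0,1); (0,1); (1,0); (1,2)];
   [:: (0,0); (0,0); (1,1); (0,1); (1,0); (0,1); (0,1); (0,1); (0,1); (0,1); (0,2); (2,0)];
   [:: (0,0); (0,0); (0,3); (0,1); (1,0); (0,1); (0,1); (0,1); (0,1); (0,1); (1,0); (0,1)];
   [:: (0,0); (1,1); (1,1); (0,1); (1,0); (0,1); (0,1); (0,1); (0,1); (0,1); (1,0); (2,0)];
   [:: (1,1); (1,1); (1,1); (0,1); (1,0); (0,1); (0,1); (0,1); (0,1); (0,1); (1,0); (0,1)]].
Definition reps12 : seq (seq (nat * nat)) :=
  [:: [:: (0,1); (0,1); (0,1); (0,1); (0,1); (0,1); (1,0); (0,1); (0,1); (0,1); (0,1); (1,2)];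
   [:: (0,1); (0,1); (0,1); (0,1); (0,1); (0,1); (1,0); (0,1); (0,1); (0,1); (2,0); (2,0)]].
Definition special : seq (seq block) := [:: h0; h23; h26; h27; h28].
Lemma tetrad0 : tetrad_check h0. Proof. vm_cast_no_check (erefl true). Qed.
Lemma cap_reps : all (fun p => let h := [seq dyn q | q <- p] in (h \in special) || cap_check h)
  (reps0 ++ reps6 ++ reps9 ++ reps12).
Proof. vm_cast_no_check (erefl true). Qed.
Lemma cover0 : cover_check gens0 word0 reps0. Proof. vm_cast_no_check (erefl true). Qed.
Lemma cover6 : cover_check gens6 word6 reps6. Proof. vm_cast_no_check (erefl true). Qed.
Lemma cover9 : cover_check gens9 word9 reps9. Proof. vm_cast_no_check (erefl true). Qed.
Lemma cover12 : cover_check gens12 word12 reps12. Proof. vm_cast_no_check (erefl true). Qed.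

Lemma bounded_rep p : p \in reps0 ++ reps6 ++ reps9 ++ reps12 -> bounded [seq dyn q | q <- p].
Proof.
move=> /(allP cap_reps) /=; case: (boolP (_ \in special)) => [S _|_ /cap_bounded //].
move: S; rewrite /special !inE => /or4P [|||/orP []] /eqP ->.
- exact: tetrad_bounded tetrad0.
- exact: bounded23.
- exact: bounded26.
- exact: bounded27.
- exact: bounded28.
Qed.

Lemma gens_ok : all (fun g => gok2 g && gok2 (ginv g)) (gens0 ++ gens6 ++ gens9 ++ gens12).
Proof. by vm_compute. Qed.

Theorem bounded108 h : inNz h -> vdot h h = 108%BZ -> bounded h.
Proof.
apply: bounded_all => w; have := gens_ok; rewrite !all_cat => /and4P [g0 g6 g9 g12].
have B (r : seq (seq (nat * nat))) : {subset r <= reps0 ++ reps6 ++ reps9 ++ reps12} ->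
    {in r, forall p, bounded [seq dyn q | q <- p]} by move=> s p /s; apply: bounded_rep.
rewrite !inE => /or4P [] /eqP ->.
- by apply: (cover_checkP g0 cover0); apply: B => p pr; rewrite !mem_cat pr.
- by apply: (cover_checkP g6 cover6); apply: B => p pr; rewrite !mem_cat pr orbT.
- by apply: (cover_checkP g9 cover9); apply: B => p pr; rewrite !mem_cat pr !orbT.
- by apply: (cover_checkP g12 cover12); apply: B => p pr; rewrite !mem_cat pr !orbT.
Qed.

Local Open Scope ring_scope.

Theorem theorem6p1 :
  forall (h : vec) (L : seq vec),
    inN h -> dot h h = 12 ->
    uniq L -> (forall l, l \in L -> inF h l) -> geometric h L ->
    (size L <= 350)%N.
Proof.
move=> h L Nh hh uL FL [_ [adm [S [[subS [spanS _]] [_ [r [n [[B [_ [_ SB]]] [_ [r21 _]]]]]]]]]].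
rewrite -(size_map toZ).
apply: (bounded108 (inNz_toZ Nh) _ (config_toZ Nh uL FL adm subS spanS SB r21)).
by apply: qz_inj; rewrite vdot_toZ ?hh //; apply: inN_integral.
Qed.
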